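(* There exist unital odd twisted spectral triples of the form $(\mathcal{A},H,F\mathrm{e}^{|D|},\mathrm{Ad}_{\mathrm{e}^{|D|}})$ that are regular, finitely summable, have discrete dimension spectrum, and pair non-trivially with $K_1(\mathcal{A})$, and such that the cochain $(\phi_m)_{m\geq 1,\ m\text{ odd}}$ provided by Moscovici's ansatz for a twisted local index formula is identically zero.
   Context: Here $D$ is a self-adjoint operator on the Hilbert space $H$, $F$ is its phase (a self-adjoint unitary with $D=F|D|$), and $\mathrm{Ad}_{\mathrm{e}^{|D|}}(a)=\mathrm{e}^{|D|}a\mathrm{e}^{-|D|}$. Below, $\mathcal{D}:=F\mathrm{e}^{|D|}$ (so $\mathcal{D}$ is invertible, $|\mathcal{D}|=\mathrm{e}^{|D|}$, and $\mathcal{D}|\mathcal{D}|^{-1}=F$) and $\sigma(a)=|\mathcal{D}|a|\mathcal{D}|^{-1}$. An (odd) twisted spectral triple $(\mathcal{A},H,\mathcal{D},\sigma)$: a $*$-algebra $\mathcal{A}$ of bounded operators on $H$, an algebra automorphism $\sigma$ of $\mathcal{A}$ with $\sigma(a)^*=\sigma^{-1}(a^* )$, and a self-adjoint operator $\mathcal{D}$ such that for all $a\in\mathcal{A}$: $a\operatorname{Dom}(\mathcal{D})\subset\operatorname{Dom}(\mathcal{D})$, $[\mathcal{D},a]_\sigma:=\mathcal{D}a-\sigma(a)\mathcal{D}$ is bounded, and $a(1+\mathcal{D}^2)^{-1/2}$ is compact. It is unital if $\mathcal{A}$ is unital with unit acting as the identity. It is finitely summable if $(i+\mathcal{D})^{-1}\in\mathcal{L}^p(H)$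 for some $p>0$. It is regular if there is a $*$-algebra $\mathcal{B}\subseteq\mathbb{B}(H)$ containing $\mathcal{A}$ and $[\mathcal{D},\mathcal{A}]_\sigma$, to which $\sigma$ extends as a linear isomorphism $\theta:\mathcal{B}\to\mathcal{B}$, such that $\mathcal{B}$ is invariant under $\delta_\theta(b)=|\mathcal{D}|b-\theta(b)|\mathcal{D}|$. For $\mathcal{D}$ invertible and $\sigma=\mathrm{Ad}_{|\mathcal{D}|}$, let $\Psi$ be the algebra of operators (on $\bigcap_k\operatorname{Dom}(|\mathcal{D}|^k)$) generated by $F$, $\mathcal{A}$, $[\mathcal{D},\mathcal{A}]_\sigma$ and the powers $|\mathcal{D}|^k$, $k\in\mathbb{Z}$, with $\sigma(T)=|\mathcal{D}|T|\mathcal{D}|^{-1}$ for $T\in\Psi$. The triple has discrete dimension spectrum if there is a discrete set $\mathrm{Sd}\subseteq\mathbb{C}$ such that for every $T\in\Psi$ the function $\zeta_T(z)=\operatorname{Tr}(T|\mathcal{D}|^{-2z})$, defined for $\mathrm{Re}(z)\gg0$, extends meromorphically to $\mathbb{C}$ and is holomorphic outside $\mathrm{Sd}$. For $T\in\Psi$ set $T^{(0)}=T$, $T^{(k)}=\mathcal{D}^2T^{(k-1)}-\sigma^2(T^{(k-1)})\mathcal{D}^2$, and $\tau_j(T)=\mathrm{Res}_{z=0}\,z^j\operatorname{Tr}(T|\mathcal{D}|^{-2z})$. Moscovici's ansatz (odd case): for $m\ge1$ odd, $j\in\mathbb{N}$, $\Bbbk=(k_1,\dots,k_m)\in\mathbb{N}^m$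 (with $0\in\mathbb{N}$), $|\Bbbk|=k_1+\cdots+k_m$, $$\phi_{m,j,\Bbbk}(a_0,\dots,a_m)=\tau_j\Big(Fa_0[\mathcal{D},\sigma^{-2k_1-1}(a_1)]_\sigma^{(k_1)}\cdots[\mathcal{D},\sigma^{-2(k_1+\cdots+k_m)-1}(a_m)]_\sigma^{(k_m)}|\mathcal{D}|^{-2|\Bbbk|-m}\Big),$$ $$\phi_m(a_0,\dots,a_m)=\sum_{\Bbbk\in\mathbb{N}^m}(-1)^{|\Bbbk|}\alpha(\Bbbk)\sum_{j=0}^{|\Bbbk|+(m-1)/2}\tilde\sigma_{|\Bbbk|+(m-1)/2,\,j}\ \phi_{m,j,\Bbbk}(a_0,\dots,a_m),$$ for $a_0,\dots,a_m\in\mathcal{A}$, where $\alpha(\Bbbk)^{-1}=k_1!\cdots k_m!\,(k_1+1)(k_1+k_2+2)\cdots(|\Bbbk|+m)$ and $\prod_{l=0}^{n-1}(z+l+\tfrac12)=\sum_{j=0}^n z^j\tilde\sigma_{n,j}$. The triple pairs non-trivially with $K_1(\mathcal{A})$ if there is a class $x\in K_1(\mathcal{A})$ such that $\langle[(\mathcal{A},H,\mathcal{D},\sigma)],x\rangle\neq0$, where for a unitary $u$ over $\mathcal{A}$ (in $\mathcal{A}$ or a matrix algebra over it) $\langle[(\mathcal{A},H,\mathcal{D},\sigma)],[u]\rangle=\mathrm{Index}(PuP:PH\to PH)$, $P=(F+1)/2$ (suitably amplified). *)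

(* Defs.v *)
From HB Require Import structures.
From mathcomp Require Import all_boot all_order all_algebra.
From mathcomp Require Import complex.
From mathcomp Require Import all_classical all_reals all_analysis.
From mathcomp Require summability.
Set Implicit Arguments.
Unset Strict Implicit.
Unset Printing Implicit Defensive.
Import Order.TTheory GRing.Theory Num.Theory numFieldNormedType.Exports.
Local Open Scope classical_set_scope.
Local Open Scope ring_scope.

(* Unconditional convergence: limit of the finite partial sums along the
   directed set of finite subsets of the index set. *)
Definition sums_to (K : numFieldType) (V : normedModType K) (I : choiceType)
    (x : I -> V) (s : V) : Prop :=
  summability.partial_sum x @ summability.totally --> s.

Section ComplexAnalysis.
Variable R : realType.
(* R[i] carries its normed-space structure over itself as R[i]^o. *)
Local Notation C := (R[i]^o).

Definition holomorphic_at (f : C -> C) (z0 : C) : Prop :=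
  \forall z \near z0, derivable f z 1.

(* Meromorphic on the whole plane; values at the poles are irrelevant. *)
Definition meromorphic (f : C -> C) : Prop :=
  forall z0 : C, exists (n : nat) (g : C -> C),
    holomorphic_at g z0 /\ \forall z \near z0^', f z = g z / (z - z0) ^+ n.

(* c is the coefficient of (z - z0)^-1 in the Laurent expansion at z0. *)
Definition is_residue (f : C -> C) (z0 c : C) : Prop :=
  exists (n : nat) (b : nat -> C) (h : C -> C),
    [/\ holomorphic_at h z0,
        \forall z \near z0^',
          f z = \sum_(k < n.+1) b k / (z - z0) ^+ k.+1 + h z
      & c = b 0%N].

Definition cexp (z : R[i]) : R[i] :=
  ((expR (complex.Re z) * cos (complex.Im z)) +i*
   (expR (complex.Re z) * sin (complex.Im z)))%C.

(* t^w for t > 0; the value elsewhere plays no role, as cpow is only applied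
   to positive invertible operators. *)
Definition cpow (t : R) (w : R[i]) : R[i] :=
  if 0 < t then cexp (w * (ln t)%:C%C) else 0.

End ComplexAnalysis.

Record hilbert (R : realType) := Hilbert {
  hsort :> completeNormedModType R[i];
  ip : hsort -> hsort -> R[i];
  ip_scalar : forall z, scalar (ip^~ z);
  ip_conj : forall x y, ip y x = (ip x y)^*%C;
  ip_norm : forall x, ip x x = `|x| ^+ 2 }.

Section Operators.
Variables (R : realType) (H : hilbert R).
Local Notation C := R[i].

Definition bounded_op (a : H -> H) : Prop :=
  linear a /\ exists M : R, forall x, `|a x| <= M%:C%C * `|x|.

Definition is_adjoint (a b : H -> H) : Prop :=
  forall x y, ip (a x) y = ip x (b y).

(* The closure of the image of the unit ball is compact. *)
Definition compact_op (a : H -> H) : Prop :=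
  bounded_op a /\ compact (closure (a @` [set x | `|x| <= 1])).

Definition rank_le (K : H -> H) (n : nat) : Prop :=
  exists e : 'I_n -> H, forall x, exists c : 'I_n -> C,
    K x = \sum_i c i *: e i.

(* n-th singular value: the distance, in operator norm, from a to the
   operators of rank at most n. *)
Definition singular_value (a : H -> H) (n : nat) : R :=
  inf [set M : R | 0 <= M /\ exists K, [/\ bounded_op K, rank_le K n
                        & forall x, `|a x - K x| <= M%:C%C * `|x|]].

(* The Schatten class L^p(H): p-summable singular values. *)
Definition schatten (p : R) (a : H -> H) : Prop :=
  bounded_op a /\
  (\sum_(0 <= n <oo) ((singular_value a n `^ p)%:E) < +oo)%E.

Definition orthonormal_basis (I : choiceType) (e : I -> H) : Prop :=
  (forall i j, ip (e i) (e j) = (i == j)%:R) /\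
  (forall x, (forall i, ip x (e i) = 0) -> x = 0).

(* For a trace class operator the sum does not depend on the basis. *)
Definition trace_is (a : H -> H) (c : C) : Prop :=
  schatten 1 a /\
  exists (I : choiceType) (e : I -> H), orthonormal_basis e /\
    sums_to (fun i => ip (a (e i)) (e i) : C^o) c.

(* A possibly unbounded operator is represented by its graph, so that equality
   of operators (including equality of domains) is equality of sets. *)
Definition operator := set (H * H).

Implicit Types S T : operator.

Definition graph (a : H -> H) : operator := [set p | p.2 = a p.1].

Definition dom T : set H := [set x | exists y, T (x, y)].

Definition op_comp S T : operator :=
  [set p | exists2 y, T (p.1, y) & S (y, p.2)].

Definition op_inv T : operator := [set p | T (p.2, p.1)].

Definition op_add S T : operator :=
  [set p | exists y z, [/\ S (p.1, y), T (p.1, z) & p.2 = y + z]].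

Definition op_sub S T : operator :=
  [set p | exists y z, [/\ S (p.1, y), T (p.1, z) & p.2 = y - z]].

Definition op_scale (c : C) T : operator :=
  [set p | exists2 y, T (p.1, y) & p.2 = c *: y].

Definition op_restr (W : set H) T : operator := [set p | W p.1 /\ T p].

Definition op_pow T (n : nat) : operator := iter n (op_comp T) (graph id).

Definition op_zpow T (k : int) : operator :=
  match k with
  | Posz n => op_pow T n
  | Negz n => op_pow (op_inv T) n.+1
  end.

Definition op_adj T : operator :=
  [set p | forall x y, T (x, y) -> ip y p.1 = ip x p.2].

Definition linear_op T : Prop :=
  [/\ T (0, 0),
      forall c x y x' y', T (x, y) -> T (x', y') ->
        T (c *: x + x', c *: y + y')
    & forall x y y', T (x, y) -> T (x, y') -> y = y'].

Definition self_adjoint T : Prop :=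
  [/\ linear_op T, dense (dom T) & op_adj T = T].

(* The trace of a densely defined operator with trace class bounded
   extension. *)
Definition has_trace T (c : C) : Prop :=
  exists a, [/\ dense (dom T), T `<=` graph a & trace_is a c].

(* Projection-valued measures on the Borel sets of R. *)
Definition spectral_measure (E : set R -> H -> H) : Prop :=
  [/\ forall B, measurable B ->
        [/\ bounded_op (E B), is_adjoint (E B) (E B) & E B \o E B = E B],
      E setT = id,
      forall B B', measurable B -> measurable B' -> E (B `&` B') = E B \o E B'
    & forall B : nat -> set R, (forall n, measurable (B n)) ->
        trivIset setT B -> forall x,
        series (fun n => E (B n) x) @ \oo --> E (\bigcup_n B n) x].

Definition scalar_measure (E : set R -> H -> H) (x : H) : set R -> \bar R :=
  fun B => (complex.Re (ip (E B x) x))%:E.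

(* S is the integral of f with respect to E: its domain consists of the x with
   f in L^2(mu_x), where mu_x(B) = <E(B) x, x>, and on it <S x, x> is the
   integral of f against mu_x; by polarization this determines S. *)
Definition is_spectral_integral (E : set R -> H -> H) (f : R -> C) S : Prop :=
  [/\ linear_op S,
      forall x, dom S x <->
        (\int[scalar_measure E x]_t (complex.Re (`|f t| ^+ 2))%:E < +oo)%E
    & forall x y, S (x, y) ->
        ip y x =
        (fine (\int[scalar_measure E x]_t (complex.Re (f t))%:E)%E +i*
         fine (\int[scalar_measure E x]_t (complex.Im (f t))%:E)%E)%C].

(* Borel functional calculus, S = f(T): T is self-adjoint exactly when it is the
   integral of the identity against a spectral measure, which is then unique. *)
Definition is_fcalc T (f : R -> C) S : Prop :=
  exists2 E, spectral_measure E &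
    is_spectral_integral E (fun t => t%:C%C) T /\ is_spectral_integral E f S.

Definition is_abs T S : Prop := is_fcalc T (fun t => (`|t|)%:C%C) S.

Definition is_exp T S : Prop := is_fcalc T (fun t => (expR t)%:C%C) S.

(* F is a phase of T, where S = |T|. *)
Definition is_phase T S (F : H -> H) : Prop :=
  [/\ bounded_op F, is_adjoint F F, F \o F = id & T = op_comp (graph F) S].

(* The graph of Ta - s(a)T, with domain {x in Dom T | a x in Dom T}. *)
Definition twisted_comm T (s : (H -> H) -> (H -> H)) (a : H -> H) : operator :=
  op_sub (op_comp T (graph a)) (op_comp (graph (s a)) T).

End Operators.

Section TwistedSpectralTriples.
Variables (R : realType) (H : hilbert R).
Local Notation C := R[i].
(* The data of a triple (A, H, T, s), with T in the role of the twisted Dirac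
   operator and s in that of the automorphism; s is only used on A. *)
Variables (A : set (H -> H)) (T : operator H) (s : (H -> H) -> (H -> H)).

Definition star_algebra (B : set (H -> H)) : Prop :=
  [/\ forall a, B a -> bounded_op a,
      B (fun=> 0),
      forall (c : C) a b, B a -> B b -> B (fun x => c *: a x + b x),
      forall a b, B a -> B b -> B (a \o b)
    & forall a, B a -> exists2 b, B b & is_adjoint a b].

Definition linear_iso (B : set (H -> H)) (t : (H -> H) -> (H -> H)) : Prop :=
  set_bij B B t /\
  forall (c : C) a b, B a -> B b ->
    t (fun x => c *: a x + b x) = (fun x => c *: t a x + t b x).

Definition algebra_automorphism : Prop :=
  linear_iso A s /\ forall a b, A a -> A b -> s (a \o b) = s a \o s b.

Definition s_inv : (H -> H) -> (H -> H) := 'pinv_(fun=> id) A s.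

Definition twisted_spectral_triple : Prop :=
  [/\ star_algebra A,
      algebra_automorphism,
      (* s(a)^* = s^{-1}(a^* ) *)
      forall a b, A a -> is_adjoint a b -> is_adjoint (s a) (s_inv b),
      self_adjoint T
    & forall a, A a ->
      [/\ forall x, dom T x -> dom T (a x),
          exists2 c, bounded_op c & twisted_comm T s a `<=` graph c
        & exists2 K, is_fcalc T (fun t => ((Num.sqrt (1 + t ^+ 2))^-1)%:C%C)
                              (graph K)
                   & compact_op (a \o K)]].

Definition unital : Prop := A id.

Definition finitely_summable : Prop :=
  exists p : R, 0 < p /\
  exists2 b, graph b = op_inv (op_add (graph (fun x => 'i%C *: x)) T)
           & schatten p b.

(* Bounded extensions of the twisted commutators of T with A. *)
Definition twisted_comms : set (H -> H) :=
  [set c | bounded_op c /\ exists2 a, A a & twisted_comm T s a `<=` graph c].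

Definition regular : Prop :=
  exists absT, is_abs T absT /\
  exists (B : set (H -> H)) (theta : (H -> H) -> (H -> H)),
    [/\ star_algebra B,
        A `<=` B /\ twisted_comms `<=` B,
        linear_iso B theta,
        forall a, A a -> theta a = s a
      & forall b, B b -> (forall x, dom absT x -> dom absT (b x)) /\
          exists2 c, B c & twisted_comm absT theta b `<=` graph c].

Section PseudodifferentialCalculus.
Variable absT : operator H. (* |T| *)

Definition smooth_domain : set H :=
  [set x | forall n, dom (op_pow absT n) x].

Local Notation on_smooth := (op_restr smooth_domain).

(* The phase T|T|^{-1}, on the smooth domain. *)
Definition PsiF : operator H := on_smooth (op_comp T (op_inv absT)).

Inductive Psi : operator H -> Prop :=
| Psi_phase : Psi PsiF
| Psi_alg a of A a : Psi (on_smooth (graph a))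
| Psi_comm c of twisted_comms c : Psi (on_smooth (graph c))
| Psi_power (k : int) : Psi (on_smooth (op_zpow absT k))
| Psi_add X Y of Psi X & Psi Y : Psi (op_add X Y)
| Psi_scale (c : C) X of Psi X : Psi (op_scale c X)
| Psi_mul X Y of Psi X & Psi Y : Psi (op_comp X Y).

(* Z is the meromorphic continuation of z |-> Tr(X |T|^{-2z}). *)
Definition is_zeta (X : operator H) (Z : C^o -> C^o) : Prop :=
  meromorphic Z /\
  exists r : R, forall z : C, r < complex.Re z ->
    exists2 P, is_fcalc absT (fun t => cpow t (- (2 * z))) P
             & has_trace (op_comp X P) (Z z).

Definition is_tau (j : nat) (X : operator H) (c : C) : Prop :=
  exists2 Z, is_zeta X Z & is_residue (fun z => z ^+ j * Z z) 0 c.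

Definition Psi_sigma (X : operator H) : operator H :=
  op_comp absT (op_comp X (op_inv absT)).

Definition Psi_diff (X : operator H) : operator H :=
  op_sub (op_comp (op_pow T 2) X)
         (op_comp (Psi_sigma (Psi_sigma X)) (op_pow T 2)).

(* k_1 + ... + k_{i+1}: the entries of k are numbered from 0. *)
Definition psum m (k : {ffun 'I_m -> nat}) (i : 'I_m) : nat :=
  (\sum_(l < m | l <= i) k l)%N.

Definition ksum m (k : {ffun 'I_m -> nat}) : nat := (\sum_l k l)%N.

Definition ansatz_operator m (a : 'I_m.+1 -> H -> H) (k : {ffun 'I_m -> nat})
    : operator H :=
  op_comp PsiF (op_comp (on_smooth (graph (a ord0)))
    (op_comp
      (\big[@op_comp R H/graph id]_(i < m)
         iter (k i) Psi_diff
           (on_smooth (twisted_comm T s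
              (iter (psum k i).*2.+1 s_inv (a (lift ord0 i))))))
      (on_smooth (op_zpow absT (- ((ksum k).*2 + m)%N%:Z))))).

Definition ansatz_alpha m (k : {ffun 'I_m -> nat}) : C :=
  ((\prod_i (k i)`! * \prod_(i < m) (psum k i + i.+1))%N%:R)^-1.

(* Coefficient of z^j in the product of the z + l + 1/2, l = 0, ..., n-1. *)
Definition ansatz_sigma (n j : nat) : C :=
  (\prod_(l < n) ('X + (l%:R + 2^-1)%:P))`_j.

Definition ansatz_term m (k : {ffun 'I_m -> nat}) (t : nat -> C) : C :=
  let n := (ksum k + m.-1./2)%N in
  (-1) ^+ ksum k * ansatz_alpha k * \sum_(j < n.+1) ansatz_sigma n j * t j.

End PseudodifferentialCalculus.

(* Sd is discrete in the sense of complex analysis: it has no accumulation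
   point in the plane. *)
Definition discrete_dimension_spectrum : Prop :=
  exists absT, is_abs T absT /\
  exists Sd : set C^o, limit_point Sd = set0 /\
    forall X, Psi absT X -> exists2 Z, is_zeta absT X Z &
      forall z, ~ Sd z -> holomorphic_at Z z.

(* phi_m(a_0, ..., a_m) is defined and has value v: every residue
   phi_{m,j,k}(a_0, ..., a_m) = t k j exists, and the series over all
   multi-indices k converges unconditionally to v. *)
Definition ansatz_value m (a : 'I_m.+1 -> H -> H) (v : C) : Prop :=
  exists absT, is_abs T absT /\
  exists t : {ffun 'I_m -> nat} -> nat -> C,
    (forall k j, is_tau absT j (ansatz_operator absT a k) (t k j)) /\
    sums_to (fun k : {ffun 'I_m -> nat} => ansatz_term k (t k) : C^o) v.

End TwistedSpectralTriples.

Section OddPairing.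
Variables (R : realType) (H : hilbert R).
Local Notation C := R[i].

(* dim (U / W) = n, for linear subspaces W of U. *)
Definition quotient_dim (V : lmodType C) (U W : set V) (n : nat) : Prop :=
  exists e : 'I_n -> V, (forall i, U (e i)) /\
    forall v, U v -> exists! c : {ffun 'I_n -> C}, W (v - \sum_i c i *: e i).

(* The linear map f : U -> U has finite-dimensional kernel and cokernel, and
   index k. *)
Definition is_index (V : lmodType C) (U : set V) (f : V -> V) (k : int) : Prop :=
  exists p q : nat,
    [/\ quotient_dim [set v | U v /\ f v = 0] [set 0] p,
        quotient_dim U (f @` U) q
      & k = p%:Z - q%:Z].

Definition is_unitary N (u : 'I_N -> 'I_N -> H -> H) : Prop :=
  exists w : 'I_N -> 'I_N -> H -> H,
    [/\ forall i j, is_adjoint (u i j) (w j i),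
        forall i j x, \sum_k u i k (w k j x) = if i == j then x else 0
      & forall i j x, \sum_k w i k (u k j x) = if i == j then x else 0].

Definition pos_proj (F : H -> H) (x : H) : H := 2^-1 *: (F x + x).

(* The range of P = (F + 1)/2, amplified to H^N. *)
Definition hardy N (F : H -> H) : set {ffun 'I_N -> H} :=
  [set v | forall i, pos_proj F (v i) = v i].

Definition toeplitz N (F : H -> H) (u : 'I_N -> 'I_N -> H -> H)
    (v : {ffun 'I_N -> H}) : {ffun 'I_N -> H} :=
  [ffun i => pos_proj F (\sum_j u i j (pos_proj F (v j)))].

(* The class [u] in K_1(A) of a unitary matrix u over A is paired through
   Index(PuP), and it is non-zero for some u. *)
Definition pairs_nontrivially (A : set (H -> H)) (F : H -> H) : Prop :=
  exists (N : nat) (u : 'I_N -> 'I_N -> H -> H) (k : int),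
    [/\ forall i j, A (u i j), is_unitary u,
        is_index (hardy F) (toeplitz F u) k & k <> 0].

End OddPairing.

(* Main.v *)
(* On l2(Z) let D e_n = n e_n, with phase F e_n = e_n for n >= 0 and -e_n for
   n < 0, so that |DD| = e^{|D|} has eigenvalues e^{|n|}. Let A consist of the
   band operators, finite sums of f S^d with S the bilateral shift and f
   constant near each end of Z. Conjugation by e^{|D|} multiplies f S^d by
   e^{|n| - |n+d|}, which is again constant near both ends, so it is an
   automorphism of A. The twisted commutator [DD, a]_s = e^{|D|} [F, a] is a
   matrix with finitely many entries, because sgn n - sgn (n+d) has finite
   support: it lies in A, which makes the triple regular with B = A and with
   vanishing derivation, and it makes every operator of the ansatz a finite
   matrix. The zeta function of a finite matrix is entire, so all the residues
   vanish. In general an operator of Psi is a band operator whose coefficients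
   are combinations of the e^{k|n|} near each end, and its zeta function is a
   combination of exponentials and of geometric series 1 / (1 - e^{k - 2z}).
   Finally PSP is a unilateral shift, of index -1. *)

(* Products of unbounded operators are awkward because each factor carries its own domain. Band
   operators are therefore treated as maps on all complex sequences, and one parameter [K], the set
   of exponents k allowed in the coefficients e^{k|n|}, separates three classes: the empty set gives
   the finite matrices, {0} the algebra A, and all of Z a class containing Psi. Two facts tie these
   maps to graphs. A band operator with any integer exponents preserves the sequences decaying
   faster than every exponential, which form the smooth domain, so composing graphs there amounts to
   composing maps. And the finite matrices absorb unbounded coefficients from either side, so a
   single twisted commutator, present because m >= 1, decides the fate of a whole product in the
   ansatz. One lemma on zeta functions, with poles located through [K], then serves twice: all
   exponents give poles among the points k/2 + i pi l, the empty set gives none. *)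
Require Import Defs.
From HB Require Import structures.
From mathcomp Require Import all_boot all_order all_algebra.
From mathcomp Require Import complex finmap.
From mathcomp Require Import all_classical all_reals all_analysis measurable_realfun.
From mathcomp Require Import ring lra zify.
From mathcomp Require summability.
Set Implicit Arguments.
Unset Strict Implicit.
Unset Printing Implicit Defensive.
Import Order.TTheory GRing.Theory Num.Theory numFieldNormedType.Exports.
Local Open Scope classical_set_scope.
Local Open Scope ring_scope.

(** * Unconditional sums *)

Section Sums.
Context {R : realType} {I : choiceType}.
Implicit Types f g : I -> R.

(* These are only meaningful for nonnegative f; pval f is 0 when the sum is
   infinite. *)
Definition tsum f : \bar R := (\esum_(i in [set: I]) (f i)%:E)%E.
Definition pval f : R := fine (tsum f).
Definition summ f : Prop := (tsum f < +oo)%E.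

Lemma tsum_ge0 f : (forall i, 0 <= f i) -> (0 <= tsum f)%E.
Proof. by move=> f0; apply: esum_ge0 => i _; rewrite lee_fin. Qed.

Lemma pval_ge0 f : (forall i, 0 <= f i) -> 0 <= pval f.
Proof. by move=> f0; apply: fine_ge0; apply: tsum_ge0. Qed.

Lemma pvalE f : (forall i, 0 <= f i) -> summ f -> tsum f = (pval f)%:E.
Proof. by move=> f0 sf; rewrite /pval fineK// ge0_fin_numE// tsum_ge0. Qed.

Lemma le_tsum f g : (forall i, f i <= g i) -> (tsum f <= tsum g)%E.
Proof. by move=> fg; apply: le_esum => i _; rewrite lee_fin. Qed.

Lemma le_summ f g : (forall i, f i <= g i) -> summ g -> summ f.
Proof. by move=> fg; apply: le_lt_trans; apply: le_tsum. Qed.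

Lemma le_pval f g : (forall i, 0 <= f i <= g i) -> summ g -> pval f <= pval g.
Proof.
move=> fg sg; have f0 i : 0 <= f i by case/andP: (fg i).
have fg' i : f i <= g i by case/andP: (fg i).
have g0 i : 0 <= g i := le_trans (f0 i) (fg' i).
rewrite -lee_fin -!pvalE//; first exact: le_tsum.
exact: le_summ sg.
Qed.

Lemma tsum_ge_seq f (s : seq I) : (forall i, 0 <= f i) -> uniq s ->
  ((\sum_(i <- s) f i)%:E <= tsum f)%E.
Proof.
move=> f0 us; apply: esum_ge; exists [set` s]; first by split.
by rewrite -fsbig_seq//= sumEFin.
Qed.

Lemma pval_ge_seq f (s : seq I) : (forall i, 0 <= f i) -> summ f -> uniq s ->
  \sum_(i <- s) f i <= pval f.
Proof. by move=> f0 sf us; rewrite -lee_fin -pvalE// tsum_ge_seq. Qed.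

Lemma pval_ge_term f i : (forall i, 0 <= f i) -> summ f -> f i <= pval f.
Proof.
by move=> f0 sf; have := pval_ge_seq f0 sf (s := [:: i]) isT; rewrite big_seq1.
Qed.

Lemma tsum_le_seq f (M : \bar R) :
  (forall s : seq I, uniq s -> ((\sum_(i <- s) f i)%:E <= M)%E) -> (tsum f <= M)%E.
Proof.
move=> fM; apply: ge_ereal_sup => _ [F [finF _] <-].
by rewrite fsbig_finite//= sumEFin; apply: fM; apply: finmap.fset_uniq.
Qed.

Lemma summ_seq f (M : R) : (forall i, 0 <= f i) ->
  (forall s : seq I, uniq s -> \sum_(i <- s) f i <= M) -> summ f /\ pval f <= M.
Proof.
move=> f0 fM; have le : (tsum f <= M%:E)%E.
  by apply: tsum_le_seq => s us; rewrite lee_fin fM.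
have sf : summ f by apply: le_lt_trans le _; rewrite ltry.
by split => //; rewrite -lee_fin -pvalE.
Qed.

Lemma tsumD f g : (forall i, 0 <= f i) -> (forall i, 0 <= g i) ->
  tsum (fun i => f i + g i) = (tsum f + tsum g)%E.
Proof.
by move=> f0 g0; rewrite /tsum -esumD => // i _; rewrite lee_fin.
Qed.

Lemma summD f g : (forall i, 0 <= f i) -> (forall i, 0 <= g i) ->
  summ f -> summ g -> summ (fun i => f i + g i).
Proof. by move=> f0 g0; rewrite /summ tsumD//; apply: lte_add_pinfty. Qed.

Lemma pvalD f g : (forall i, 0 <= f i) -> (forall i, 0 <= g i) ->
  summ f -> summ g -> pval (fun i => f i + g i) = pval f + pval g.
Proof. by move=> f0 g0 sf sg; rewrite {1}/pval tsumD// fineD// ge0_fin_numE// tsum_ge0. Qed.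

Lemma summZ f (c : R) : 0 <= c -> (forall i, 0 <= f i) ->
  summ f -> summ (fun i => c * f i) /\ pval (fun i => c * f i) <= c * pval f.
Proof.
move=> c0 f0 sf; apply: summ_seq => [i|s us]; first exact: mulr_ge0.
by rewrite -mulr_sumr ler_wpM2l// pval_ge_seq.
Qed.

Lemma pvalZ f (c : R) : 0 <= c -> (forall i, 0 <= f i) ->
  summ f -> pval (fun i => c * f i) = c * pval f.
Proof.
move=> c0 f0 sf; have [scf le] := summZ c0 f0 sf.
apply/eqP; rewrite eq_le le /=.
have [->|cn0] := eqVneq c 0; first by rewrite mul0r pval_ge0// => i; rewrite mul0r.
have cp : 0 < c by rewrite lt_def cn0.
(* The reverse inequality comes from bounding the partial sums of [f] by those of c * f divided by
   c. *)
have [|_] := @summ_seq f (c^-1 * pval (fun i => c * f i)) f0.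
  move=> s us; rewrite ler_pdivlMl// mulr_sumr pval_ge_seq// => i; exact: mulr_ge0.
by rewrite ler_pdivlMl.
Qed.

Lemma summ0 : summ (fun _ : I => 0 : R) /\ pval (fun _ : I => 0 : R) = 0.
Proof.
have [|s0 le0] := @summ_seq (fun=> 0) 0 (fun=> lexx 0).
  by move=> s _; rewrite big1.
by split => //; apply/eqP; rewrite eq_le le0 pval_ge0.
Qed.

Lemma pval_seq f (s : seq I) : uniq s -> (forall i, 0 <= f i) ->
  (forall i, i \notin s -> f i = 0) -> summ f /\ pval f = \sum_(i <- s) f i.
Proof.
move=> us f0 fs; have [|sf le] := @summ_seq f (\sum_(i <- s) f i) f0.
  move=> t ut; rewrite (bigID (mem s))/= [X in _ + X]big1 ?addr0; last first.
    by move=> i /fs.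
  rewrite -big_filter (perm_big [seq i <- s | i \in t]); last first.
    apply: uniq_perm; rewrite ?filter_uniq// => i.
    by rewrite !mem_filter andbC.
  by rewrite big_filter [leRHS](bigID (mem t))/= lerDl sumr_ge0.
split => //; apply/eqP; rewrite eq_le le pval_ge_seq//.
Qed.

(** The tail is expressed through dominated families that vanish on [s]. Remainders of truncated
    vectors and of partial sums have this form, so no sum over the complement of [s] is ever
    formed. *)
Lemma tsum_tail f (e : R) : (forall i, 0 <= f i) -> summ f -> 0 < e ->
  exists2 s : seq I, uniq s &
  forall g, (forall i, 0 <= g i <= f i) -> (forall i, i \in s -> g i = 0) ->
    pval g <= e.
Proof.
move=> f0 sf e0; have fin : tsum f \is a fin_num by rewrite ge0_fin_numE// tsum_ge0.
have [_ [F [finF _] <-]] := ub_ereal_sup_adherent e0 fin.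
rewrite fsbig_finite//= sumEFin => lts.
set s := finmap.enum_fset (fset_set F) in lts.
have us : uniq s by exact: finmap.fset_uniq.
exists s => //.
move=> g gf gs.
have g0 i : 0 <= g i by case/andP: (gf i).
have sg : summ g by apply: le_summ sf => i; case/andP: (gf i).
have [] := @summ_seq g e g0 => // t ut.
have : \sum_(i <- t) g i + \sum_(i <- s) f i <= pval f.
  rewrite (bigID (mem s))/= big1 ?add0r; last by move=> i /gs.
  apply: le_trans (_ : \sum_(i <- [seq i <- t | i \notin s] ++ s) f i <= _).
    by rewrite big_cat lerD2r big_filter ler_sum// => i _; case/andP: (gf i).
  apply: pval_ge_seq => //; rewrite cat_uniq us filter_uniq// andbT.
  by apply/hasPn => i si; rewrite /= mem_filter negb_and negbK si.
have : pval f - e < \sum_(i <- s) f i.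
  by move: lts; rewrite -[ereal_sup _]/(tsum f) pvalE// -EFinB lte_fin.
lra.
Qed.

Lemma pval_eq0 f : (forall i, 0 <= f i) -> summ f -> pval f = 0 -> forall i, f i = 0.
Proof.
move=> f0 sf e0 i; apply/eqP; rewrite eq_le f0 andbT -e0.
exact: pval_ge_term.
Qed.

Definition rsum f : R := pval (fun i => Num.max (f i) 0) - pval (fun i => Num.max (- f i) 0).

Lemma maxr_ge0 (x : R) : 0 <= Num.max x 0. Proof. by rewrite le_max lexx orbT. Qed.

Lemma maxr_sub (x : R) : Num.max x 0 - Num.max (- x) 0 = x.
Proof.
have [x0|x0] := leP 0 x; first by rewrite max_r ?oppr_le0// subr0.
by rewrite max_l ?oppr_ge0 ?(ltW x0)// sub0r opprK.
Qed.

Definition asumm f := summ (fun i => `|f i|).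

Lemma asumm_pos f : asumm f -> summ (fun i => Num.max (f i) 0).
Proof. by apply: le_summ => i; rewrite ge_max normr_ge0 ler_norm. Qed.

Lemma asumm_neg f : asumm f -> summ (fun i => Num.max (- f i) 0).
Proof. by apply: le_summ => i; rewrite ge_max normr_ge0 -normrN ler_norm. Qed.

(** Cross-adding two decompositions of [f] reduces the claim to additivity of nonnegative sums.
    Additivity and homogeneity of [rsum] then follow by supplying suitable decompositions. *)
Lemma rsum_sub f g h : (forall i, 0 <= g i) -> (forall i, 0 <= h i) ->
  summ g -> summ h -> (forall i, f i = g i - h i) -> rsum f = pval g - pval h.
Proof.
move=> g0 h0 sg sh fE.
have sp : summ (fun i => Num.max (f i) 0).
  by apply: le_summ sg => i; rewrite ge_max g0 fE andbT gerBl.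
have sn : summ (fun i => Num.max (- f i) 0).
  by apply: le_summ sh => i; rewrite ge_max h0 fE andbT opprB gerBl.
apply/eqP; rewrite /rsum subr_eq addrAC eq_sym subr_eq; apply/eqP.
rewrite -!pvalD//; try by move=> i; apply: maxr_ge0.
congr pval; apply/funext => i; have := maxr_sub (f i); rewrite fE; lra.
Qed.

Lemma asummZ f (c : R) : asumm f -> asumm (fun i => c * f i).
Proof.
move=> sf; rewrite /asumm; under eq_fun do rewrite normrM.
by have [] := summZ (normr_ge0 c) (fun i => normr_ge0 (f i)) sf.
Qed.

Lemma rsumD f g : asumm f -> asumm g ->
  rsum (fun i => f i + g i) = rsum f + rsum g.
Proof.
move=> sf sg.
rewrite (@rsum_sub _ (fun i => Num.max (f i) 0 + Num.max (g i) 0)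
  (fun i => Num.max (- f i) 0 + Num.max (- g i) 0)).
- rewrite (pvalD _ _ (asumm_pos sf) (asumm_pos sg)); try by move=> i; apply: maxr_ge0.
  rewrite (pvalD _ _ (asumm_neg sf) (asumm_neg sg)); try by move=> i; apply: maxr_ge0.
  by rewrite /rsum opprD addrACA.
- by move=> i; rewrite addr_ge0 ?maxr_ge0.
- by move=> i; rewrite addr_ge0 ?maxr_ge0.
- by apply: summD (asumm_pos sf) (asumm_pos sg) => i; apply: maxr_ge0.
- by apply: summD (asumm_neg sf) (asumm_neg sg) => i; apply: maxr_ge0.
- by move=> i; have := maxr_sub (f i); have := maxr_sub (g i); lra.
Qed.

Lemma rsumN f : rsum (fun i => - f i) = - rsum f.
Proof.
rewrite /rsum opprB; congr (_ - pval _).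
by apply/funext => i; rewrite opprK.
Qed.

Lemma rsumZ f c : asumm f -> rsum (fun i => c * f i) = c * rsum f.
Proof.
move=> sf; wlog c0 : c / 0 <= c => [hw|].
  have [/hw//|/ltW c0] := lerP 0 c.
  have := hw (- c); rewrite oppr_ge0 => /(_ c0).
  under eq_fun do rewrite mulNr; rewrite rsumN mulNr => /eqP.
  by rewrite eqr_opp => /eqP.
rewrite (@rsum_sub _ (fun i => c * Num.max (f i) 0) (fun i => c * Num.max (- f i) 0)).
- rewrite (pvalZ c0 _ (asumm_pos sf)); last by move=> i; apply: maxr_ge0.
  by rewrite (pvalZ c0 _ (asumm_neg sf)) ?mulrBr// => i; apply: maxr_ge0.
- by move=> i; rewrite mulr_ge0 ?maxr_ge0.
- by move=> i; rewrite mulr_ge0 ?maxr_ge0.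
- by have [] := summZ c0 (fun i => maxr_ge0 _) (asumm_pos sf).
- by have [] := summZ c0 (fun i => maxr_ge0 _) (asumm_neg sf).
- by move=> i; rewrite -mulrBr maxr_sub.
Qed.

Lemma rsum_ge0 f : (forall i, 0 <= f i) -> summ f -> rsum f = pval f.
Proof.
move=> f0 sf; rewrite (@rsum_sub f f (fun=> 0))//; last by move=> i; rewrite subr0.
- by rewrite (summ0).2 subr0.
- by case: summ0.
Qed.

Lemma tsum_reindex (h : I -> I) f : bijective h -> tsum (f \o h) = tsum f.
Proof.
move=> bh; have hb : set_bij [set: I] [set: I] h by rewrite setTT_bijective.
by rewrite /tsum [RHS](reindex_esum _ _ _ _ hb).
Qed.

Lemma rsum_reindex (h : I -> I) f : bijective h -> rsum (f \o h) = rsum f.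
Proof.
move=> bh; rewrite /rsum /pval; congr (fine _ - fine _).
  exact: (tsum_reindex (fun i => Num.max (f i) 0) bh).
exact: (tsum_reindex (fun i => Num.max (- f i) 0) bh).
Qed.

End Sums.

(** * The space of square-summable families *)

Section ComplexModulus.
Context {R : realType}.
Implicit Types z w : R[i].

Definition sqn z : R := complex.Re z ^+ 2 + complex.Im z ^+ 2.
Definition cabs z : R := Num.sqrt (sqn z).

Lemma normC_cabs z : `|z| = (cabs z)%:C%C.
Proof. by rewrite normc_def. Qed.

Lemma sqn_ge0 z : 0 <= sqn z. Proof. by rewrite addr_ge0 ?sqr_ge0. Qed.
Lemma cabs_ge0 z : 0 <= cabs z. Proof. exact: sqrtr_ge0. Qed.
Lemma sqnE z : sqn z = cabs z ^+ 2. Proof. by rewrite sqr_sqrtr// sqn_ge0. Qed.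

Lemma cabsM z w : cabs (z * w) = cabs z * cabs w.
Proof. by apply: complexI; rewrite rmorphM/= -!normC_cabs normrM. Qed.

Lemma cabsD z w : cabs (z + w) <= cabs z + cabs w.
Proof. by rewrite -lecR rmorphD/= -!normC_cabs ler_normD. Qed.

Lemma cabsN z : cabs (- z) = cabs z.
Proof. by apply: complexI; rewrite -!normC_cabs normrN. Qed.

Lemma cabsB z w : cabs (z - w) = cabs (w - z).
Proof. by rewrite -cabsN opprB. Qed.

Lemma cabs0 : cabs 0 = 0.
Proof. by apply: complexI; rewrite -!normC_cabs normr0. Qed.

Lemma cabs1 : cabs 1 = 1.
Proof. by apply: complexI; rewrite -!normC_cabs normr1. Qed.

Lemma cabs_real (r : R) : cabs r%:C%C = `|r|.
Proof. by rewrite /cabs /sqn/= expr0n/= addr0 sqrtr_sqr. Qed.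

Lemma cabs_eq0 z : cabs z = 0 -> z = 0.
Proof. by move=> e; apply/eqP; rewrite -normr_eq0 normC_cabs e. Qed.

Lemma cabsX z n : cabs (z ^+ n) = cabs z ^+ n.
Proof. by elim: n => [|n ih]; rewrite ?expr0 ?cabs1// !exprS cabsM ih. Qed.

Lemma cabsV z : cabs z^-1 = (cabs z)^-1.
Proof.
have [->|z0] := eqVneq z 0; first by rewrite invr0 cabs0 invr0.
by apply: complexI; rewrite fmorphV/= -!normC_cabs normfV.
Qed.

Lemma cabs_conj z : cabs (z^*)%C = cabs z.
Proof. by apply: complexI; rewrite -!normC_cabs normcJ. Qed.

Lemma sqn0 : sqn 0 = 0. Proof. by rewrite sqnE cabs0 expr0n. Qed.
Lemma sqnM z w : sqn (z * w) = sqn z * sqn w.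
Proof. by rewrite !sqnE cabsM exprMn. Qed.
Lemma sqn_eq0 z : sqn z = 0 -> z = 0.
Proof. by rewrite sqnE => /eqP; rewrite sqrf_eq0 => /eqP/cabs_eq0. Qed.

(* The weighted square of a sum; the triangle inequality in l2 follows by taking
   for s the quotient of the norms. *)
Lemma sqnD_le z w (s : R) : 0 < s ->
  sqn (z + w) <= (1 + s) * sqn z + (1 + s^-1) * sqn w.
Proof.
case: z w => [a b] [c d] s0; rewrite /sqn/=.
have ss : s * s^-1 = 1 by rewrite mulfV ?gt_eqF.
have E (u v : R) : (u + v) ^+ 2 = (1 + s) * u ^+ 2 + (1 + s^-1) * v ^+ 2
    - s^-1 * (s * u - v) ^+ 2.
  have -> : s^-1 * (s * u - v) ^+ 2 =
      (s * s^-1) * (s * u ^+ 2) - 2 * (s * s^-1) * (u * v) + s^-1 * v ^+ 2 by ring.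
  rewrite ss; ring.
have p (u v : R) : 0 <= s^-1 * (s * u - v) ^+ 2 by rewrite mulr_ge0 ?sqr_ge0// invr_ge0 ltW.
by have := p a c; have := p b d; rewrite (E a c) (E b d); lra.
Qed.

Lemma absRe_le z : `|complex.Re z| <= cabs z.
Proof. by rewrite -lecR -normC_cabs normc_ge_Re. Qed.

Lemma absIm_le z : `|complex.Im z| <= cabs z.
Proof.
rewrite -(ger0_norm (cabs_ge0 z)) -ler_sqr ?nnegrE// !real_normK ?num_real// -sqnE /sqn.
by rewrite lerDr sqr_ge0.
Qed.

Lemma cabs_le_ReIm z : cabs z <= `|complex.Re z| + `|complex.Im z|.
Proof.
rewrite -ler_sqr ?nnegrE ?cabs_ge0 ?addr_ge0// -sqnE /sqn sqrrD !real_normK ?num_real//.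
by rewrite lerD2r lerDl mulrn_wge0 ?mulr_ge0.
Qed.

End ComplexModulus.

Section Ell2.
Context {R : realType} {I : choiceType}.
Implicit Types x y : I -> R[i].

Definition l2 x : Prop := summ (fun i => sqn (x i)).
Definition l2nsq x : R := pval (fun i => sqn (x i)).
Definition l2n x : R := Num.sqrt (l2nsq x).

Lemma l2_le x y (M : R) : (forall i, sqn (x i) <= M * sqn (y i)) -> l2 y ->
  l2 x /\ l2nsq x <= `|M| * l2nsq y.
Proof.
move=> le ly; have le' i : 0 <= sqn (x i) <= `|M| * sqn (y i).
  by rewrite sqn_ge0 (le_trans (le i))// ler_wpM2r ?sqn_ge0 ?ler_norm.
have [s1 s2] := summZ (normr_ge0 M) (fun i => sqn_ge0 (y i)) ly.
split; first by apply: le_summ s1 => i; case/andP: (le' i).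
by apply: le_trans s2; apply: le_pval.
Qed.

Lemma l2nsq_ge0 x : 0 <= l2nsq x. Proof. by apply: pval_ge0 => i; apply: sqn_ge0. Qed.
Lemma l2n_ge0 x : 0 <= l2n x. Proof. exact: sqrtr_ge0. Qed.
Lemma l2nsqE x : l2nsq x = l2n x ^+ 2. Proof. by rewrite sqr_sqrtr ?l2nsq_ge0. Qed.

Lemma l2Z (c : R[i]) x : l2 x -> l2 (fun i => c * x i).
Proof.
by move=> lx; have [] := @l2_le (fun i => c * x i) x (sqn c) _ lx => // i; rewrite sqnM.
Qed.

Lemma l2nZ (c : R[i]) x : l2 x -> l2n (fun i => c * x i) = cabs c * l2n x.
Proof.
move=> lx; rewrite /l2n /l2nsq /cabs -sqrtrM ?sqn_ge0// -pvalZ ?sqn_ge0//.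
  by congr (Num.sqrt (pval _)); apply/funext => i; rewrite sqnM.
by move=> i; apply: sqn_ge0.
Qed.

Lemma l2nsqD_le x y s : l2 x -> l2 y -> 0 < s ->
  l2 (fun i => x i + y i) /\
  l2nsq (fun i => x i + y i) <= (1 + s) * l2nsq x + (1 + s^-1) * l2nsq y.
Proof.
move=> lx ly s0.
have s1 : 0 <= 1 + s by rewrite addr_ge0// ltW.
have s2 : 0 <= 1 + s^-1 by rewrite addr_ge0// invr_ge0 ltW.
have [a1 _] := summZ s1 (fun i => sqn_ge0 (x i)) lx.
have [a2 _] := summZ s2 (fun i => sqn_ge0 (y i)) ly.
have p1 i : 0 <= (1 + s) * sqn (x i) by rewrite mulr_ge0 ?sqn_ge0.
have p2 i : 0 <= (1 + s^-1) * sqn (y i) by rewrite mulr_ge0 ?sqn_ge0.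
have a3 := summD p1 p2 a1 a2.
split; first by apply: le_summ a3 => i; exact: sqnD_le.
rewrite -(pvalZ s1 (fun i => sqn_ge0 (x i)) lx) -(pvalZ s2 (fun i => sqn_ge0 (y i)) ly).
rewrite -pvalD//; apply: le_pval => // i; rewrite sqn_ge0; exact: sqnD_le.
Qed.

Lemma l2D x y : l2 x -> l2 y -> l2 (fun i => x i + y i).
Proof. by move=> lx ly; have [] := l2nsqD_le lx ly ltr01. Qed.

Lemma l2n0_eq0 x : l2 x -> l2n x = 0 -> forall i, x i = 0.
Proof.
move=> lx n0 i; apply: sqn_eq0; apply: (pval_eq0 (f := fun i => sqn (x i))) => //.
  by move=> j; apply: sqn_ge0.
by rewrite -/(l2nsq x) l2nsqE n0 expr0n.
Qed.

Lemma l2nD x y : l2 x -> l2 y -> l2n (fun i => x i + y i) <= l2n x + l2n y.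
Proof.
move=> lx ly.
have [x0|xn0] := eqVneq (l2n x) 0.
  rewrite x0 add0r (_ : (fun i => x i + y i) = y)//.
  by apply/funext => i; rewrite (l2n0_eq0 lx x0) add0r.
have [y0|yn0] := eqVneq (l2n y) 0.
  rewrite y0 addr0 (_ : (fun i => x i + y i) = x)//.
  by apply/funext => i; rewrite (l2n0_eq0 ly y0) addr0.
have xp : 0 < l2n x by rewrite lt_def xn0 l2n_ge0.
have yp : 0 < l2n y by rewrite lt_def yn0 l2n_ge0.
have [_] := l2nsqD_le lx ly (divr_gt0 yp xp).
rewrite !l2nsqE => le.
rewrite -ler_sqr ?nnegrE ?addr_ge0 ?l2n_ge0//; apply: le_trans le _.
by rewrite le_eqVlt; apply/orP; left; apply/eqP; field; rewrite xn0 yn0.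
Qed.

Lemma l2_0 : l2 (fun=> 0).
Proof. by rewrite /l2; under eq_fun do rewrite sqn0; exact: summ0.1. Qed.

Lemma l2n_ge_term x i : l2 x -> cabs (x i) <= l2n x.
Proof.
move=> lx; rewrite ler_sqrt ?l2nsq_ge0//.
by apply: (pval_ge_term (f := fun i => sqn (x i))) => // j; apply: sqn_ge0.
Qed.

Definition ell2_pred : {pred (I -> R[i])} := fun x => `[< l2 x >].

Record ell2 := Ell2 { l2v :> I -> R[i]; _ : l2v \in ell2_pred }.

HB.instance Definition _ := [isSub for l2v].
HB.instance Definition _ := [Choice of ell2 by <:].

Lemma ell2_submod : submod_closed ell2_pred.
Proof.
split; first by rewrite unfold_in; apply/asboolP/l2_0.
move=> c x y; rewrite !unfold_in => /asboolP lx /asboolP ly; apply/asboolP.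
exact: (l2D (l2Z c lx) ly).
Qed.

HB.instance Definition _ := GRing.isSubmodClosed.Build _ _ ell2_pred ell2_submod.
HB.instance Definition _ := [SubChoice_isSubLmodule of ell2 by <:].

Lemma l2vP (x : ell2) : l2 x.
Proof. by case: x => x /=; rewrite unfold_in => /asboolP. Qed.

Definition mkl2 x (lx : l2 x) : ell2 :=
  @Ell2 x (introT (asboolP _) lx).

Lemma ell2_ext (x y : ell2) : (forall i, x i = y i) -> x = y.
Proof. by move=> e; apply: val_inj; apply/funext => i; exact: e. Qed.

Lemma ell2DE (x y : ell2) i : (x + y) i = x i + y i. Proof. by []. Qed.
Lemma ell2ZE c (x : ell2) i : (c *: x) i = c * x i. Proof. by []. Qed.
Lemma ell20E i : (0 : ell2) i = 0. Proof. by []. Qed.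
Lemma ell2NE (x : ell2) i : (- x) i = - x i. Proof. by []. Qed.

Definition ell2norm (x : ell2) : R[i] := (l2n x)%:C%C.

Lemma ell2normD (x y : ell2) : ell2norm (x + y) <= ell2norm x + ell2norm y.
Proof. by rewrite /ell2norm -rmorphD/= lecR l2nD//; exact: l2vP. Qed.

Lemma ell2normZ (c : R[i]) (x : ell2) : ell2norm (c *: x) = `|c| * ell2norm x.
Proof.
by rewrite /ell2norm normC_cabs -rmorphM/= -(l2nZ _ (l2vP x)).
Qed.

Lemma ell2norm0_eq0 (x : ell2) : ell2norm x = 0 -> x = 0.
Proof.
move=> /complexI n0; apply: ell2_ext => i; rewrite ell20E.
exact: l2n0_eq0 (l2vP x) n0 i.
Qed.

HB.instance Definition _ :=
  Lmodule_isNormed.Build R[i] ell2 ell2normD ell2normZ ell2norm0_eq0.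

Lemma ell2_normE (x : ell2) : `|x| = (l2n x)%:C%C. Proof. by []. Qed.


Lemma ell2_cauchyE (F : set_system ell2) : ProperFilter F -> cauchy F ->
  forall e : R, 0 < e -> exists2 A, F A & forall x y : ell2, A x -> A y -> l2n (x - y) < e.
Proof.
move=> FF /cauchyP Fc e e0.
have e2 : (0 : R[i]) < (e / 2)%:C%C by rewrite ltcR divr_gt0.
have [z Fz] := Fc _ e2; exists (ball z (e / 2)%:C%C) => // x y.
rewrite -ball_normE /= => zx zy.
rewrite -ltcR -[(l2n _)%:C%C]/(`|x - y|).
rewrite -(subrKA z) (le_lt_trans (ler_normD _ _))//.
rewrite [X in X%:C%C](splitr e) rmorphD/= ltrD// distrC//.
Qed.

(** Completeness is taken from the real line, so limits are found for 1-Lipschitz real functionals;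
    the real and imaginary parts of a coordinate are of this kind. *)
Lemma ell2_coord_lim (F : set_system ell2) (phi : ell2 -> R) : ProperFilter F -> cauchy F ->
  (forall x y : ell2, `|phi x - phi y| <= l2n (x - y)) ->
  exists l : R, forall e, 0 < e -> F [set x : ell2 | `|phi x - l| <= e].
Proof.
move=> FF Fc phiL.
have : cauchy (phi @ F).
  apply/cauchy_exP => e e0; have [A FA AP] := ell2_cauchyE FF Fc e0.
  have [a Aa] := filter_ex FA.
  exists (phi a); change (F (phi @^-1` ball (phi a) e)).
  apply: filterS FA => x Ax.
  rewrite -ball_normE /=; apply: le_lt_trans (phiL _ _) _; exact: AP.
move/cauchy_cvgP => phic; exists (lim (phi @ F)) => e e0.
have /cvgrPdist_le/(_ e e0) := phic.
change (F [set x | `|lim (phi @ F) - phi x| <= e] -> F [set x : ell2 | `|phi x - lim (phi @ F)| <= e]).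
by apply: filterS => x /=; rewrite distrC.
Qed.

Lemma ell2_coords_lim (F : set_system ell2) : ProperFilter F -> cauchy F ->
  exists c : I -> R[i], forall i e, 0 < e -> F [set x : ell2 | cabs (x i - c i) <= e].
Proof.
move=> FF Fc.
have H i : exists c : R[i], forall e, 0 < e -> F [set x : ell2 | cabs (x i - c) <= e].
  have [|a aP] := @ell2_coord_lim F (fun x : ell2 => complex.Re (x i)) FF Fc.
    move=> x y; apply: le_trans (_ : cabs (x i - y i) <= _).
      by rewrite -raddfB; exact: absRe_le.
    exact: (l2n_ge_term i (l2vP (x - y))).
  have [|b bP] := @ell2_coord_lim F (fun x : ell2 => complex.Im (x i)) FF Fc.
    move=> x y; apply: le_trans (_ : cabs (x i - y i) <= _).
      by rewrite -raddfB; exact: absIm_le.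
    exact: (l2n_ge_term i (l2vP (x - y))).
  exists (a +i* b)%C => e e0.
  have e2 : 0 < e / 2 by rewrite divr_gt0.
  apply: filterS2 (aP _ e2) (bP _ e2) => x /= xa xb.
  apply: le_trans (cabs_le_ReIm _) _.
  by rewrite (splitr e); apply: lerD; rewrite raddfB.
by have [c cP] := choice H; exists c.
Qed.

Lemma filter_seq (F : set_system ell2) (P : I -> set ell2) (s : seq I) : Filter F ->
  (forall i, F (P i)) -> F [set x : ell2 | forall i, i \in s -> P i x].
Proof.
move=> FF FP; elim: s => [|a s ih]; first by apply: filterS filterT.
apply: filterS2 (FP a) ih => x Pa Ps i; rewrite in_cons => /orP[/eqP->//|]; exact: Ps.
Qed.

Lemma ell2_complete (F : set_system ell2) : ProperFilter F -> cauchy F -> cvg F.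
Proof.
move=> FF Fc; have [c cP] := ell2_coords_lim FF Fc.
(* A Fatou argument: if [A] has diameter below [e], each of its members is within 2e in norm of the
   coordinatewise limit [c]. On a finite [s] the comparison goes through some [b] in [A] that is
   close to [c] on [s]. *)
have key (e : R) A : 0 < e -> F A -> (forall x y : ell2, A x -> A y -> l2n (x - y) < e) ->
    forall a, A a -> l2 (fun i => a i - c i) /\ l2nsq (fun i => a i - c i) <= 4 * e ^+ 2.
  move=> e0 FA AP a Aa; apply: summ_seq => [i|s us]; first exact: sqn_ge0.
  (* This size makes the sum of h^2 over [s] at most e^2. *)
  set h := e / (size s).+1%:R.
  have h0 : 0 < h by rewrite divr_gt0.
  have FB : F [set x : ell2 | forall i, i \in s -> cabs (x i - c i) <= h].
    by apply: filter_seq => i; exact: cP.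
  have [b [Ab bc]] := filter_ex (filterI FA FB).
  apply: le_trans (_ : \sum_(i <- s) (2 * sqn ((a - b) i) + 2 * h ^+ 2) <= _).
    rewrite big_seq [leRHS]big_seq; apply: ler_sum => i si.
    have -> : a i - c i = (a - b) i + (b i - c i) by rewrite /= subrKA.
    have := sqnD_le ((a - b) i) (b i - c i) ltr01; rewrite invr1.
    move/le_trans; apply; rewrite lerD2l ler_wpM2l// sqnE ler_sqr ?nnegrE ?cabs_ge0 ?(ltW h0)//.
    exact: bc.
  rewrite big_split/= -mulr_sumr big_const_seq iter_addr_0 count_predT.
  have H1 : \sum_(i <- s) sqn ((a - b) i) <= e ^+ 2.
    apply: le_trans (pval_ge_seq (fun i => sqn_ge0 ((a - b) i)) (l2vP (a - b)) us) _.
    rewrite -/(l2nsq _) l2nsqE ler_sqr ?nnegrE ?l2n_ge0 ?(ltW e0)//.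
    by apply/ltW/AP.
  have H2 : h ^+ 2 *+ size s <= e ^+ 2.
    rewrite /h expr_div_n -mulrnAl -mulr_natr -mulrA ler_piMr ?sqr_ge0//.
    rewrite ler_pdivrMr ?exprn_gt0// mul1r -natrX ler_nat.
    by rewrite expnS expn1 (leq_trans (leqnSn _))// leq_pmulr.
  rewrite -mulrnAr; lra.
have [A FA AP] := ell2_cauchyE FF Fc ltr01.
have [a Aa] := filter_ex FA.
have [lac _] := key _ _ ltr01 FA AP a Aa.
have lc : l2 c.
  have := l2D (l2vP a) (l2Z (-1) lac); congr l2; apply/funext => i; ring.
apply/cvg_ex; exists (mkl2 lc); apply/cvgrPdist_le => e e0.
have er : e = (complex.Re e)%:C%C by rewrite RRe_real// realE (ltW e0).
have e1 : 0 < complex.Re e by rewrite -ltcR -er.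
have e2 : 0 < complex.Re e / 2 by rewrite divr_gt0.
have [B FB BP] := ell2_cauchyE FF Fc e2.
apply: (filterS _ FB) => x Bx; have [_ lx] := key _ _ e2 FB BP x Bx.
rewrite er distrC ell2_normE lecR -ler_sqr ?nnegrE ?l2n_ge0 ?(ltW e1)//.
by rewrite -l2nsqE; apply: le_trans lx _; rewrite expr_div_n; lra.
Qed.

HB.instance Definition _ := Uniform_isComplete.Build ell2 ell2_complete.

End Ell2.

(** * Inner product, standard basis and density in l2 *)

Section Ell2Hilbert.
Context {R : realType} {I : choiceType}.
Implicit Types f g : I -> R[i].

Lemma ReIm_eq (z w : R[i]) :
  complex.Re z = complex.Re w -> complex.Im z = complex.Im w -> z = w.
Proof. by case: z w => [a b] [c d] /= -> ->. Qed.

Definition csumm f := summ (fun i => cabs (f i)).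
Definition csum f : R[i] :=
  (rsum (fun i => complex.Re (f i)) +i* rsum (fun i => complex.Im (f i)))%C.

Lemma csumm_Re f : csumm f -> asumm (fun i => complex.Re (f i)).
Proof. by apply: le_summ => i; exact: absRe_le. Qed.

Lemma csumm_Im f : csumm f -> asumm (fun i => complex.Im (f i)).
Proof. by apply: le_summ => i; exact: absIm_le. Qed.

Lemma csummD f g : csumm f -> csumm g -> csumm (fun i => f i + g i).
Proof.
move=> sf sg; apply: (@le_summ _ _ _ (fun i => cabs (f i) + cabs (g i))) => [i|].
  exact: cabsD.
by apply: summD sf sg => i; exact: cabs_ge0.
Qed.

Lemma csummZ c f : csumm f -> csumm (fun i => c * f i).
Proof.
move=> sf; rewrite /csumm; under eq_fun do rewrite cabsM.
by have [] := summZ (cabs_ge0 c) (fun i => cabs_ge0 (f i)) sf.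
Qed.

Lemma csumD f g : csumm f -> csumm g -> csum (fun i => f i + g i) = csum f + csum g.
Proof.
move=> sf sg; apply: ReIm_eq; rewrite raddfD /=.
  rewrite -(rsumD (csumm_Re sf) (csumm_Re sg)); congr rsum.
  by apply/funext => i; rewrite raddfD.
rewrite -(rsumD (csumm_Im sf) (csumm_Im sg)); congr rsum.
by apply/funext => i; rewrite raddfD.
Qed.

Lemma csumZ c f : csumm f -> csum (fun i => c * f i) = c * csum f.
Proof.
move=> sf; case: c => a b.
have sR := csumm_Re sf; have sI := csumm_Im sf.
apply: ReIm_eq => /=.
  rewrite -[- (b * _)]mulNr -!rsumZ// -rsumD; try exact: asummZ.
  by congr rsum; apply/funext => i; case: (f i) => u v /=; rewrite mulNr.
rewrite -!rsumZ// -rsumD; try exact: asummZ.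
by congr rsum; apply/funext => i; case: (f i).
Qed.

Lemma csum_conj f : csum (fun i => (f i)^*%C) = (csum f)^*%C.
Proof.
apply: ReIm_eq => /=; last rewrite -rsumN.
all: by congr rsum; apply/funext => i; case: (f i).
Qed.

Lemma rsum_single (h : I -> R) i0 : (forall i, i != i0 -> h i = 0) -> rsum h = h i0.
Proof.
move=> h0; rewrite /rsum.
have H (k : I -> R) : (forall i, 0 <= k i) -> (forall i, i != i0 -> k i = 0) -> pval k = k i0.
  move=> k0 kz; have kz' i : i \notin [:: i0] -> k i = 0 by rewrite inE => /kz.
  by rewrite (pval_seq (isT : uniq [:: i0]) k0 kz').2 big_seq1.
rewrite !H ?maxr_sub//; first [by move=> i; exact: maxr_ge0 |
  by move=> i /h0 ->; rewrite ?oppr0 maxxx].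
Qed.

Lemma csum_single f i0 : (forall i, i != i0 -> f i = 0) -> csum f = f i0.
Proof.
move=> f0; rewrite /csum !(@rsum_single _ i0); first by case: (f i0).
all: by move=> i /f0 ->.
Qed.

Lemma csum_reindex (h : I -> I) f : bijective h -> csum (f \o h) = csum f.
Proof.
move=> bh; apply: ReIm_eq.
  exact: (rsum_reindex (fun i => complex.Re (f i)) bh).
exact: (rsum_reindex (fun i => complex.Im (f i)) bh).
Qed.

Lemma csumm_l2 (x y : I -> R[i]) : l2 x -> l2 y -> csumm (fun i => x i * (y i)^*%C).
Proof.
move=> lx ly; apply: (@le_summ _ _ _ (fun i => sqn (x i) + sqn (y i))).
  move=> i; rewrite cabsM cabs_conj !sqnE.
  have := sqr_ge0 (cabs (x i) - cabs (y i)).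
  have := mulr_ge0 (cabs_ge0 (x i)) (cabs_ge0 (y i)).
  by rewrite sqrrB; lra.
by apply: summD => // i; exact: sqn_ge0.
Qed.

Definition ell2ip (x y : ell2) : R[i] := csum (fun i : I => x i * (y i)^*%C).

Lemma ell2ip_scalar (z : ell2) : scalar (ell2ip^~ z).
Proof.
move=> c x y; rewrite /ell2ip.
have sx := csumm_l2 (l2vP x) (l2vP z); have sy := csumm_l2 (l2vP y) (l2vP z).
rewrite -(csumZ _ sx) -csumD//; last exact: csummZ.
by congr csum; apply/funext => i; rewrite ell2DE ell2ZE mulrDl mulrA.
Qed.

Lemma ell2ip_conj (x y : ell2) : ell2ip y x = ((ell2ip x y)^*)%C.
Proof.
rewrite /ell2ip -csum_conj; congr csum; apply/funext => i.
by rewrite rmorphM/= conjcK mulrC.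
Qed.

Lemma ell2ip_norm (x : @ell2 R I) : ell2ip x x = `|x| ^+ 2.
Proof.
have E i : x i * (x i)^*%C = (sqn (x i))%:C%C.
  by rewrite -sqr_normc normC_cabs -rmorphXn/= -sqnE.
rewrite ell2_normE -rmorphXn/= -l2nsqE; apply: ReIm_eq => /=.
  transitivity (rsum (fun i => sqn (x i))).
    by congr rsum; apply/funext => i; rewrite E.
  by rewrite rsum_ge0//; [move=> i; exact: sqn_ge0|exact: l2vP].
transitivity (rsum (fun _ : I => 0 : R)).
  by congr rsum; apply/funext => i; rewrite E.
by rewrite rsum_ge0 ?(summ0).2//; exact: summ0.1.
Qed.

Definition ell2_hilbert : hilbert R :=
  @Hilbert R (@ell2 R I) ell2ip ell2ip_scalar ell2ip_conj ell2ip_norm.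

Lemma l2_fin (s : seq I) (x : I -> R[i]) : (forall i, i \notin s -> x i = 0) -> l2 x.
Proof.
move=> xs.
have x0 i : i \notin undup s -> sqn (x i) = 0.
  by rewrite mem_undup => /xs ->; rewrite sqn0.
exact: (pval_seq (undup_uniq s) (fun i => sqn_ge0 (x i)) x0).1.
Qed.

Lemma delta_l2 (i : I) : l2 (fun j => (j == i)%:R : R[i]).
Proof. by apply: (@l2_fin [:: i]) => j; rewrite inE => /negbTE ->. Qed.

Definition delta (i : I) : @ell2 R I := mkl2 (delta_l2 i).

Lemma deltaE i j : delta i j = (j == i)%:R. Proof. by []. Qed.

Lemma ip_delta (x : ell2_hilbert) i : ip x (delta i : ell2_hilbert) = l2v x i.
Proof.
rewrite -[ip _ _]/(ell2ip _ _) /ell2ip (@csum_single _ i).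
  by rewrite deltaE eqxx conjc1 mulr1.
by move=> j /negbTE ji; rewrite deltaE ji conjc0 mulr0.
Qed.

Lemma delta_onb : orthonormal_basis (H := ell2_hilbert) (fun i : I => delta i).
Proof.
split=> [i j|x x0]; first by rewrite ip_delta deltaE eq_sym.
by apply: ell2_ext => i; rewrite -ip_delta x0.
Qed.

(** Every vector is approximated by its truncations to finite sets, which [tsum_tail] chooses.
    Domains of diagonal operators and of the operators whose trace is taken are shown dense this
    way. *)
Lemma ell2_dense (S : set (@ell2 R I)) :
  (forall (s : seq I) (x : @ell2 R I), (forall i, i \notin s -> x i = 0) -> S x) -> dense S.
Proof.
move=> fS O [x Ox] oO.
have : nbhs x O by exact: open_nbhs_nbhs.
rewrite -nbhs_ballE => -[e /= e0 eO].
have er : e = (complex.Re e)%:C%C by rewrite RRe_real// realE (ltW e0).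
have e1 : 0 < complex.Re e by rewrite -ltcR -er.
have e2 : 0 < (complex.Re e / 2) ^+ 2 by rewrite exprn_gt0// divr_gt0.
have [s us sP] := tsum_tail (fun i => sqn_ge0 (x i)) (l2vP x) e2.
have ly : l2 (fun i => if i \in s then x i else 0).
  by apply: (@l2_fin s) => i /negbTE ->.
exists (mkl2 ly); split; last by apply: (fS s) => i /= /negbTE ->.
apply: eO; rewrite -ball_normE /= er ell2_normE ltcR.
apply: le_lt_trans (_ : complex.Re e / 2 < _); last by rewrite ltr_pdivrMr// mulr_natr mulr2n ltrDl.
rewrite -ler_sqr ?nnegrE ?l2n_ge0 ?divr_ge0 ?(ltW e1)// -l2nsqE.
apply: sP => [i|i si]; rewrite ell2DE ell2NE /=.
  rewrite sqn_ge0 /=; case: ifP => _; first by rewrite subrr sqn0 sqn_ge0.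
  by rewrite subr0.
by rewrite si subrr sqn0.
Qed.

End Ell2Hilbert.

(** * Diagonal operators and their functional calculus *)

Lemma conjCM (R : realType) (z w : R[i]) : conjc (z * w) = conjc z * conjc w.
Proof. exact: rmorphM. Qed.

Lemma conjCR (R : realType) (r : R) : conjc (r%:C)%C = (r%:C)%C.
Proof. exact: conjc_real. Qed.

Section DiscreteIntegral.
Context {R : realType} {I : choiceType} (nu : nat -> I) (nub : bijective nu).
Variables (d : I -> R) (c : I -> R) (c0 : forall i, 0 <= c i).

(** With c i = |x_i|^2 this is the scalar spectral measure at x of the diagonal operator with
    eigenvalues [d]; equal eigenvalues add their masses. *)
Definition atomic (B : set R) : \bar R := tsum (fun i => \1_B (d i) * c i).

Lemma tsum_nu (g : I -> R) : (forall i, 0 <= g i) ->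
  tsum g = (\sum_(0 <= n <oo) (g (nu n))%:E)%E.
Proof.
move=> g0; have hb : set_bij [set: nat] [set: I] nu by rewrite setTT_bijective.
rewrite /tsum (reindex_esum _ _ _ _ hb) nneseries_esumT// => n.
by rewrite lee_fin.
Qed.

(** The enumeration [nu] arranges the point masses in a sequence, the form that [mseries] sums. *)
Definition atoms (n : nat) : {measure set R -> \bar R} :=
  mscale (NngNum (c0 (nu n))) (dirac (d (nu n))).

Lemma atomicE : atomic = mseries atoms 0.
Proof.
apply/funext => B; rewrite /atomic tsum_nu.
  apply: eq_eseriesr => n _ /=.
  by rewrite /mscale/= diracE indicE -EFinM mulrC.
by move=> i; rewrite mulr_ge0// indicE.
Qed.

Lemma ge0_integral_atomic (f : R -> R) : measurable_fun setT f ->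
  (forall t, 0 <= f t) ->
  (\int[atomic]_t (f t)%:E)%E = tsum (fun i => f (d i) * c i).
Proof.
move=> mf f0; have mf' : measurable_fun setT (EFin \o f) by exact/measurable_EFinP.
rewrite atomicE ge0_integral_measure_series//; last by move=> t _; rewrite lee_fin.
rewrite tsum_nu; last by move=> i; rewrite mulr_ge0.
apply: eq_eseriesr => n _.
rewrite ge0_integral_mscale//; last by move=> t _; rewrite lee_fin.
by rewrite integral_dirac// diracT mul1e -EFinM mulrC.
Qed.

Lemma integral_atomic (f : R -> R) : measurable_fun setT f ->
  asumm (fun i => f (d i) * c i) ->
  fine (\int[atomic]_t (f t)%:E)%E = rsum (fun i => f (d i) * c i).
Proof.
move=> mf sf.
have -> : (\int[atomic]_t (f t)%:E = \int[atomic]_t ((fun t => (f t)%:E)^\+ t)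
    - \int[atomic]_t ((fun t => (f t)%:E)^\- t))%E by rewrite atomicE integralE.
have -> : (fun t => (f t)%:E)^\+%E = (fun t => (Num.max (f t) 0)%:E).
  by apply/funext => t; rewrite funeposE EFin_max.
have -> : (fun t => (f t)%:E)^\-%E = (fun t => (Num.max (- f t) 0)%:E).
  by apply/funext => t; rewrite funenegE EFin_max.
rewrite !ge0_integral_atomic.
- have Ep : (fun i => Num.max (f (d i)) 0 * c i) = (fun i => Num.max (f (d i) * c i) 0).
    by apply/funext => i; rewrite maxr_pMl// mul0r.
  have En : (fun i => Num.max (- f (d i)) 0 * c i) = (fun i => Num.max (- (f (d i) * c i)) 0).
    by apply/funext => i; rewrite maxr_pMl// mul0r mulNr.
  rewrite Ep En fineB// ge0_fin_numE ?tsum_ge0 //; try by move=> i; exact: maxr_ge0.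
    exact: asumm_pos.
  exact: asumm_neg.
- by apply: measurable_maxr => //; exact: measurableT_comp.
- by move=> t; exact: maxr_ge0.
- by apply: measurable_maxr.
- by move=> t; exact: maxr_ge0.
Qed.

End DiscreteIntegral.

(** * Diagonal operators as graphs, their spectral measures and functions *)

Section Diagonal.
Context {R : realType} {I : choiceType} (nu : nat -> I) (nub : bijective nu).
Local Notation HS := (@ell2_hilbert R I).
Local Notation V := (@ell2 R I).
Implicit Types (f g : I -> R[i]).

(** Both components are square-summable by their type, so the domain is the maximal one without any
    stated condition. *)
Definition Diag f : operator HS :=
  [set p : HS * HS | forall i, (p.2 : V) i = f i * (p.1 : V) i].

(* Multiplication by f, with junk value 0 outside of its maximal domain. *)
Definition mulop f (x : HS) : HS :=
  if pselect (l2 (fun i => f i * (x : V) i)) is left lf then mkl2 lf else 0.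

Lemma mulopE f (x : V) i : l2 (fun i => f i * x i) -> (mulop f x : V) i = f i * x i.
Proof. by move=> lf; rewrite /mulop; case: pselect. Qed.

Definition bounded_fun f := exists2 M : R, 0 <= M & forall i, cabs (f i) <= M.

Lemma bounded_fun_l2 f (M : R) (x : V) : 0 <= M -> (forall i, cabs (f i) <= M) ->
  l2 (fun i => f i * x i) /\ l2n (fun i => f i * x i) <= M * l2n x.
Proof.
move=> Mp fM.
have H j : sqn (f j * x j) <= M ^+ 2 * sqn (x j).
  rewrite sqnM ler_wpM2r ?sqn_ge0// sqnE ler_sqr ?nnegrE ?cabs_ge0//.
have [l1 l2'] := l2_le H (l2vP x); split => //.
rewrite -ler_sqr ?nnegrE ?mulr_ge0 ?l2n_ge0// -l2nsqE exprMn -l2nsqE.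
by move: l2'; rewrite ger0_norm// exprn_ge0.
Qed.

Lemma mulop_bE f (x : V) i : bounded_fun f -> (mulop f x : V) i = f i * x i.
Proof. by move=> [M M0 fM]; apply: mulopE; have [] := bounded_fun_l2 x M0 fM. Qed.

Lemma mulop_bounded f : bounded_fun f -> bounded_op (mulop f).
Proof.
move=> bf; split.
  move=> c x y; apply: ell2_ext => i; rewrite mulop_bE// !ell2DE !ell2ZE !mulop_bE//.
  by rewrite mulrDr mulrCA.
case: (bf) => M M0 fM; exists M => x.
rewrite !ell2_normE -rmorphM/= lecR; have [_] := bounded_fun_l2 x M0 fM.
apply: le_trans; rewrite le_eqVlt; apply/orP; left; apply/eqP; congr l2n.
by apply/funext => i; rewrite mulop_bE.
Qed.

Lemma graph_mulop f : bounded_fun f -> graph (mulop f) = Diag f.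
Proof.
move=> bf; apply/seteqP; split => -[x y]; rewrite /graph /Diag /=.
  by move=> -> i; rewrite mulop_bE.
by move=> H; apply: ell2_ext => i; rewrite H mulop_bE.
Qed.

Lemma dom_Diag f (x : V) : dom (Diag f) x <-> l2 (fun i => f i * x i).
Proof.
split=> [[y /= Hy]|lf].
  by have := l2vP y; congr l2; apply/funext => i; exact: Hy.
by exists (mkl2 lf : V).
Qed.

Lemma linear_Diag f : linear_op (Diag f).
Proof.
split=> /=.
- by move=> i; rewrite mulr0.
- move=> c x y x' y' Hx Hx' i.
  by rewrite !ell2DE !ell2ZE Hx Hx' mulrDr mulrCA.
- by move=> x y y' Hy Hy'; apply: ell2_ext => i; rewrite Hy Hy'.
Qed.

Lemma dense_Diag f : dense (dom (Diag f)).
Proof.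
apply: ell2_dense => s x xs; apply/dom_Diag; apply: (@l2_fin _ _ s) => i /xs ->.
by rewrite mulr0.
Qed.

Lemma ip_ell2 (x y : HS) : ip x y = csum (fun i => (x : V) i * ((y : V) i)^*%C).
Proof. by []. Qed.

Lemma self_adjoint_Diag (d : I -> R) : self_adjoint (Diag (fun i => (d i)%:C%C)).
Proof.
split; [exact: linear_Diag|exact: dense_Diag|].
apply/seteqP; split => -[x y] /= H.
  move=> i.
  (* Testing the adjoint relation on the basis vector e_i reads off y at i. *)
  pose e : V := delta i.
  have He : Diag (fun i => (d i)%:C%C) (e, (d i)%:C%C *: e).
    move=> j; rewrite [LHS](_ : _ = (d i)%:C%C * e j)//=.
    by have [->//|ji] := eqVneq j i; rewrite !mulr0.
  have := H _ _ He.
  rewrite [LHS]ip_conj [RHS]ip_conj => /(congr1 conjc); rewrite !conjcK ip_delta => <-.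
  rewrite [ip x _]ip_conj; have := (ip_scalar x (d i)%:C%C (e : HS) 0).
  rewrite addr0; move=> ->; rewrite ip_conj ip_delta.
  have -> : ip 0 x = 0 by rewrite ip_ell2 (@csum_single _ _ _ i) ?mul0r// => j _; rewrite mul0r.
  by rewrite addr0 conjCM; rewrite conjCR conjcK.
move=> u v Huv; rewrite !ip_ell2; congr csum; apply/funext => i.
by rewrite Huv H conjCM conjCR mulrCA mulrA.
Qed.

Definition diag_proj (d : I -> R) (B : set R) : HS -> HS :=
  mulop (fun i => \1_B (d i)).

Lemma indicC (B : set R) (t : R) : (\1_B t : R[i]) = (\1_B t : R)%:C%C.
Proof. by rewrite !indicE rmorph_nat. Qed.

Lemma bounded_indic (d : I -> R) B : bounded_fun (fun i => \1_B (d i)).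
Proof.
exists 1 => // i; rewrite indicE; case: (_ \in _) => /=; first by rewrite cabs1.
by rewrite cabs0.
Qed.

Lemma diag_projE d B (x : V) i : (diag_proj d B x : V) i = \1_B (d i) * x i.
Proof. by rewrite mulop_bE//; exact: bounded_indic. Qed.

Lemma is_adjoint_mulop f : bounded_fun f ->
  is_adjoint (H := HS) (mulop f) (mulop (fun i => (f i)^*%C)).
Proof.
move=> bf x y; rewrite !ip_ell2; congr csum; apply/funext => i.
have bf' : bounded_fun (fun i => (f i)^*%C).
  by case: bf => M M0 fM; exists M => // j; rewrite cabs_conj.
by rewrite !mulop_bE// conjCM conjcK; ring.
Qed.

Lemma spectral_diag (d : I -> R) : spectral_measure (diag_proj d).
Proof.
split.
- move=> B _; split.
  + exact/mulop_bounded/bounded_indic.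
  + have := is_adjoint_mulop (bounded_indic d B).
    congr is_adjoint; congr mulop; apply/funext => i.
    by rewrite indicC conjCR.
  + apply/funext => x; apply: ell2_ext => i; rewrite /= !diag_projE mulrA.
    by rewrite !indicE; case: (_ \in _); rewrite ?mulr0 ?mulr1.
- by apply/funext => x; apply: ell2_ext => i; rewrite diag_projE indicT mul1r.
- move=> B B' _ _; apply/funext => x; apply: ell2_ext => i; rewrite /= !diag_projE mulrA.
  by rewrite indicI.
- move=> B mB tB x.
  apply/cvgrPdist_le => e e0.
  have er : e = (complex.Re e)%:C%C by rewrite RRe_real// realE (ltW e0).
  set r := complex.Re e in er.
  have r0 : 0 < r by rewrite -ltcR -er.
  have [s us sP] := tsum_tail (fun i => sqn_ge0 ((x : V) i)) (l2vP x) (exprn_gt0 2 r0).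
  pose part N := \big[setU/set0]_(n < N) B n.
  have SE N i : (series (fun n => diag_proj d (B n) x) N : V) i =
      \1_(part N) (d i) * (x : V) i.
    elim: N => [|N ih].
      by rewrite /series /part /= big_geq// big_ord0 indic0 mul0r.
    rewrite seriesSr ell2DE diag_projE ih -mulrDl; congr (_ * _).
    rewrite /part big_ord_recr/= !indicE in_setU -natrD; congr (_%:R).
    case: (boolP (d i \in B N)) => dN; last by rewrite orbF addn0.
    have nd : d i \notin \big[setU/set0]_(i0 < N) B i0.
      apply/negP => /set_mem; rewrite -bigcup_mkord => -[k /= kN Bk].
      have /eqP := tB k N Logic.I Logic.I (ex_intro _ (d i) (conj Bk (set_mem dN))).
      by rewrite ltn_eqF.
    by rewrite (negbTE nd).
  (* [k i] is the index of the piece containing d i, when there is one. Beyond every k i with i in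
     [s], the partial union and the full union agree at d i, so the remainder vanishes on [s] and
     the tail estimate applies. *)
  have hk i : exists n, (\bigcup_n B n) (d i) -> B n (d i).
    have [[n _ Bn]|nB] := pselect ((\bigcup_n B n) (d i)); first by exists n.
    by exists 0%N.
  have [k kP] := choice hk.
  exists (\max_(i <- s) (k i).+1)%N => // N /= sN.
  have zE i : (diag_proj d (\bigcup_n B n) x - series (fun n => diag_proj d (B n) x) N : V) i =
      (\1_(\bigcup_n B n) (d i) - \1_(part N) (d i)) * (x : V) i.
    by rewrite ell2DE ell2NE SE diag_projE mulrBl.
  have sub i : part N (d i) -> (\bigcup_n B n) (d i).
    by rewrite /part -bigcup_mkord => -[n _ Bn]; exists n.
  rewrite er ell2_normE lecR -ler_sqr ?nnegrE ?l2n_ge0 ?(ltW r0)// -l2nsqE.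
  apply: sP => i.
    rewrite sqn_ge0 zE sqnM /= ler_piMl ?sqn_ge0// !indicE.
    case: (boolP (d i \in part N)) => dN.
      by rewrite (mem_set (sub _ (set_mem dN))) subrr sqn0.
    by rewrite subr0; case: (_ \in _); rewrite ?sqn0// sqnE cabs1 expr1n.
  move=> si; rewrite zE !indicE.
  case: (boolP (d i \in \bigcup_n B n)) => dU; last first.
    rewrite (negbTE (_ : d i \notin part N)) ?subrr ?mul0r ?sqn0//.
    by apply: contra dU => /set_mem/sub/mem_set.
  rewrite (_ : d i \in part N) ?subrr ?mul0r ?sqn0//.
  apply/mem_set; rewrite /part -bigcup_mkord; exists (k i); last exact/kP/set_mem.
  apply: leq_trans sN => /=.
  exact: (@leq_bigmax_seq _ s xpredT (fun i => (k i).+1) i si isT).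
Qed.

Definition is_measurable (f : R -> R[i]) :=
  measurable_fun setT (fun t => complex.Re (f t)) /\
  measurable_fun setT (fun t => complex.Im (f t)).

Lemma scalar_measureE d (x : HS) :
  scalar_measure (diag_proj d) x = atomic d (fun i => sqn ((x : V) i)).
Proof.
apply/funext => B; rewrite /scalar_measure /atomic ip_ell2.
have E i : (diag_proj d B x : V) i * conjc ((x : V) i) = (\1_B (d i) * sqn ((x : V) i))%:C%C.
  rewrite diag_projE -mulrA -sqr_normc normC_cabs -rmorphXn/= -sqnE indicC.
  by rewrite -rmorphM.
have le i : \1_B (d i) * sqn ((x : V) i) <= sqn ((x : V) i).
  by rewrite indicE ler_piMl ?sqn_ge0//; case: (_ \in _).
have ge i : 0 <= \1_B (d i) * sqn ((x : V) i).
  by rewrite indicE mulr_ge0 ?sqn_ge0//; case: (_ \in _).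
have sm := le_summ le (l2vP (x : V)).
rewrite /csum /= pvalE//; congr (_%:E); rewrite -rsum_ge0//; congr rsum.
by apply/funext => i; rewrite E.
Qed.

Lemma spectral_integral_diag (d : I -> R) (f : R -> R[i]) : is_measurable f ->
  is_spectral_integral (diag_proj d) f (Diag (fun i => f (d i))).
Proof.
move=> [mRe mIm]; split; first exact: linear_Diag.
  move=> x; rewrite dom_Diag scalar_measureE.
  have -> : (\int[atomic d (fun i => sqn ((x : V) i))]_t (complex.Re (`|f t| ^+ 2))%:E)%E
      = tsum (fun i => sqn (f (d i) * (x : V) i)).
    have E : (fun t => (complex.Re (`|f t| ^+ 2))%:E) = (fun t => (sqn (f t))%:E).
      by apply/funext => t; rewrite normC_cabs -rmorphXn/= -sqnE.
    rewrite E (ge0_integral_atomic nub).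
    - by congr tsum; apply/funext => i; rewrite sqnM.
    - by move=> i; exact: sqn_ge0.
    - by apply: measurable_funD; apply: measurable_funX.
    - by move=> t; exact: sqn_ge0.
  by [].
move=> x y Hxy; rewrite scalar_measureE ip_ell2.
have E i : (y : V) i * conjc ((x : V) i) = f (d i) * (sqn ((x : V) i))%:C%C.
  by rewrite Hxy -mulrA -sqr_normc normC_cabs -rmorphXn/= -sqnE.
have ERe i : complex.Re ((y : V) i * conjc ((x : V) i)) = complex.Re (f (d i)) * sqn ((x : V) i).
  by rewrite E; case: (f (d i)) => u v /=; rewrite mulr0 subr0.
have EIm i : complex.Im ((y : V) i * conjc ((x : V) i)) = complex.Im (f (d i)) * sqn ((x : V) i).
  by rewrite E; case: (f (d i)) => u v /=; rewrite mulr0 add0r.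
have sm := csumm_l2 (l2vP (y : V)) (l2vP (x : V)).
have sR := csumm_Re sm; have sI := csumm_Im sm.
rewrite (funext ERe) in sR; rewrite (funext EIm) in sI.
rewrite !(integral_atomic nub) //; try by move=> i; exact: sqn_ge0.
by rewrite /csum (funext ERe) (funext EIm).
Qed.

(** The projections [diag_proj d] serve as spectral measure for the operator and for its function
    alike. Every absolute value, exponential, inverse square root and complex power below is an
    instance. *)
Lemma fcalc_diag (d : I -> R) (f : R -> R[i]) : is_measurable f ->
  is_fcalc (Diag (fun i => (d i)%:C%C)) f (Diag (fun i => f (d i))).
Proof.
move=> mf; exists (diag_proj d); first exact: spectral_diag.
split; last exact: spectral_integral_diag.
apply: (@spectral_integral_diag d (fun t => t%:C%C)); split => /=.
  exact: measurable_id.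
exact: measurable_cst.
Qed.

End Diagonal.

(** * Coefficient functions and band operators *)

Section Symbols.
Context {R : realType}.
Local Notation C := R[i].
Local Notation sq := (int -> R[i]).
Implicit Types (f g : sq) (K : set int) (k l d m n : int).

(** The eigenvalue at e_n of the k-th power of |DD|. *)
Definition ew k n : R := expR (k%:~R * (`|n|%N)%:R).

Lemma ew_gt0 k n : 0 < ew k n. Proof. exact: expR_gt0. Qed.
Lemma ew_ge0 k n : 0 <= ew k n. Proof. exact: expR_ge0. Qed.
Lemma ewD k l n : ew (k + l) n = ew k n * ew l n.
Proof. by rewrite /ew intrD mulrDl expRD. Qed.
Lemma ew0 n : ew 0 n = 1. Proof. by rewrite /ew mul0r expR0. Qed.
Lemma ewN k n : ew (- k) n * ew k n = 1. Proof. by rewrite -ewD addNr ew0. Qed.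

Lemma ewNr k n : ew k n * ew (- k) n = 1.
Proof. by rewrite mulrC ewN. Qed.

Lemma ewV n : ew (-1) n = (ew 1 n)^-1.
Proof.
apply: (mulIf (lt0r_neq0 (ew_gt0 1 n))).
by rewrite mulVf ?(lt0r_neq0 (ew_gt0 1 n))// ewN.
Qed.

(* The span of the finitely supported functions and of the e^{k|n|}, k in K, cut
   off on either half-line: EP set0 consists of the finitely supported functions,
   EP [set 0] of the functions that are constant near each end of Z. *)
Inductive EP K : sq -> Prop :=
| EP_delta m : EP K (fun n => (n == m)%:R)
| EP_pos k of K k : EP K (fun n => if 0 <= n then (ew k n)%:C%C else 0)
| EP_neg k of K k : EP K (fun n => if 0 <= n then 0 else (ew k n)%:C%C)
| EP_add f g of EP K f & EP K g : EP K (fun n => f n + g n)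
| EP_scale (c : C) f of EP K f : EP K (fun n => c * f n).

Lemma EP_ext K f g : EP K f -> (forall n, f n = g n) -> EP K g.
Proof. by move=> Kf /funext <-. Qed.

Lemma EP_zero K : EP K (fun=> 0).
Proof. by apply: EP_ext (EP_scale 0 (EP_delta K 0)) _ => n; rewrite mul0r. Qed.

Lemma EP_sub K K' f : K `<=` K' -> EP K f -> EP K' f.
Proof.
move=> KK; elim=> [m|k /KK Kk|k /KK Kk|{}f g _ Kf _ Kg|c {}f _ Kf].
- exact: EP_delta. - exact: EP_pos. - exact: EP_neg. - exact: EP_add. - exact: EP_scale.
Qed.

Lemma EP_fin K f (s : seq int) : (forall n, n \notin s -> f n = 0) -> EP K f.
Proof.
elim: s f => [|a s ih] f fs.
  by apply: EP_ext (EP_zero K) _ => n; rewrite fs.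
have Kg : EP K (fun n => f n * (n != a)%:R).
  apply: ih => n ns; have [->|na] := eqVneq n a; first by rewrite mulr0.
  by rewrite fs ?mul0r// inE negb_or na.
apply: EP_ext (EP_add Kg (EP_scale (f a) (EP_delta K a))) _ => n.
by have [->|na] := eqVneq n a; rewrite /= ?mulr0 ?mulr1 ?add0r ?addr0.
Qed.

(** The factor [g] is arbitrary: without exponents only the deltas generate, and a delta times any
    sequence is a multiple of that delta. Hence finite support absorbs exponential growth. *)
Lemma EP_ideal f g : EP set0 f -> EP set0 (fun n => f n * g n).
Proof.
elim=> [m|//|//|{}f h _ Kf _ Kh|c {}f _ Kf].
- apply: (@EP_fin _ _ [:: m]) => n; rewrite inE => /negbTE ->; exact: mul0r.
- by apply: EP_ext (EP_add Kf Kh) _ => n; rewrite mulrDl.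
- by apply: EP_ext (EP_scale c Kf) _ => n; rewrite mulrA.
Qed.

Lemma EP_set0 K f : EP set0 f -> EP K f.
Proof. exact: EP_sub. Qed.

(** Generators on opposite half-lines have product zero, on the same half-line their exponents add,
    and anything involving a delta falls under [EP_ideal]. *)
Lemma EP_mul K f g : (forall k l, K k -> K l -> K (k + l)) ->
  EP K f -> EP K g -> EP K (fun n => f n * g n).
Proof.
move=> KD Kf Kg; elim: Kf => [m|k Kk|k Kk|{}f h _ Kf _ Kh|c {}f _ Kf].
- by apply: EP_set0; apply: EP_ideal; exact: EP_delta.
- elim: Kg => [m|l Kl|l Kl|{}g h _ Kg' _ Kh|c {}g _ Kg'].
  + apply: EP_set0; apply: EP_ext (EP_ideal _ (EP_delta set0 m)) _ => n.
    exact: mulrC.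
  + apply: EP_ext (EP_pos (KD _ _ Kk Kl)) _ => n; case: ifP => n0; last by rewrite mul0r.
    by rewrite ewD rmorphM.
  + by apply: EP_ext (EP_zero K) _ => n; case: ifP => n0; rewrite ?mul0r ?mulr0.
  + by apply: EP_ext (EP_add Kg' Kh) _ => n; rewrite mulrDr.
  + by apply: EP_ext (EP_scale c Kg') _ => n; rewrite mulrCA.
- elim: Kg => [m|l Kl|l Kl|{}g h _ Kg' _ Kh|c {}g _ Kg'].
  + apply: EP_set0; apply: EP_ext (EP_ideal _ (EP_delta set0 m)) _ => n.
    exact: mulrC.
  + by apply: EP_ext (EP_zero K) _ => n; case: ifP => n0; rewrite ?mul0r ?mulr0.
  + apply: EP_ext (EP_neg (KD _ _ Kk Kl)) _ => n; case: ifP => n0; first by rewrite mul0r.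
    by rewrite ewD rmorphM.
  + by apply: EP_ext (EP_add Kg' Kh) _ => n; rewrite mulrDr.
  + by apply: EP_ext (EP_scale c Kg') _ => n; rewrite mulrCA.
- by apply: EP_ext (EP_add Kf Kh) _ => n; rewrite mulrDl.
- by apply: EP_ext (EP_scale c Kf) _ => n; rewrite mulrA.
Qed.

Lemma ewS k n : 0 <= n -> ew k (n + 1) = ew k 1 * ew k n.
Proof.
move=> n0; rewrite /ew -expRD; congr expR.
have -> : (`|(n + 1)%R| = `|n| + 1)%N by lia.
by rewrite natrD absz1; ring.
Qed.

Lemma ewNS k n : n < 0 -> ew k n = ew k 1 * ew k (n + 1).
Proof.
move=> n0; rewrite /ew -expRD; congr expR.
have -> : (`|n| = `|(n + 1)%R| + 1)%N by lia.
by rewrite natrD absz1; ring.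
Qed.

(** Away from the cut a unit shift only scales e^{k|n|} by a constant; the one index that moves
    across the cut is corrected by a delta. *)
Lemma EP_shiftS K f : EP K f -> EP K (fun n => f (n + 1)).
Proof.
elim=> [m|k Kk|k Kk|{}f h _ Kf _ Kh|c {}f _ Kf].
- by apply: EP_ext (EP_delta K (m - 1)) _ => n; congr (_ %:R); lia.
- apply: EP_ext (EP_add (EP_scale (ew k 1)%:C%C (EP_pos Kk)) (EP_delta K (-1))) _ => n.
  case: ifP => n0.
    rewrite ifT; last lia.
    by rewrite ewS// rmorphM/= (_ : n == -1 = false) ?addr0//; lia.
  rewrite mulr0 add0r; case: ifP => n1; last by rewrite (_ : n == -1 = false)//; lia.
  have -> : n = -1 by lia.
  by rewrite eqxx /ew mulr0 expR0.
- apply: EP_ext (EP_scale ((ew k 1)^-1)%:C%C (EP_add (EP_neg Kk)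
    (EP_scale (- (ew k (-1))%:C%C) (EP_delta K (-1))))) _ => n.
  case: ifP => n0.
    rewrite ifT; last lia.
    by rewrite (_ : n == -1 = false) ?mulr0 ?addr0 ?mulr0//; lia.
  have [->|n1] := eqVneq n (-1); first by rewrite mulr1 subrr mulr0.
  rewrite ifF; last lia.
  rewrite mulr0 addr0 (ewNS k (n := n)); last lia.
  by rewrite -rmorphM/= mulKf// gt_eqF// ew_gt0.
- exact: EP_add Kf Kh.
- exact: EP_scale Kf.
Qed.

Lemma EP_shiftP K f : EP K f -> EP K (fun n => f (n - 1)).
Proof.
elim=> [m|k Kk|k Kk|{}f h _ Kf _ Kh|c {}f _ Kf].
- by apply: EP_ext (EP_delta K (m + 1)) _ => n; congr (_ %:R); lia.
- apply: EP_ext (EP_scale ((ew k 1)^-1)%:C%C (EP_add (EP_pos Kk)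
    (EP_scale (- (ew k 0)%:C%C) (EP_delta K 0)))) _ => n.
  have [->|n1] := eqVneq n 0; first by rewrite /= mulr1 subrr mulr0.
  rewrite mulr0 addr0; case: ifP => n0; last by rewrite mulr0 ifF//; lia.
  rewrite ifT; last lia.
  have {1}-> : n = n - 1 + 1 by lia.
  rewrite ewS; last lia.
  by rewrite -rmorphM/= mulKf// gt_eqF// ew_gt0.
- apply: EP_ext (EP_add (EP_scale (ew k 1)%:C%C (EP_neg Kk))
     (EP_scale (ew k 1)%:C%C (EP_delta K 0))) _ => n.
  have [->|n1] := eqVneq n 0; first by rewrite /= mulr0 mulr1 add0r.
  rewrite mulr0 addr0; case: ifP => n0.
    by rewrite mulr0 ifT//; lia.
  rewrite ifF; last lia.
  rewrite (ewNS k (n := n - 1)); last lia.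
  by rewrite subrK rmorphM.
- exact: EP_add Kf Kh.
- exact: EP_scale Kf.
Qed.

Lemma EP_shift K f d : EP K f -> EP K (fun n => f (n + d)).
Proof.
elim/int_ind: d f => [|d ih|d ih] f Kf.
- by apply: EP_ext Kf _ => n; rewrite addr0.
- by apply: EP_ext (ih _ (EP_shiftS Kf)) _ => n; congr f; lia.
- by apply: EP_ext (ih _ (EP_shiftP Kf)) _ => n; congr f; lia.
Qed.

Lemma EP_conj K f : EP K f -> EP K (fun n => conjc (f n)).
Proof.
elim=> [m|k Kk|k Kk|{}f h _ Kf _ Kh|c {}f _ Kf].
- by apply: EP_ext (EP_delta K m) _ => n; rewrite conjc_nat.
- by apply: EP_ext (EP_pos Kk) _ => n; case: ifP; rewrite ?conjCR ?conjc0.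
- by apply: EP_ext (EP_neg Kk) _ => n; case: ifP; rewrite ?conjCR ?conjc0.
- by apply: EP_ext (EP_add Kf Kh) _ => n; rewrite [RHS]rmorphD.
- by apply: EP_ext (EP_scale (conjc c) Kf) _ => n; rewrite conjCM.
Qed.

Lemma EP_ew K k : K k -> EP K (fun n => (ew k n)%:C%C).
Proof.
move=> Kk; apply: EP_ext (EP_add (EP_pos Kk) (EP_neg Kk)) _ => n.
by case: ifP; rewrite ?addr0 ?add0r.
Qed.

Lemma EP_const K c : K 0 -> EP K (fun=> c).
Proof.
move=> K0; apply: EP_ext (EP_scale c (EP_ew K0)) _ => n.
by rewrite ew0 mulr1.
Qed.

Lemma EP_cond K a b : K 0 -> EP K (fun n => if 0 <= n then a else b).
Proof.
move=> K0; apply: EP_ext (EP_add (EP_scale a (EP_pos K0)) (EP_scale b (EP_neg K0))) _ => n.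
by case: ifP; rewrite ew0 ?mulr0 ?mulr1 ?addr0 ?add0r.
Qed.

Definition sgnC n : C := if 0 <= n then 1 else -1.

Lemma EP_sgnC K : K 0 -> EP K sgnC. Proof. exact: EP_cond. Qed.

Lemma sgnCM n : sgnC n * sgnC n = 1.
Proof. by rewrite /sgnC; case: ifP; rewrite ?mulrNN mulr1. Qed.

(** Unit steps telescope: the sign changes only between -1 and 0, so the difference for a unit step
    in either direction lives at a single point. *)
Lemma EP_sgnC_diff d : EP set0 (fun n => sgnC n - sgnC (n + d)).
Proof.
elim/int_ind: d => [|d ih|d ih].
- by apply: EP_ext (EP_zero _) _ => n; rewrite addr0 subrr.
- have h : EP set0 (fun n => sgnC n - sgnC (n + 1)).
    apply: (@EP_fin _ _ [:: -1]) => n; rewrite inE /sgnC => n1.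
    by case: ifP; case: ifP; rewrite ?subrr//; lia.
  apply: EP_ext (EP_add ih (EP_shift d%:Z h)) _ => n.
  rewrite [LHS]addrA subrK; congr (_ - sgnC _); lia.
- have h : EP set0 (fun n => sgnC n - sgnC (n - 1)).
    apply: (@EP_fin _ _ [:: 0]) => n; rewrite inE /sgnC => n1.
    by case: ifP; case: ifP; rewrite ?subrr//; lia.
  apply: EP_ext (EP_add ih (EP_shift (- d%:Z) h)) _ => n.
  rewrite [LHS]addrA subrK; congr (_ - sgnC _); lia.
Qed.

(** The difference |n| - |n+d| is bounded and eventually constant, so no exponential survives and
    the exponent set stays {0}. This is why conjugation by powers of |DD| preserves the algebra. The
    ratio for general [d] is a product of shifted unit steps. *)
Lemma EP_ratio k d : EP [set 0] (fun n => (ew k n * ew (- k) (n + d))%:C%C).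
Proof.
have KD k' l : [set 0] k' -> [set 0] l -> [set (0 : int)] (k' + l) by move=> /= -> ->.
elim/int_ind: d => [|d ih|d ih].
- apply: EP_ext (EP_const 1 (erefl : [set 0] (0 : int))) _ => n.
  by rewrite addr0 mulrC ewN.
- have h : EP [set 0] (fun n => (ew k n * ew (- k) (n + 1))%:C%C).
    apply: EP_ext (EP_cond (ew (- k) 1)%:C%C (ew k 1)%:C%C (erefl : [set 0] (0 : int))) _ => n.
    case: ifP => n0; congr (_%:C)%C.
      by rewrite (ewS (- k) n0) mulrCA ewNr mulr1.
    have n1 : n < 0 by lia.
    by rewrite (ewNS k n1) -mulrA ewNr mulr1.
  apply: EP_ext (EP_mul KD ih (EP_shift d%:Z h)) _ => n.
  rewrite -rmorphM/=; congr (_%:C)%C.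
  rewrite mulrA -[ew k n * _ * _]mulrA ewN mulr1; congr (_ * ew _ _); lia.
- have h : EP [set 0] (fun n => (ew k n * ew (- k) (n - 1))%:C%C).
    (* At n = 0 the ratio is e^{-k}, the value of the negative side, although the cut counts 0 as
       nonnegative; the delta adjusts this. *)
    apply: EP_ext (EP_add (EP_cond (ew k 1)%:C%C (ew (- k) 1)%:C%C (erefl : [set 0] (0 : int)))
      (EP_scale ((ew (- k) 1)%:C%C - (ew k 1)%:C%C) (EP_delta _ 0))) _ => n.
    have [->|nn] := eqVneq n 0; first by rewrite /= mulr1 addrCA subrr addr0 /ew !mulr0 expR0 mul1r.
    rewrite mulr0 addr0; case: ifP => n0; congr (_%:C)%C.
      have n1 : 0 <= n - 1 by lia.
      have := ewS k n1; rewrite subrK => ->.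
      by rewrite -mulrA ewNr mulr1.
    have n1 : n - 1 < 0 by lia.
    by have := ewNS (- k) n1; rewrite subrK => ->; rewrite mulrCA ewNr mulr1.
  apply: EP_ext (EP_mul KD ih (EP_shift (- d%:Z) h)) _ => n.
  rewrite -rmorphM/=; congr (_%:C)%C.
  rewrite mulrA -[ew k n * _ * _]mulrA ewN mulr1; congr (_ * ew _ _); lia.
Qed.

Lemma EP_bounded f : EP [set 0] f -> bounded_fun f.
Proof.
elim=> [m|k /= ->|k /= ->|{}f h _ [M M0 Kf] _ [N N0 Kh]|c {}f _ [M M0 Kf]].
- by exists 1 => // n; case: eqP => _; rewrite ?cabs1 ?cabs0.
- by exists 1 => // n; case: ifP => _; rewrite ?ew0 ?cabs1 ?cabs0.
- by exists 1 => // n; case: ifP => _; rewrite ?ew0 ?cabs1 ?cabs0.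
- exists (M + N); first exact: addr_ge0.
  by move=> n; rewrite (le_trans (cabsD _ _))// lerD.
- exists (cabs c * M); first by rewrite mulr_ge0 ?cabs_ge0.
  by move=> n; rewrite cabsM ler_wpM2l ?cabs_ge0.
Qed.

Lemma EP_growth K f : EP K f -> exists M k : R, [/\ 0 <= M, 0 <= k &
  forall n, cabs (f n) <= M * expR (k * (`|n|%N)%:R)].
Proof.
have ge1 (k : R) (n : int) : 0 <= k -> 1 <= expR (k * (`|n|%N)%:R).
  by move=> k0; rewrite -expR0 ler_expR mulr_ge0.
elim=> [m|k _|k _|{}f h _ [M [a [M0 a0 Kf]]] _ [N [b [N0 b0 Kh]]]|c {}f _ [M [a [M0 a0 Kf]]]].
- exists 1, 0; split=> // n; rewrite mul0r expR0 mulr1.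
  by case: eqP => _; rewrite ?cabs1 ?cabs0.
- exists 1, `|k%:~R|; split=> // n; rewrite mul1r; case: ifP => _.
    by rewrite cabs_real ger0_norm ?ew_ge0// ler_expR ler_wpM2r// ler_norm.
  by rewrite cabs0 expR_ge0.
- exists 1, `|k%:~R|; split=> // n; rewrite mul1r; case: ifP => _.
    by rewrite cabs0 expR_ge0.
  by rewrite cabs_real ger0_norm ?ew_ge0// ler_expR ler_wpM2r// ler_norm.
- exists (M + N), (a + b); split; rewrite ?addr_ge0// => n.
  rewrite (le_trans (cabsD _ _))// mulrDl; apply: lerD.
    by apply: le_trans (Kf n) _; rewrite ler_wpM2l// ler_expR ler_wpM2r// lerDl.
  by apply: le_trans (Kh n) _; rewrite ler_wpM2l// ler_expR ler_wpM2r// lerDr.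
- exists (cabs c * M), a; split; rewrite ?mulr_ge0 ?cabs_ge0// => n.
  by rewrite cabsM -mulrA ler_wpM2l ?cabs_ge0.
Qed.

End Symbols.

(** * Band operators as maps on all sequences *)

Section BandOperators.
Context {R : realType}.
Local Notation sq := (int -> R[i]).
Implicit Types (f g x y : sq) (K : set int) (L M : sq -> sq).

(* Band operators act on all sequences, which avoids domain questions. *)
Inductive Op K : (sq -> sq) -> Prop :=
| Op_gen f (d : int) of EP K f : Op K (fun x n => f n * x (n + d))
| Op_add L M of Op K L & Op K M : Op K (fun x n => L x n + M x n).

Lemma Op_ext K L M : Op K L -> (forall x n, L x n = M x n) -> Op K M.
Proof.
move=> KL LM; suff <- : L = M by [].
by apply/funext => x; apply/funext => n.
Qed.

Lemma Op_sub K K' L : K `<=` K' -> Op K L -> Op K' L.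
Proof.
move=> KK; elim=> [f d Kf|{}L M _ KL _ KM]; last exact: Op_add.
by apply: Op_gen; exact: EP_sub Kf.
Qed.

Lemma Op_mul K f : EP K f -> Op K (fun x n => f n * x n).
Proof. by move=> Kf; apply: Op_ext (Op_gen 0 Kf) _ => x n; rewrite addr0. Qed.

Lemma Op_zero K : Op K (fun _ _ => 0).
Proof. by apply: Op_ext (Op_mul (EP_zero K)) _ => x n; rewrite mul0r. Qed.

Lemma Op_scale K c L : Op K L -> Op K (fun x n => c * L x n).
Proof.
elim=> [f d Kf|{}L M _ KL _ KM].
- by apply: Op_ext (Op_gen d (EP_scale c Kf)) _ => x n; rewrite mulrA.
- by apply: Op_ext (Op_add KL KM) _ => x n; rewrite mulrDr.
Qed.

Lemma Op_linear K L : Op K L -> forall c x y n,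
  L (fun n => c * x n + y n) n = c * L x n + L y n.
Proof.
elim=> [f d Kf|{}L M _ KL _ KM] c x y n; first by rewrite mulrDr mulrCA.
by rewrite KL KM mulrDr addrACA.
Qed.

Lemma Op_delta K L : Op K L -> forall f (m n : int),
  L (fun j => f j * (j == m)%:R) n = f m * L (fun j => (j == m)%:R) n.
Proof.
elim=> [g d Kg|{}L M _ KL _ KM] f m n; last by rewrite KL KM mulrDr.
by have [->|_] := eqVneq (n + d) m; rewrite ?mulr0// !mulr1 mulrC.
Qed.

(** Composition multiplies the coefficient of S^d by a translate of the other coefficient. The
    multiplication rule for coefficients is left open so that closure under composition and both
    ideal properties become instances. *)
Lemma Op_comp_gen K1 K2 K3 L M :
  (forall f g, EP K1 f -> EP K2 g -> EP K3 (fun n => f n * g n)) ->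
  Op K1 L -> Op K2 M -> Op K3 (fun x => L (M x)).
Proof.
move=> H; elim=> [f d Kf|{}L L' _ KL _ KL'] KM; last first.
  by apply: Op_ext (Op_add (KL KM) (KL' KM)) _.
elim: KM => [g e Kg|{}M M' _ KM _ KM'].
  apply: Op_ext (Op_gen (d + e) (H _ _ Kf (EP_shift d Kg))) _ => x n.
  by rewrite addrA mulrA.
by apply: Op_ext (Op_add KM KM') _ => x n; rewrite mulrDr.
Qed.

Lemma Op_comp K L M : (forall k l, K k -> K l -> K (k + l)) ->
  Op K L -> Op K M -> Op K (fun x => L (M x)).
Proof. by move=> KD; apply: Op_comp_gen => f g; exact: EP_mul. Qed.

Lemma Op_idealr K L M : Op set0 L -> Op K M -> Op set0 (fun x => L (M x)).
Proof. by apply: Op_comp_gen => f g Kf _; exact: EP_ideal. Qed.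

Lemma Op_ideall K L M : Op K L -> Op set0 M -> Op set0 (fun x => L (M x)).
Proof.
apply: Op_comp_gen => f g _ Kg.
by apply: EP_ext (EP_ideal f Kg) _ => n; exact: mulrC.
Qed.

Lemma Op_twist k L : Op [set 0] L -> Op [set 0] (fun x n =>
  (ew k n)%:C%C * L (fun m => (ew (- k) m)%:C%C * x m) n).
Proof.
have KD k' l : [set 0] k' -> [set 0] l -> [set (0 : int)] (k' + l) by move=> /= -> ->.
elim=> [f d Kf|{}L M _ KL _ KM].
- apply: Op_ext (Op_gen d (EP_mul KD Kf (EP_ratio k d))) _ => x n.
  by rewrite rmorphM/=; ring.
- by apply: Op_ext (Op_add KL KM) _ => x n; rewrite mulrDr.
Qed.

Lemma Op_sgnC_comm K L : Op K L -> Op set0 (fun x n =>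
  sgnC n * L x n - L (fun m => sgnC m * x m) n).
Proof.
elim=> [f d Kf|{}L M _ KL _ KM].
- apply: Op_ext (Op_gen d (EP_ideal f (EP_sgnC_diff d))) _ => x n; ring.
- by apply: Op_ext (Op_add KL KM) _ => x n; ring.
Qed.

Lemma bij_shift (d : int) : bijective (fun n : int => n + d).
Proof. by exists (fun n => n - d) => n; rewrite (addrK, subrK). Qed.

Lemma l2_shift (d : int) x : l2 x -> l2 (fun n => x (n + d)) /\
  l2nsq (fun n => x (n + d)) = l2nsq x.
Proof.
move=> lx; rewrite /l2 /l2nsq /summ /pval.
by rewrite (tsum_reindex (fun n => sqn (x n)) (bij_shift d)).
Qed.

Lemma Op_l2 L : Op [set 0] L -> exists2 M : R, 0 <= M &
  forall x, l2 x -> l2 (L x) /\ l2n (L x) <= M * l2n x.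
Proof.
elim=> [f d /EP_bounded[M M0 fM]|{}L L' _ [M M0 LM] _ [N N0 LN]].
- exists M => // x lx; have [lx' xE] := l2_shift d lx.
  have := bounded_fun_l2 (mkl2 lx') M0 fM; rewrite /l2n [l2nsq (mkl2 lx')]xE.
  exact.
- exists (M + N); first exact: addr_ge0.
  move=> x lx; have [l1 le1] := LM x lx; have [l2' le2] := LN x lx.
  split; first exact: l2D.
  by rewrite (le_trans (l2nD l1 l2'))// mulrDl lerD.
Qed.

Lemma Op_adj L : Op [set 0] L -> exists2 M, Op [set 0] M &
  forall x y, l2 x -> l2 y ->
    csum (fun n => L x n * conjc (y n)) = csum (fun n => x n * conjc (M y n)).
Proof.
elim=> [f d Kf|{}L L' KL [M KM LM] KL' [M' KM' LM']].
- exists (fun x n => conjc (f (n - d)) * x (n - d)).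
    exact: (Op_gen (- d) (EP_shift (- d) (EP_conj Kf))).
  move=> x y lx ly.
  rewrite -[RHS](csum_reindex _ (bij_shift d)) /=; congr csum; apply/funext => n.
  by rewrite /= addrK conjCM conjcK; ring.
- exists (fun x n => M x n + M' x n); first exact: Op_add.
  move=> x y lx ly.
  have [A _ HA] := Op_l2 KL; have [B _ HB] := Op_l2 KL'.
  have [A' _ HA'] := Op_l2 KM; have [B' _ HB'] := Op_l2 KM'.
  transitivity (csum (fun n => L x n * conjc (y n)) + csum (fun n => L' x n * conjc (y n))).
    rewrite -csumD; last 2 first.
    + by apply: csumm_l2 => //; exact: (HA _ lx).1.
    + by apply: csumm_l2 => //; exact: (HB _ lx).1.
    by congr csum; apply/funext => n; rewrite mulrDl.
  rewrite LM// LM'// -csumD; last 2 first.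
  + by apply: csumm_l2 => //; exact: (HA' _ ly).1.
  + by apply: csumm_l2 => //; exact: (HB' _ ly).1.
  by congr csum; apply/funext => n; rewrite -mulrDr; congr (_ * _); rewrite [RHS]rmorphD.
Qed.

(* Pointwise exponential decay, rather than an l2 bound: a band operator lowers
   the rate c by an amount that does not depend on c. *)
Definition decay (c B : R) x := forall n, cabs (x n) <= B * expR (- c * (`|n|%N)%:R).

Lemma Op_decay K L : Op K L -> exists2 k : R, 0 <= k & forall c, 0 <= c ->
  exists2 D : R, 0 <= D & forall B x, 0 <= B -> decay c B x -> decay (c - k) (D * B) (L x).
Proof.
elim=> [f d /EP_growth[M [k [M0 k0 fM]]]|{}L L' _ [k k0 kP] _ [k' k0' kP']].
- exists k => // c c0.
  (* The shift by [d] costs the factor e^{c|d|}, which goes into the constant; only the growth rate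
     [k] of the coefficient lowers the rate of decay. *)
  exists (M * expR (c * (`|d|%N)%:R)); first by rewrite mulr_ge0 ?expR_ge0.
  move=> B x B0 xd n; rewrite cabsM.
  apply: le_trans (ler_pM (cabs_ge0 _) (cabs_ge0 _) (fM n) (xd _)) _.
  rewrite -!mulrA; apply: ler_wpM2l => //.
  rewrite [leLHS]mulrCA [leRHS]mulrCA; apply: ler_wpM2l => //.
  rewrite -!expRD ler_expR.
  have : c * (`|n|%N)%:R <= c * ((`|(n + d)%R|%N)%:R + (`|d|%N)%:R).
    rewrite ler_wpM2l// -natrD ler_nat; lia.
  lra.
- exists (k + k'); first exact: addr_ge0.
  move=> c c0; have [D D0 DP] := kP c c0; have [E E0 EP] := kP' c c0.
  exists (D + E); first exact: addr_ge0.
  move=> B x B0 xd n; rewrite (le_trans (cabsD _ _))// !mulrDl; apply: lerD.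
    apply: le_trans (DP _ _ B0 xd n) _; rewrite ler_wpM2l ?mulr_ge0// ler_expR.
    have : 0 <= k' * (`|n|%N)%:R :> R by rewrite mulr_ge0.
    lra.
  apply: le_trans (EP _ _ B0 xd n) _; rewrite ler_wpM2l ?mulr_ge0// ler_expR.
  have : 0 <= k * (`|n|%N)%:R :> R by rewrite mulr_ge0.
  lra.
Qed.

(** Only the terms with d = 0 reach the diagonal. These matrix entries determine the zeta
    function. *)
Lemma Op_diag K L : Op K L -> EP K (fun n => L (fun j => (j == n)%:R) n).
Proof.
elim=> [f d Kf|{}L M _ KL _ KM]; last exact: EP_add.
have [->|d0] := eqVneq d 0.
  by apply: EP_ext Kf _ => n; rewrite addr0 eqxx mulr1.
by apply: EP_ext (EP_zero K) _ => n; rewrite -subr_eq0 addrAC subrr add0r (negbTE d0) mulr0.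
Qed.

End BandOperators.

(** * Complex exponential and meromorphic functions *)

Section RealTaylor.
Context {R : realType}.
Implicit Types x y : R.

(** By the mean value theorem f x = f'(z) x with |z| <= |x|, which gains one power of |x|. Iterating
    from a constant bound yields the Taylor remainders below, with constants that are not sharp. *)
Lemma MVT_pow (f df : R -> R) (c : R) n : (forall x, is_derive x 1 f (df x)) -> f 0 = 0 ->
  (forall x, `|x| <= 1 -> `|df x| <= c * `|x| ^+ n) ->
  forall x, `|x| <= 1 -> `|f x| <= c * `|x| ^+ n.+1.
Proof.
move=> fd f0 dfc.
have fc a b : {within `[a, b], continuous f}.
  apply: continuous_subspaceT => u; apply: differentiable_continuous.
  by apply/derivable1_diffP; have [] := fd u.
have key x z : `|x| <= 1 -> `|z| <= `|x| -> f x = df z * x -> `|f x| <= c * `|x| ^+ n.+1.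
  move=> x1 zx ->; rewrite normrM exprSr mulrA ler_wpM2r//.
  have z1 := le_trans zx x1.
  apply: le_trans (dfc z z1) _.
  have c0 : 0 <= c.
    have := le_trans (normr_ge0 _) (dfc 1 _); rewrite normr1 expr1n mulr1; exact.
  by rewrite ler_wpM2l// lerXn2r ?nnegrE.
move=> x x1; have [x0|x0|->] := ltgtP x 0.
- have [z zI E] := MVT x0 (fun z _ => fd z) (fc x 0).
  move: zI; rewrite in_itv /= => /andP[xz z0].
  apply: (key x z) => //; last by move: E; rewrite f0; lra.
  by rewrite !ltr0_norm// lerN2 ltW.
- have [z zI E] := MVT x0 (fun z _ => fd z) (fc 0 x).
  move: zI; rewrite in_itv /= => /andP[z0 zx].
  apply: (key x z) => //; last by move: E; rewrite f0 !subr0.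
  by rewrite !gtr0_norm// ltW.
- by rewrite f0 normr0 expr0n mulr0.
Qed.

Let c : R := expR 1.

Lemma expR_taylor2 x : `|x| <= 1 -> `|expR x - 1 - x| <= c * `|x| ^+ 2.
Proof.
move: x; apply: (@MVT_pow (fun x => expR x - 1 - x) (fun x => expR x - 1)).
- by move=> x; apply: is_derive_eq; rewrite subr0.
- by rewrite expR0 subrr subr0.
apply: (@MVT_pow (fun x => expR x - 1) expR c 0).
- by move=> x; apply: is_derive_eq; rewrite subr0.
- by rewrite expR0 subrr.
move=> x x1; rewrite expr0 mulr1 ger0_norm ?expR_ge0// ler_expR.
exact: le_trans (ler_norm x) x1.
Qed.

Lemma expR_taylor3 x : `|x| <= 1 -> `|expR x - 1 - x - 2^-1 * x ^+ 2| <= c * `|x| ^+ 3.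
Proof.
move: x; apply: (@MVT_pow (fun x => expR x - 1 - x - 2^-1 * x ^+ 2) (fun x => expR x - 1 - x)).
- move=> x; apply: is_derive_eq; rewrite subr0 -/(GRing.scale _ _) /GRing.scale /=.
  by field.
- by rewrite expR0 subrr subr0 expr0n/= mulr0 subrr.
exact: expR_taylor2.
Qed.

Lemma sin_le x : `|x| <= 1 -> `|sin x| <= `|x|.
Proof.
move=> x1; have := @MVT_pow sin cos 1 0 _ (sin0 R) _ x x1; rewrite mul1r expr1; apply => //.
by move=> y _; rewrite expr0 mulr1 ler_norml cos_geN1 cos_le1.
Qed.

Lemma cos_taylor2 x : `|x| <= 1 -> `|cos x - 1| <= `|x| ^+ 2.
Proof.
move=> x1; have := @MVT_pow (fun x => cos x - 1) (fun x => - sin x) 1 1 _ _ _ x x1.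
rewrite mul1r; apply.
- by move=> y; apply: is_derive_eq; rewrite subr0.
- by rewrite cos0 subrr.
- by move=> y y1; rewrite normrN mul1r expr1 sin_le.
Qed.

Lemma sin_taylor3 x : `|x| <= 1 -> `|sin x - x| <= `|x| ^+ 3.
Proof.
move=> x1; have := @MVT_pow (fun x => sin x - x) (fun x => cos x - 1) 1 2 _ _ _ x x1.
rewrite mul1r; apply.
- by rewrite subr0; exact: sin0.
- by move=> y y1; rewrite mul1r cos_taylor2.
Qed.

Lemma cos_taylor4 x : `|x| <= 1 -> `|cos x - 1 + 2^-1 * x ^+ 2| <= `|x| ^+ 4.
Proof.
move=> x1; have := @MVT_pow (fun x => cos x - 1 + 2^-1 * x ^+ 2) (fun x => - sin x + x) 1 3 _ _ _ x x1.
rewrite mul1r; apply.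
- by move=> y; apply: is_derive_eq; rewrite subr0 /GRing.scale /=; field.
- by rewrite cos0 subrr expr0n/= mulr0 addr0.
- by move=> y y1; rewrite mul1r -normrN opprD opprK sin_taylor3.
Qed.

End RealTaylor.

Section ComplexExp.
Context {R : realType}.
Local Notation C := (R[i]^o).
Implicit Types z w : R[i].

Lemma cexp0 : cexp (0 : R[i]) = 1.
Proof. by rewrite /cexp /= expR0 cos0 sin0 mulr1 mulr0. Qed.

Lemma cexpD z w : cexp (z + w) = cexp z * cexp w.
Proof.
case: z w => [a b] [c d]; rewrite /cexp /= expRD cosD sinD.
by apply: ReIm_eq => /=; ring.
Qed.

Lemma cexp_real (r : R) : cexp (r%:C%C) = (expR r)%:C%C.
Proof. by rewrite /cexp /= cos0 sin0 mulr1 mulr0. Qed.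

Lemma cabs_cexp z : cabs (cexp z) = expR (complex.Re z).
Proof.
case: z => a b; rewrite /cexp /cabs /sqn /= !exprMn -mulrDr cos2Dsin2 mulr1.
by rewrite sqrtr_sqr ger0_norm ?expR_ge0.
Qed.

Lemma cexpMn z n : cexp (z *+ n) = cexp z ^+ n.
Proof. by elim: n => [|n ih]; rewrite ?mulr0n ?cexp0// mulrS cexpD ih exprS. Qed.

(** Order three is dictated by the removable singularity in [meromorphic_zetak], where a division by
    h must still leave a quadratic remainder. *)
Lemma cexp_taylor : exists2 K : R, 0 <= K & forall w, cabs w <= 1 ->
  cabs (cexp w - 1 - w - 2^-1 * w ^+ 2) <= K * cabs w ^+ 3.
Proof.
pose c : R := expR 1.
have c0 : 0 <= c := expR_ge0 1.
(* The bounds [A1] to [A5] below add up to 2c + 6 times the cube of [t]. *)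
exists (2 * c + 8); first by rewrite addr_ge0// mulr_ge0.
move=> [x y] w1; set t := cabs _ in w1 *.
have t0 : 0 <= t := cabs_ge0 _.
have xt : `|x| <= t := absRe_le (x +i* y)%C.
have yt : `|y| <= t := absIm_le (x +i* y)%C.
have x1 := le_trans xt w1; have y1 := le_trans yt w1.
have pw n (u : R) : `|u| <= t -> `|u| ^+ n <= t ^+ n by move=> ut; rewrite lerXn2r ?nnegrE.
set rho := expR x - 1 - x - 2^-1 * x ^+ 2.
set rho2 := expR x - 1 - x.
set kap := cos y - 1 + 2^-1 * y ^+ 2.
set sig := sin y - y.
have Hrho : `|rho| <= c * t ^+ 3 by rewrite (le_trans (expR_taylor3 x1))// ler_wpM2l// pw.
have Hrho2 : `|rho2| <= c * t ^+ 2 by rewrite (le_trans (expR_taylor2 x1))// ler_wpM2l// pw.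
have Hkap : `|kap| <= t ^+ 3.
  rewrite (le_trans (cos_taylor4 y1))// (le_trans (pw 4%N _ yt))//.
  by rewrite (exprS t 3) ler_piMl ?exprn_ge0.
have Hsig : `|sig| <= t ^+ 3 by rewrite (le_trans (sin_taylor3 y1))// pw.
have Hsin : `|sin y| <= t by rewrite (le_trans (sin_le y1)).
have Hcos : `|cos y| <= 1 by rewrite ler_norml cos_geN1 cos_le1.
(* Writing expR x and cos y as Taylor polynomial plus remainder leaves only products that contain a
   remainder, and explicit monomials of order at least three. *)
have ERe : complex.Re (cexp (x +i* y)%C - 1 - (x +i* y)%C - 2^-1 * (x +i* y)%C ^+ 2) =
    rho * cos y + kap * (1 + x + 2^-1 * x ^+ 2) - 2^-1 * y ^+ 2 * (x + 2^-1 * x ^+ 2).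
  have -> : (2^-1 : R[i]) = (2^-1)%:C%C by rewrite fmorphV/= rmorph_nat.
  by rewrite expr2 /cexp /rho /kap /=; field.
have EIm : complex.Im (cexp (x +i* y)%C - 1 - (x +i* y)%C - 2^-1 * (x +i* y)%C ^+ 2) =
    rho2 * sin y + sig * (1 + x).
  have -> : (2^-1 : R[i]) = (2^-1)%:C%C by rewrite fmorphV/= rmorph_nat.
  by rewrite expr2 /cexp /rho2 /sig /=; field.
apply: le_trans (cabs_le_ReIm _) _; rewrite ERe EIm.
have x2 : `|x ^+ 2| <= 1 by rewrite normrX exprn_ile1.
have A1 : `|rho * cos y| <= c * t ^+ 3.
  by rewrite normrM -[leRHS]mulr1 ler_pM.
have A2 : `|kap * (1 + x + 2^-1 * x ^+ 2)| <= t ^+ 3 * 3.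
  rewrite normrM ler_pM//; move: x1 x2; rewrite !ler_norml => /andP[? ?] /andP[? ?].
  by apply/andP; split; lra.
have A3 : `|2^-1 * y ^+ 2 * (x + 2^-1 * x ^+ 2)| <= t ^+ 3.
  have -> : 2^-1 * y ^+ 2 * (x + 2^-1 * x ^+ 2) = y ^+ 2 * x * (2^-1 * (1 + 2^-1 * x)) by ring.
  rewrite normrM -[leRHS]mulr1 ler_pM//.
    by rewrite normrM normrX (exprSr t 2) ler_pM ?exprn_ge0 ?pw.
  by move: x1; rewrite !ler_norml => /andP[? ?]; apply/andP; split; lra.
have A4 : `|rho2 * sin y| <= c * t ^+ 3.
  by rewrite normrM (exprSr t 2) mulrA ler_pM.
have A5 : `|sig * (1 + x)| <= t ^+ 3 * 2.
  rewrite normrM ler_pM//; move: x1; rewrite !ler_norml => /andP[? ?].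
  by apply/andP; split; lra.
have B1 := ler_normD (rho * cos y + kap * (1 + x + 2^-1 * x ^+ 2)) (- (2^-1 * y ^+ 2 * (x + 2^-1 * x ^+ 2))).
have B2 := ler_normD (rho * cos y) (kap * (1 + x + 2^-1 * x ^+ 2)).
have B3 := ler_normD (rho2 * sin y) (sig * (1 + x)).
rewrite normrN in B1.
have t3 : 0 <= t ^+ 3 by rewrite exprn_ge0.
lra.
Qed.

(* A remainder bound is convenient because cexp_taylor yields it both for cexp
   itself and at the removable singularity in meromorphic_zetak. *)
Lemma derivable_quad (f : R[i] -> R[i]) (a l : R[i]) (K r : R) : 0 < r ->
  (forall h, cabs h <= r -> cabs (f (a + h) - f a - l * h) <= K * cabs h ^+ 2) ->
  derivable (f : C -> C) a 1.
Proof.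
move=> r0 fK; apply/cvg_ex; exists l; apply/cvgrPdist_le => e e0.
have er : e = (complex.Re e)%:C%C by rewrite RRe_real// realE (ltW e0).
have e1 : 0 < complex.Re e by rewrite -ltcR -er.
pose s := Num.min r (complex.Re e / (`|K| + 1)).
have K1 : 0 < `|K| + 1 by rewrite ltr_wpDl.
have s0 : 0 < s by rewrite lt_min r0 divr_gt0.
have s1 : (0 : R[i]) < s%:C%C by rewrite ltcR.
exists s%:C%C => // h /=; rewrite sub0r normrN normC_cabs ltcR => hs h0.
rewrite /= distrC.
have hp : 0 < cabs h by rewrite lt_def cabs_ge0 andbT; apply: contra h0 => /eqP/cabs_eq0 ->.
have hr : cabs h <= r by apply: le_trans (ltW hs) _; rewrite /s ge_min lexx.
have hK := fK h hr.
rewrite er normC_cabs lecR.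
have -> : h^-1 *: (f (h *: (1 : C) + a) - f a) - l = h^-1 * (f (a + h) - f a - l * h).
  rewrite [h *: _]mulr1 [h + a]addrC [LHS](_ : _ = h^-1 * (f (a + h) - f a) - l)//.
  by rewrite [in RHS]mulrBr [l * h]mulrC mulKf.
rewrite cabsM cabsV ler_pdivrMl//; apply: le_trans hK _.
rewrite expr2 mulrCA ler_wpM2l ?cabs_ge0//.
apply: le_trans (_ : (`|K| + 1) * cabs h <= _).
  by rewrite ler_wpM2r ?cabs_ge0// (le_trans (ler_norm K))// lerDl.
rewrite mulrC -ler_pdivlMr//; apply: le_trans (ltW hs) _.
by rewrite /s ge_min lexx orbT.
Qed.

Lemma cabs_half_sq w : cabs (2^-1 * w ^+ 2) = 2^-1 * cabs w ^+ 2.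
Proof.
rewrite cabsM cabsX; congr (_ * _).
by rewrite (_ : (2^-1 : R[i]) = (2^-1)%:C%C) ?cabs_real ?ger0_norm// fmorphV/= rmorph_nat.
Qed.

Lemma derivable_cexp (a b z : R[i]) : derivable ((fun z : R[i] => cexp (a * z + b)) : C -> C) z 1.
Proof.
have [K K0 KP] := cexp_taylor.
have [->|a0] := eqVneq a 0.
  have -> : (fun z : R[i] => cexp (0 * z + b)) = cst (cexp b).
    by apply/funext => u; rewrite mul0r add0r.
  exact: derivable_cst.
have ap : 0 < cabs a by rewrite lt_def cabs_ge0 andbT; apply: contra a0 => /eqP/cabs_eq0 ->.
(* For |h| at most 1/|a| the product a h stays in the unit disc, where [cexp_taylor] applies; a = 0
   was split off to make this radius available. *)
apply: (@derivable_quad _ z (cexp (a * z + b) * a)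
  (cabs (cexp (a * z + b)) * ((K + 1) * cabs a ^+ 2)) (cabs a)^-1).
  by rewrite invr_gt0.
move=> h hr.
have ah : cabs (a * h) <= 1 by rewrite cabsM mulrC -ler_pdivlMr// mul1r.
have -> : cexp (a * (z + h) + b) - cexp (a * z + b) - cexp (a * z + b) * a * h =
    cexp (a * z + b) * ((cexp (a * h) - 1 - a * h - 2^-1 * (a * h) ^+ 2) + 2^-1 * (a * h) ^+ 2).
  have -> : a * (z + h) + b = (a * z + b) + a * h by ring.
  by rewrite cexpD; ring.
rewrite cabsM -mulrA ler_wpM2l ?cabs_ge0//.
rewrite -mulrA -exprMn -cabsM; apply: le_trans (cabsD _ _) _.
rewrite mulrDl lerD//.
  apply: le_trans (KP _ ah) _; rewrite ler_wpM2l//.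
  by rewrite exprS ler_piMl ?exprn_ge0 ?cabs_ge0.
have -> : cabs (2^-1 * (a * h) ^+ 2) = 2^-1 * cabs (a * h) ^+ 2 by exact: cabs_half_sq.
by rewrite ler_wpM2r ?exprn_ge0 ?cabs_ge0//; lra.
Qed.

End ComplexExp.

(** * Holomorphic and meromorphic functions, and the poles of the geometric series *)

Section Meromorphic.
Context {R : realType}.
Local Notation C := (R[i]^o).
Implicit Types (f g : C -> C) (z : R[i]).

Lemma holomorphic_all f z0 : (forall z : C, derivable f z 1) -> holomorphic_at f z0.
Proof. by move=> fd; apply: (filterS (P := setT) (F := nbhs (z0 : C))) filterT => z _. Qed.

Lemma near_punctured (P : C -> Prop) (z0 : C) : (forall z, P z) -> \forall z \near z0^', P z.
Proof. by move=> fd; apply: (filterS (P := setT) (F := z0^')) filterT => z _. Qed.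

Lemma derivable_neq0 f z0 : derivable f z0 1 -> f z0 != 0 -> \forall z \near (z0 : C), f z != 0.
Proof.
move=> /derivable1_diffP/differentiable_continuous fc f0.
exact: (cvgr_neq0 (f z0) fc f0).
Qed.

Lemma near_neq (z0 z1 : C) : z1 != z0 -> \forall z \near z1, z != z0.
Proof.
move=> z10; have d1 : derivable (fun z : C => z - z0) z1 1.
  by apply: derivableB; [exact: derivable_id|exact: derivable_cst].
have z1n : z1 - z0 != 0 by rewrite subr_eq0.
by apply: filterS (derivable_neq0 d1 z1n) => z; rewrite subr_eq0.
Qed.

Lemma holomorphicD f g z0 : holomorphic_at f z0 -> holomorphic_at g z0 ->
  holomorphic_at (fun z => f z + g z) z0.
Proof. by apply: filterS2 => z; exact: derivableD. Qed.

Lemma holomorphicM f g z0 : holomorphic_at f z0 -> holomorphic_at g z0 ->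
  holomorphic_at (fun z => f z * g z) z0.
Proof. by apply: filterS2 => z; exact: derivableM. Qed.

Lemma holomorphic_cst (c : C) z0 : holomorphic_at (fun=> c) z0.
Proof. by apply: holomorphic_all => z; exact: derivable_cst. Qed.

Lemma holomorphic_id z0 : holomorphic_at (fun z : C => z) z0.
Proof. by apply: holomorphic_all => z; exact: derivable_id. Qed.

Lemma holomorphicV f z0 : holomorphic_at f z0 -> f z0 != 0 ->
  holomorphic_at (fun z => (f z)^-1) z0.
Proof.
move=> fh f0; have f1 : derivable f z0 1 := nbhs_singleton fh.
by apply: filterS2 fh (derivable_neq0 f1 f0) => z fz fz0; exact: derivableV.
Qed.

Lemma holomorphicX f n z0 : holomorphic_at f z0 -> holomorphic_at (fun z => f z ^+ n) z0.
Proof.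
move=> fh; elim: n => [|n ih]; first exact: holomorphic_cst.
rewrite (_ : (fun z => f z ^+ n.+1) = fun z => f z * f z ^+ n); last first.
  by apply/funext => z; rewrite exprS.
exact: holomorphicM.
Qed.

Lemma holomorphic_sub_cst (c : C) z0 : holomorphic_at (fun z : C => z - c) z0.
Proof. exact: holomorphicD (holomorphic_id _) (holomorphic_cst _ _). Qed.

Lemma meromorphic_entire f : (forall z0, holomorphic_at f z0) -> meromorphic f.
Proof.
move=> fh z0; exists 0%N, f; split; first exact: fh.
by apply: near_punctured => z; rewrite expr0 divr1.
Qed.

Lemma meromorphicD f g : meromorphic f -> meromorphic g -> meromorphic (fun z => f z + g z).
Proof.
move=> fm gm z0; have [n [f1 [f1h fE]]] := fm z0; have [m [g1 [g1h gE]]] := gm z0.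
exists (n + m)%N, (fun z => f1 z * (z - z0) ^+ m + g1 z * (z - z0) ^+ n); split.
  exact: (holomorphicD (holomorphicM f1h (holomorphicX m (holomorphic_sub_cst z0 z0)))
    (holomorphicM g1h (holomorphicX n (holomorphic_sub_cst z0 z0)))).
have nz : \forall z \near z0^', z != z0 by exact: nbhs_dnbhs_neq.
near=> z.
have zz : z - z0 != 0 by rewrite subr_eq0; near: z.
rewrite (near fE z)// (near gE z)// mulrDl exprD.
by congr (_ + _); field; rewrite ?expf_neq0.
Unshelve. all: by end_near.
Qed.

Lemma meromorphicZ (c : C) f : meromorphic f -> meromorphic (fun z => c * f z).
Proof.
move=> fm z0; have [n [f1 [f1h fE]]] := fm z0.
exists n, (fun z => c * f1 z); split; first exact: holomorphicM (holomorphic_cst _ _) f1h.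
by apply: filterS fE => z ->; rewrite mulrA.
Qed.

Lemma holomorphic_cexp (a b : R[i]) z0 : holomorphic_at ((fun z : R[i] => cexp (a * z + b)) : C -> C) z0.
Proof. by apply: holomorphic_all => z; exact: derivable_cexp. Qed.

(* kexp k z = e^{k - 2z} is the ratio of the geometric series whose n-th term is
   e^{kn} |e^n|^{-2z}. *)
Definition kexp (k : int) z : R[i] := cexp (- 2 * z + k%:~R).
Definition zetak (k : int) z : R[i] := (1 - kexp k z)^-1.
(** These are the points k/2 + i pi l with k and l integers. *)
Definition Sd : set C := [set z | exists k, kexp k z = 1].

Lemma derivable_kexp k z : derivable ((fun z => 1 - kexp k z) : C -> C) z 1.
Proof.
have dk : derivable (kexp k : C -> C) z 1 by exact: (@derivable_cexp R (- 2) k%:~R z).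
exact: (@derivableB _ C C (cst 1) (kexp k) z 1 (derivable_cst _ _ _) dk).
Qed.

Lemma holomorphic_zetak k z0 : kexp k z0 != 1 -> holomorphic_at (zetak k : C -> C) z0.
Proof.
move=> k1; have k1' : 1 - kexp k z0 != 0 by rewrite subr_eq0 eq_sym.
exact: (@holomorphicV (fun z => 1 - kexp k z) z0 (@holomorphic_all (fun z => 1 - kexp k z) z0 (@derivable_kexp k)) k1').
Qed.

(** Where [kexp k] equals 1, the quotient [psi] of 1 - kexp k by z - z0 extends by the derivative of
    1 - kexp k at z0, which is 2. So [zetak k] is 1/psi divided by z - z0, a simple pole. *)
Lemma meromorphic_zetak k : meromorphic (zetak k : C -> C).
Proof.
move=> z0; have [k1|k1] := eqVneq (kexp k z0) 1; last first.
  exists 0%N, (zetak k); split; first exact: holomorphic_zetak.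
  by apply: near_punctured => z; rewrite expr0 divr1.
have kE (h : R[i]) : kexp k (z0 + h) = cexp (- 2 * h).
  by rewrite /kexp mulrDr addrAC cexpD -/(kexp k z0) k1 mul1r.
pose psi : R[i] -> R[i] := fun z => if z == z0 then 2 else (1 - kexp k z) / (z - z0).
have psi0 : psi z0 = 2 by rewrite /psi eqxx.
have dpsi0 : derivable (psi : C -> C) z0 1.
  have [K K0 KP] := @cexp_taylor R.
  (* The expansion (1 - e^{-2h})/h = 2 - 2h + O(h^2) gives the slope -2. The 8 is the cube of |-2|,
     and the radius 1/2 keeps |2h| within 1. *)
  apply: (@derivable_quad _ psi z0 (-2) (K * 8) 2^-1) => // h hr.
  have h1 : cabs (- 2 * h) = 2 * cabs h.
    rewrite cabsM cabsN (_ : (2 : R[i]) = 2%:C%C) ?cabs_real ?ger0_norm//.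
    by rewrite rmorph_nat.
  have h2 : cabs (- 2 * h) <= 1 by rewrite h1; lra.
  have [->|hn] := eqVneq h 0.
    by rewrite addr0 subrr mulr0 subr0 cabs0 expr0n/= mulr0.
  have hE : z0 + h - z0 = h by rewrite addrAC subrr add0r.
  have hF : (z0 + h == z0) = false by rewrite -subr_eq0 hE (negbTE hn).
  rewrite psi0 /psi hF hE kE.
  have -> : (1 - cexp (- 2 * h)) / h - 2 - - 2 * h =
      - (cexp (- 2 * h) - 1 - (- 2 * h) - 2^-1 * (- 2 * h) ^+ 2) / h by field.
  rewrite cabsM cabsV cabsN ler_pdivrMr; last first.
    by rewrite lt_def cabs_ge0 andbT; apply: contra hn => /eqP/cabs_eq0 ->.
  apply: le_trans (KP _ h2) _; rewrite h1 exprMn.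
  by rewrite le_eqVlt; apply/orP; left; apply/eqP; ring.
have dpsi z : derivable (psi : C -> C) z 1.
  have [->//|zz] := eqVneq z z0.
  have dq : derivable ((fun z => (1 - kexp k z) * (z - z0)^-1) : C -> C) z 1.
    have zn : z - z0 != 0 by rewrite subr_eq0.
    have d1 : derivable ((fun z : C => z - z0) : C -> C) z 1.
      by apply: derivableB; [exact: derivable_id|exact: derivable_cst].
    exact: (@derivableM _ C (fun z => 1 - kexp k z) (fun z => (z - z0)^-1) z 1
      (@derivable_kexp k z) (@derivableV _ C (fun z => z - z0) z 1 zn d1)).
  have nq : {near (z : C), (fun z => (1 - kexp k z) * (z - z0)^-1) =1 psi}.
    by apply: filterS (near_neq zz) => u /negbTE uz; rewrite /psi uz.
  exact: (@near_eq_derivable _ C C _ psi z 1 nq dq).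
exists 1%N, (fun z => (psi z)^-1); split.
  have p0 : psi z0 != 0 by rewrite psi0 pnatr_eq0.
  exact: (@holomorphicV psi z0 (holomorphic_all _ dpsi) p0).
apply: filterS (nbhs_dnbhs_neq (z0 : C)) => z /negbTE zz.
rewrite /psi zz invf_div expr1 /zetak mulrAC divff ?mul1r// subr_eq0 zz//.
Qed.

(** Distinct points of [Sd] are at least 1/2 apart: [cexp w = 1] forces Re w = 0 and excludes 0 <
    |Im w| < 1, cosine being injective on [0, pi], while the real parts of such points differ by
    half-integers. *)
Lemma Sd_discrete : limit_point Sd = set0.
Proof.
have H0 (t : R) : 0 <= t -> t < 1 -> cos t = 1 -> t = 0.
  move=> t0 t1 ct; have pi1 : (1 : R) <= pi by have := pi_ge2 R; lra.
  apply: (@cos_inj R); rewrite ?in_itv/= ?lexx ?t0 ?pi_ge0//; last by rewrite ct cos0.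
  by rewrite (le_trans (ltW t1)).
have H (w : R[i]) : cexp w = 1 -> complex.Re w = 0 /\ (`|complex.Im w| < 1 -> complex.Im w = 0).
  case: w => a b ew; have := cabs_cexp (a +i* b)%C; rewrite ew cabs1 /= => ea.
  have a0 : a = 0 by rewrite -(expRK a) -ea ln1.
  split => // b1; have := congr1 (@complex.Re R) ew; rewrite /cexp /= a0 expR0 mul1r => cb.
  apply/eqP; rewrite -normr_eq0; apply/eqP; apply: H0 => //.
  by have [b0|b0] := ger0P b; rewrite ?cosN.
have sep (z w : R[i]) : Sd z -> Sd w -> cabs (z - w) < 2^-1 -> z = w.
  move=> [k kz] [l lw] zw.
  have E : cexp (- 2 * (z - w) + (k - l)%:~R) = 1.
    have -> : - 2 * (z - w) + (k - l)%:~R = (- 2 * z + k%:~R) + - (- 2 * w + l%:~R).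
      by rewrite intrD mulrNz; ring.
    rewrite cexpD [cexp (_ + k%:~R)]kz mul1r.
    have : cexp (- 2 * w + l%:~R) * cexp (- (- 2 * w + l%:~R)) = 1.
      by rewrite -cexpD subrr cexp0.
    by rewrite [cexp (_ + l%:~R)]lw mul1r.
  have [e1 e2] := H _ E.
  have kl : (k - l)%:~R = ((k - l)%:~R : R)%:C%C :> R[i] by rewrite rmorph_int.
  have m2 : (- 2 : R[i]) = (- 2 : R)%:C%C by rewrite rmorphN rmorph_nat.
  move: e1 e2 zw; rewrite kl m2; case: (z - w) (subr_eq0 z w) => x y Exy /=.
  rewrite !mul0r subr0 !addr0 => e1 e2 zw.
  have xs : `|x| < 2^-1 := le_lt_trans (absRe_le (x +i* y)%C) zw.
  have ys : `|y| < 2^-1 := le_lt_trans (absIm_le (x +i* y)%C) zw.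
  have y0 : y = 0.
    have h1 : `|- 2 * y| < 1 by rewrite normrM normrN (ger0_norm (ler0n R 2)); lra.
    by have := e2 h1; lra.
  have kl0 : k - l = 0.
    have : `|(k - l)%:~R : R| < 1.
      have -> : (k - l)%:~R = 2 * x by lra.
      by rewrite normrM (ger0_norm (ler0n R 2)); lra.
    rewrite -intr_norm ltrz1; lia.
  have x0 : x = 0 by move: e1; rewrite kl0; lra.
  by apply/eqP; rewrite -Exy y0 x0.
apply/seteqP; split => // z zl.
(* A point [w] of [Sd] within 1/4 of the limit point z and another one [v] strictly closer to z are
   less than 1/2 apart, hence equal, which is absurd. *)
have r4 : (0 : R[i]) < (4^-1 : R)%:C%C by rewrite ltcR.
have [w [wz Sw /= wb]] := zl _ (nbhsx_ballx (z : C) _ r4).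
move: wb; rewrite -ball_normE /= normC_cabs ltcR => wb.
have wp : 0 < cabs (z - w).
  rewrite lt_def cabs_ge0 andbT; apply: contra wz => /eqP/cabs_eq0/eqP.
  by rewrite subr_eq0 eq_sym.
have rp : (0 : R[i]) < (cabs (z - w))%:C%C by rewrite ltcR.
have [v [vz Sv /= vb]] := zl _ (nbhsx_ballx (z : C) _ rp).
move: vb; rewrite -ball_normE /= normC_cabs ltcR => vb.
have : v = w.
  apply: sep => //; have -> : v - w = (z - w) - (z - v) by ring.
  by apply: le_lt_trans (cabsD _ _) _; rewrite cabsN; lra.
by move=> vw; move: vb; rewrite vw ltxx.
Qed.

End Meromorphic.

(** * Zeta functions *)

Section UnconditionalSums.
Context {R : realType} {I : choiceType}.
Implicit Types f g : I -> R[i].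

Lemma rsum_le (h : I -> R) : asumm h -> `|rsum h| <= pval (fun i => `|h i|).
Proof.
move=> sh; rewrite /rsum.
have p0 : 0 <= pval (fun i => Num.max (h i) 0) by apply: pval_ge0 => i; exact: maxr_ge0.
have n0 : 0 <= pval (fun i => Num.max (- h i) 0) by apply: pval_ge0 => i; exact: maxr_ge0.
have pl : pval (fun i => Num.max (h i) 0) <= pval (fun i => `|h i|).
  by apply: le_pval => // i; rewrite maxr_ge0 ge_max normr_ge0 ler_norm.
have nl : pval (fun i => Num.max (- h i) 0) <= pval (fun i => `|h i|).
  by apply: le_pval => // i; rewrite maxr_ge0 ge_max normr_ge0 -normrN ler_norm.
rewrite ler_norml; apply/andP; split; lra.
Qed.

Lemma csum_le f : csumm f -> cabs (csum f) <= 2 * pval (fun i => cabs (f i)).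
Proof.
move=> sf; apply: le_trans (cabs_le_ReIm _) _ => /=.
have a1 := rsum_le (csumm_Re sf); have a2 := rsum_le (csumm_Im sf).
have b1 : pval (fun i => `|complex.Re (f i)|) <= pval (fun i => cabs (f i)).
  by apply: le_pval => // i; rewrite normr_ge0 absRe_le.
have b2 : pval (fun i => `|complex.Im (f i)|) <= pval (fun i => cabs (f i)).
  by apply: le_pval => // i; rewrite normr_ge0 absIm_le.
lra.
Qed.

Lemma csum_fin f (s : seq I) : uniq s -> (forall i, i \notin s -> f i = 0) ->
  csumm f /\ csum f = \sum_(i <- s) f i.
Proof.
elim: s f => [|a s ih] f /=.
  move=> _ f0; have -> : f = fun=> 0 by apply/funext => i; rewrite f0.
  rewrite big_nil; split.
    by rewrite /csumm; under eq_fun do rewrite cabs0; exact: summ0.1.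
  apply: ReIm_eq => /=; rewrite rsum_ge0 ?summ0.2 //; exact: summ0.1.
move=> /andP[as_ us] fs.
pose g i := if i == a then 0 else f i.
have gs i : i \notin s -> g i = 0.
  by rewrite /g; case: eqVneq => // ia ni; rewrite fs// inE negb_or ia.
have [sg gE] := ih g us gs.
pose d i := if i == a then f a else 0.
have dz i : i != a -> d i = 0 by rewrite /d => /negbTE ->.
have sd : csumm d.
  have dz' i : i \notin [:: a] -> cabs (d i) = 0 by rewrite inE => /dz ->; rewrite cabs0.
  exact: (pval_seq (isT : uniq [:: a]) (fun i => cabs_ge0 (d i)) dz').1.
have fE : f = fun i => d i + g i.
  by apply/funext => i; rewrite /d /g; case: eqVneq => [->|]; rewrite ?addr0 ?add0r.
have sf : csumm f by rewrite [X in csumm X]fE; exact: csummD.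
have -> : csum f = csum d + csum g by rewrite [in LHS]fE csumD.
split=> //; rewrite gE (csum_single dz) big_cons {1}/d eqxx; congr (_ + _).
apply: eq_big_seq => i si; rewrite /g ifN//.
by apply: contra as_ => /eqP <-.
Qed.

(** Once the finite set contains the list given by [tsum_tail], the remainder of the family vanishes
    on that list and is small in absolute sum. Starting from half of [e] absorbs the factor 2 of
    [csum_le]. *)
Lemma csumm_sums_to f : csumm f -> sums_to (f : I -> R[i]^o) (csum f : R[i]^o).
Proof.
move=> sf; have PF := @summability.totally_filter I.
apply/cvgrPdist_le => e e0.
have er : e = (complex.Re e)%:C%C by rewrite RRe_real// realE (ltW e0).
have e1 : 0 < complex.Re e / 2 by rewrite divr_gt0// -ltcR -er.
have [s us sP] := tsum_tail (fun i => cabs_ge0 (f i)) sf e1.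
have [B BP] : exists B : finmap.finset_of (Phant I), forall i, i \in s -> i \in finmap.enum_fset B.
  by exists (finmap.seq_fset tt s) => i si; rewrite [_ \in _](seq_fsetE tt s i).
exists B => // A BA.
have sub i : i \in s -> i \in finmap.enum_fset A by move=> /BP; exact: (finmap.fsubsetP BA).
rewrite /summability.partial_sum -(finmap.big_seq_fsetE _ _ predT) /=.
set t := finmap.enum_fset A in sub *.
have ut : uniq t by exact: finmap.fset_uniq.
pose g i := if i \in t then f i else 0.
pose h i := if i \in t then 0 else f i.
have fE : f = fun i => g i + h i.
  by apply/funext => i; rewrite /g /h; case: ifP; rewrite ?addr0 ?add0r.
have gt i : i \notin t -> g i = 0 by rewrite /g => /negbTE ->.
have [sg gE] := csum_fin ut gt.
have hle i : 0 <= cabs (h i) <= cabs (f i).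
  by rewrite cabs_ge0 /h /=; case: ifP; rewrite ?cabs0 ?cabs_ge0 ?lexx.
have sh : csumm h by apply: le_summ sf => i; case/andP: (hle i).
have hP : pval (fun i => cabs (h i)) <= complex.Re e / 2.
  apply: sP => // i si; rewrite /h ifT ?cabs0//; exact: sub.
have -> : csum f - \sum_(i <- t) f i = csum h.
  rewrite [X in csum X]fE csumD// gE addrAC.
  rewrite [X in X - _ + _](_ : _ = \sum_(i <- t) f i) ?subrr ?add0r//.
  by apply: eq_big_seq => i it; rewrite /g it.
rewrite er normC_cabs lecR; apply: le_trans (csum_le sh) _; lra.
Qed.

End UnconditionalSums.

Section Zeta.
Context {R : realType}.
Local Notation C := (R[i]^o).
Implicit Types (f g : int -> R[i]) (K : set int) (z : R[i]).

Lemma summ_geo_nat (r : R) : 0 <= r < 1 -> summ (fun n : nat => r ^+ n).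
Proof.
move=> /andP[r0 r1].
have f0 n : 0 <= r ^+ n by rewrite exprn_ge0.
apply: (@summ_seq _ _ _ (1 - r)^-1 f0 _).1 => t ut.
pose N := (\max_(i <- t) i).+1.
have tN i : i \in t -> (i < N)%N by move=> it; rewrite ltnS (@leq_bigmax_seq _ _ xpredT id).
rewrite (perm_big [seq i <- iota 0 N | i \in t]); last first.
  apply: uniq_perm; rewrite ?filter_uniq ?iota_uniq// => i.
  by rewrite mem_filter mem_iota /= add0n; case: (boolP (i \in t)) => // /tN ->.
rewrite big_filter; apply: le_trans (_ : \sum_(i <- iota 0 N) r ^+ i <= _).
  by rewrite [leRHS](bigID (mem t))/= lerDl sumr_ge0.
have -> : \sum_(i <- iota 0 N) r ^+ i = \sum_(i < N) r ^+ i.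
  by rewrite -(big_mkord xpredT (fun i => r ^+ i)) /index_iota subn0.
have r1' : 0 < 1 - r by rewrite subr_gt0.
rewrite -[leRHS]mul1r ler_pdivlMr// mulrC -(opprB r 1) mulNr -subrX1 opprB.
by rewrite gerBl.
Qed.

Lemma summ_geo (r : R) : 0 <= r < 1 -> summ (fun n : int => if 0 <= n then r ^+ `|n|%N else 0).
Proof.
move=> r01; have [r0 r1] := andP r01.
have f0 (n : int) : 0 <= (if 0 <= n then r ^+ `|n|%N else 0) by case: ifP; rewrite ?exprn_ge0.
apply: (@summ_seq _ _ _ (pval (fun n : nat => r ^+ n)) f0 _).1 => s us.
pose t := [seq `|n|%N | n <- s & 0 <= n].
have -> : \sum_(n <- s) (if 0 <= n then r ^+ `|n|%N else 0) = \sum_(i <- t) r ^+ i.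
  by rewrite /t big_map big_filter -big_mkcond.
apply: pval_ge_seq; [by move=> n; rewrite exprn_ge0|exact: summ_geo_nat|].
rewrite map_inj_in_uniq ?filter_uniq// => a b.
by rewrite !mem_filter => /andP[a0 _] /andP[b0 _]; lia.
Qed.

Lemma bij_oppz : bijective (fun n : int => - n).
Proof. by exists (fun n => - n) => n; rewrite opprK. Qed.

Lemma summ_exp (c : R) : 0 < c -> summ (fun n : int => expR (- c * (`|n|%N)%:R)).
Proof.
move=> c0; pose r := expR (- c).
have r01 : 0 <= r < 1.
  by rewrite expR_ge0 -expR0 ltr_expR oppr_lt0.
have E (n : int) : expR (- c * (`|n|%N)%:R) = r ^+ `|n|%N by rewrite expRM_natr.
pose f (n : int) : R := if 0 <= n then r ^+ `|n|%N else 0.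
have f0 n : 0 <= f n by rewrite /f; case: ifP => //; rewrite exprn_ge0// expR_ge0.
have sf : summ f := summ_geo r01.
have sf' : summ (fun n => f (- n)).
  by rewrite /summ (tsum_reindex f bij_oppz).
apply: (le_summ _ (summD f0 (fun n => f0 (- n)) sf sf')) => n.
rewrite E /f abszN; case: (lerP 0 n) => n0.
  by rewrite lerDl; case: ifP => //; rewrite exprn_ge0 ?expR_ge0.
by rewrite add0r ifT//; lia.
Qed.

Definition geo (q : R[i]) (n : int) : R[i] := if 0 <= n then q ^+ `|n|%N else 0.
Definition ngeo (q : R[i]) (n : int) : R[i] := if 0 <= n then 0 else q ^+ `|n|%N.

(** The family equals the delta at 0 plus q times its own translate, so its sum s satisfies s = 1 +
    q s, which determines s without a limit of partial sums. *)
Lemma csum_geo (q : R[i]) : cabs q < 1 -> csumm (geo q) /\ csum (geo q) = (1 - q)^-1.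
Proof.
move=> q1; have sg : csumm (geo q).
  have q01 : 0 <= cabs q < 1 by rewrite cabs_ge0.
  apply: le_summ (summ_geo q01) => n; rewrite /geo; case: ifP => _.
    by rewrite cabsX.
  by rewrite cabs0.
split => //.
have sg1 : csumm (fun n => geo q (n - 1)).
  rewrite /csumm /summ.
  by rewrite (tsum_reindex (fun n => cabs (geo q n)) (bij_shift (-1))).
have gE : geo q = fun n => (n == 0)%:R + q * geo q (n - 1).
  apply/funext => n; rewrite /geo; have [->|n0] := eqVneq n 0.
    by rewrite /= expr0 mulr0 addr0.
  rewrite add0r; case: ifP => n1; last by rewrite ifF ?mulr0//; lia.
  rewrite ifT; last lia.
  by rewrite -exprS; congr (_ ^+ _); lia.
have dz (n : int) : n != 0 -> ((n == 0)%:R : R[i]) = 0 by move=> /negbTE ->.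
have sd : csumm (fun n : int => (n == 0)%:R : R[i]).
  by have [] := @csum_fin R _ (fun n : int => (n == 0)%:R) [:: 0] isT => // n; rewrite inE => /dz.
have : csum (geo q) = 1 + q * csum (geo q).
  rewrite [in LHS]gE csumD//; last exact: csummZ.
  rewrite (csum_single dz) csumZ//; congr (_ + _ * _).
  exact: (csum_reindex (geo q) (bij_shift (-1))).
have q0 : 1 - q != 0.
  by rewrite subr_eq0; apply: contraTneq q1 => <-; rewrite cabs1 ltxx.
move=> E; apply: (mulfI q0); rewrite mulfV// mulrBl mul1r {1}E.
by rewrite addrK.
Qed.

(** The negative half-line is the reflection of the nonnegative one with n = 0 removed, whence the
    term -1. *)
Lemma csum_ngeo (q : R[i]) : cabs q < 1 -> csumm (ngeo q) /\ csum (ngeo q) = (1 - q)^-1 - 1.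
Proof.
move=> q1; have [sg gE] := csum_geo q1.
have E : ngeo q = fun n => geo q (- n) + - 1 * (n == 0)%:R.
  apply/funext => n; rewrite /ngeo /geo abszN; have [->|n0] := eqVneq n 0.
    by rewrite /= expr0 mulr1 subrr.
  rewrite mulr0 addr0; case: ifP => n1; [rewrite ifF//|rewrite ifT//]; lia.
have dz (n : int) : n != 0 -> ((n == 0)%:R : R[i]) = 0 by move=> /negbTE ->.
have sd : csumm (fun n : int => (n == 0)%:R : R[i]).
  by have [] := @csum_fin R _ (fun n : int => (n == 0)%:R) [:: 0] isT => // n; rewrite inE => /dz.
have sg1 : csumm (fun n => geo q (- n)).
  by rewrite /csumm /summ (tsum_reindex (fun n => cabs (geo q n)) bij_oppz).
rewrite E; split; first by apply: csummD => //; exact: csummZ.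
rewrite csumD//; last exact: csummZ.
rewrite (csumZ _ sd) (csum_single dz) mulr1; congr (_ - _).
by rewrite -gE; exact: (csum_reindex (geo q) bij_oppz).
Qed.

(** The points where exponents in [K] can produce poles. There are none for empty [K], so a finite
    matrix has an entire zeta function. *)
Definition SdK K : set C := [set z | exists2 k, K k & kexp k z = 1].

(** The eigenvalue of |DD|^{-2z} at e_n. *)
Definition zw z (n : int) : R[i] := cexp (- (2 * z) * (`|n|%N)%:R).

Lemma kexp_zw (k n : int) z : (ew k n)%:C%C * zw z n = kexp k z ^+ `|n|%N.
Proof.
rewrite -cexp_real -cexpD -cexpMn; congr cexp.
by rewrite rmorphM/= rmorph_int rmorph_nat -mulr_natr; ring.
Qed.

Lemma cabs_kexp (k : int) z : k%:~R / 2 < complex.Re z -> cabs (kexp k z) < 1.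
Proof.
move=> kz; rewrite cabs_cexp -expR0 ltr_expR.
have -> : (- 2 * z + k%:~R) = (- 2 : R)%:C%C * z + (k%:~R : R)%:C%C.
  by rewrite rmorphN rmorph_nat rmorph_int.
by case: z kz => a b /=; rewrite mul0r subr0; lra.
Qed.

Lemma EP_zeta K f : EP K f -> exists Z : C -> C, [/\ meromorphic Z,
  forall z, ~ SdK K z -> holomorphic_at Z z &
  exists r : R, forall z, r < complex.Re z ->
    csumm (fun n => f n * zw z n) /\ csum (fun n => f n * zw z n) = Z z].
Proof.
elim=> [m|k Kk|k Kk|{}f g _ [Z [mZ hZ [r rP]]] _ [Z' [mZ' hZ' [r' rP']]]|c {}f _ [Z [mZ hZ [r rP]]]].
- have hz z0 : holomorphic_at ((fun z => zw z m) : C -> C) z0.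
    have -> : (fun z => zw z m) = fun z => cexp ((- 2 * (`|m|%N)%:R) * z + 0).
      by apply/funext => z; rewrite /zw addr0; congr cexp; ring.
    exact: holomorphic_cexp.
  exists (fun z => zw z m); split => //; first exact: meromorphic_entire.
  exists 0 => z _.
  have dz n : n != m -> (n == m)%:R * zw z n = 0 by move=> /negbTE ->; rewrite mul0r.
  split; last by rewrite (csum_single dz) eqxx mul1r.
  by have [] := @csum_fin R _ (fun n => (n == m)%:R * zw z n) [:: m] isT => // n; rewrite inE => /dz.
- exists (zetak k); split; first exact: meromorphic_zetak.
    by move=> z nz; apply: holomorphic_zetak; apply/eqP => e; apply: nz; exists k.
  exists (k%:~R / 2) => z kz.
  have -> : (fun n => (if 0 <= n then (ew k n)%:C%C else 0) * zw z n) = geo (kexp k z).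
    by apply/funext => n; rewrite /geo; case: ifP; rewrite ?mul0r ?kexp_zw.
  exact: csum_geo (cabs_kexp kz).
- exists (fun z => zetak k z + (-1)); split.
  + apply: meromorphicD; first exact: meromorphic_zetak.
    by apply: meromorphic_entire => z0; exact: holomorphic_cst.
  + move=> z nz; apply: holomorphicD; last exact: holomorphic_cst.
    by apply: holomorphic_zetak; apply/eqP => e; apply: nz; exists k.
  exists (k%:~R / 2) => z kz.
  have -> : (fun n => (if 0 <= n then 0 else (ew k n)%:C%C) * zw z n) = ngeo (kexp k z).
    by apply/funext => n; rewrite /ngeo; case: ifP; rewrite ?mul0r ?kexp_zw.
  exact: csum_ngeo (cabs_kexp kz).
- exists (fun z => Z z + Z' z); split; first exact: meromorphicD.
    by move=> z nz; apply: holomorphicD; [exact: hZ|exact: hZ'].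
  exists (Num.max r r') => z; rewrite gt_max => /andP[rz rz'].
  have [s1 e1] := rP z rz; have [s2 e2] := rP' z rz'.
  have -> : (fun n => (f n + g n) * zw z n) = fun n => f n * zw z n + g n * zw z n.
    by apply/funext => n; rewrite mulrDl.
  by split; [exact: csummD|rewrite csumD// e1 e2].
- exists (fun z => c * Z z); split; first exact: meromorphicZ.
    by move=> z nz; apply: holomorphicM; [exact: holomorphic_cst|exact: hZ].
  exists r => z rz; have [s1 e1] := rP z rz.
  have -> : (fun n => c * f n * zw z n) = fun n => c * (f n * zw z n).
    by apply/funext => n; rewrite mulrA.
  by split; [exact: csummZ|rewrite csumZ// e1].
Qed.

End Zeta.

(** * Compactness and Schatten classes *)

Section Cube.
Context {R : realType} {I : choiceType}.
Variables (M : I -> R) (M0 : forall i, 0 <= M i) (sM : summ (fun i => M i ^+ 2)).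
Local Notation V := (@ell2 R I).

(** A Hilbert cube: square-summable sides make it compact, and compactness of an operator is shown
    by placing the image of the unit ball inside one. *)
Definition cube : set V := [set x : V | forall i, cabs (x i) <= M i].

(* Coordinates of an ultrafilter on the cube converge in compact intervals. *)
Lemma ultra_real_lim (F : set_system V) (phi : V -> R) (m : R) : UltraFilter F ->
  F [set x | `|phi x| <= m] -> exists c : R, forall e, 0 < e -> F [set x | `|phi x - c| <= e].
Proof.
move=> FU Fm.
have [c [_ cc]] : exists c, (`[- m, m]%classic `&` cluster (phi @ F)) c.
  apply: segment_compact; change (F (phi @^-1` `[- m, m])).
  by apply: filterS Fm => x /=; rewrite in_itv/= -ler_norml.
exists c => e e0.
have [//|Fn] := in_ultra_setVsetC [set x | `|phi x - c| <= e] FU.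
have PF : (phi @ F) [set t | ~ (`|t - c| <= e)] by exact: Fn.
have [t [/= t1 t2]] := cc _ _ PF (nbhsx_ballx c e e0).
by case: t1; move: t2; rewrite -ball_normE /= distrC => /ltW.
Qed.

(** Along an ultrafilter each coordinate converges. Norm convergence follows by splitting the
    indices: those in a finite [s] are uniformly close, and outside [s] both x and the limit [c]
    obey the bound [M], so |c - x|^2 is at most 4 M^2, which has a small tail. *)
Lemma compact_cube : compact cube.
Proof.
rewrite compact_ultra => F FU FC.
have H i : exists c : R[i], forall e, 0 < e -> F [set x : V | cabs (x i - c) <= e].
  have [|a aP] := @ultra_real_lim F (fun x : V => complex.Re (x i)) (M i) FU.
    by apply: filterS FC => x xC /=; apply: le_trans (absRe_le _) (xC i).
  have [|b bP] := @ultra_real_lim F (fun x : V => complex.Im (x i)) (M i) FU.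
    by apply: filterS FC => x xC /=; apply: le_trans (absIm_le _) (xC i).
  exists (a +i* b)%C => e e0.
  have e2 : 0 < e / 2 by rewrite divr_gt0.
  apply: filterS2 (aP _ e2) (bP _ e2) => x /= xa xb.
  apply: le_trans (cabs_le_ReIm _) _.
  by rewrite (splitr e); apply: lerD; rewrite raddfB.
have [c cP] := choice H.
have cM i : cabs (c i) <= M i.
  apply/ler_addgt0Pr => e e0.
  have [x [xC xc]] := filter_ex (filterI FC (cP i e e0)).
  have -> : c i = x i + (c i - x i) by rewrite addrC subrK.
  by apply: le_trans (cabsD _ _) _; apply: lerD; [exact: xC|rewrite cabsB].
have sq_le (z : R[i]) (r : R) : cabs z <= r -> sqn z <= r ^+ 2.
  by move=> zr; rewrite sqnE lerXn2r ?nnegrE ?cabs_ge0// (le_trans (cabs_ge0 _) zr).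
have lc : l2 c by apply: le_summ sM => i; exact: sq_le.
exists (mkl2 lc); split; first exact: cM.
apply/cvgrPdist_le => e e0.
have er : e = (complex.Re e)%:C%C by rewrite RRe_real// realE (ltW e0).
set r := complex.Re e in er.
have r0 : 0 < r by rewrite -ltcR -er.
have r2 : 0 < r ^+ 2 / 2 by rewrite divr_gt0// exprn_gt0.
have p4 i : 0 <= 4 * M i ^+ 2 by rewrite mulr_ge0// sqr_ge0.
have s4 : summ (fun i => 4 * M i ^+ 2).
  by have [] := summZ (ler0n R 4) (fun i => sqr_ge0 (M i)) sM.
have [s us sP] := tsum_tail p4 s4 r2.
have [h h0 hE] : exists2 h, 0 < h & h * (size s).+1%:R = r / 2.
  exists (r / (2 * (size s).+1%:R)); first by rewrite divr_gt0// mulr_gt0.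
  by rewrite invfM mulrA mulfVK// pnatr_eq0.
have Fs : F [set x : V | forall i, i \in s -> cabs (x i - c i) <= h].
  by apply: filter_seq => i; exact: cP.
apply: filterS2 FC Fs => x xC xs; rewrite er ell2_normE lecR.
rewrite -ler_sqr ?nnegrE ?l2n_ge0 ?(ltW r0)// -l2nsqE.
pose d := mkl2 lc - x.
pose g1 i := if i \in s then sqn (d i) else 0.
pose g2 i := if i \in s then 0 else sqn (d i).
have g10 i : 0 <= g1 i by rewrite /g1; case: ifP; rewrite ?sqn_ge0.
have g20 i : 0 <= g2 i by rewrite /g2; case: ifP; rewrite ?sqn_ge0.
have g1s i : i \notin s -> g1 i = 0 by rewrite /g1 => /negbTE ->.
have [sg1 E1] := pval_seq us g10 g1s.
have dE i : d i = c i - x i by [].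
have g24 i : g2 i <= 4 * M i ^+ 2.
  rewrite /g2; case: ifP => _; first exact: p4.
  rewrite dE; have := sq_le (c i - x i) (2 * M i); rewrite exprMn -natrX; apply.
  apply: le_trans (cabsD _ _) _; rewrite cabsN mulr_natl mulr2n.
  by apply: lerD; [exact: cM|exact: xC].
have sg2 : summ g2 := le_summ g24 s4.
have -> : l2nsq d = pval g1 + pval g2.
  rewrite -pvalD//; congr pval; apply/funext => i.
  by rewrite /g1 /g2; case: ifP; rewrite ?addr0 ?add0r.
have b2 : pval g2 <= r ^+ 2 / 2.
  apply: sP => i; first by rewrite g20 g24.
  by move=> si; rewrite /g2 si.
have b1 : pval g1 <= r ^+ 2 / 2.
  rewrite E1; apply: le_trans (_ : \sum_(i <- s) h ^+ 2 <= _).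
    rewrite big_seq [leRHS]big_seq; apply: ler_sum => i si.
    by rewrite /g1 si dE sq_le// cabsB xs.
  rewrite big_const_seq iter_addr_0 count_predT -mulr_natr.
  have n0 : (size s)%:R <= (size s).+1%:R :> R by rewrite ler_nat.
  have n1 : 1 <= (size s).+1%:R :> R by rewrite ler1n.
  apply: le_trans (_ : 2 * (h * (size s).+1%:R) ^+ 2 <= _); last by rewrite hE; lra.
  have n2 : (size s).+1%:R <= (size s).+1%:R ^+ 2 :> R by rewrite expr2 ler_peMl// ler0n.
  have m1 := ler_wpM2l (sqr_ge0 h) (le_trans n0 n2).
  have m2 := mulr_ge0 (sqr_ge0 h) (sqr_ge0 ((size s).+1%:R : R)).
  rewrite exprMn; lra.
lra.
Qed.

End Cube.

(** * Trace class and compact operators from exponential decay *)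

Section Schatten.
Context {R : realType}.
Local Notation V := (@ell2 R int).
Local Notation HS := (@ell2_hilbert R int).

(** The order 0, -1, 1, -2, 2, ... fills Z symmetrically, so the first n values cover an interval of
    radius about n/2. *)
Definition nu (i : nat) : int := if odd i then Negz i./2 else Posz i./2.
Definition nu_inv (k : int) : nat := match k with Posz m => m.*2 | Negz m => m.*2.+1 end.

Lemma nuK : cancel nu nu_inv.
Proof. by move=> i; rewrite /nu; case: ifP => oi /=; rewrite -[RHS]odd_double_half oi. Qed.

Lemma nu_invK : cancel nu_inv nu.
Proof. by case=> m; rewrite /nu /= ?odd_double ?doubleK// uphalf_double. Qed.

Lemma nu_bij : bijective nu.
Proof. by exists nu_inv; [exact: nuK|exact: nu_invK]. Qed.

Definition vanish (m : nat) (x : V) := forall n : int, (`|n| < m)%N -> x n = 0.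

Lemma bounded_op_comp (a b : HS -> HS) : bounded_op a -> bounded_op b -> bounded_op (a \o b).
Proof.
move=> [la [M aM]] [lb [N bN]]; split; first by move=> c x y; rewrite /= lb la.
exists (`|M| * N) => x /=; apply: le_trans (aM _) _.
apply: le_trans (_ : (`|M|)%:C%C * `|b x| <= _).
  by rewrite ler_wpM2r// lecR ler_norm.
by rewrite rmorphM/= -mulrA ler_wpM2l// lecR.
Qed.

(* The approximants of rank n cut off all but the first n basis vectors in the
   enumeration nu of Z; the remainder vanishes at all k with |k| < n/2. *)
Lemma schatten_decay (a : HS -> HS) (D c : R) : linear a -> 0 <= D -> 0 < c ->
  (forall m (x : V), vanish m x -> l2n (a x : V) <= D * expR (- c * m%:R) * l2n x) ->
  schatten 1 a.
Proof.
move=> la D0 c0 aD.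
have ba : bounded_op a.
  split => //; exists D => x; rewrite !ell2_normE -rmorphM/= lecR.
  by have := aD 0%N x; rewrite mulr0 expR0 mulr1; apply.
split => //.
have bP n : bounded_fun (fun k => (nu_inv k < n)%N%:R : R[i]).
  by exists 1 => // k; case: (_ < _)%N; rewrite ?cabs1 ?cabs0.
have sv n : 0 <= singular_value a n <= D * expR (- c * n./2%:R).
  apply/andP; split.
    apply: lb_le_inf; last by move=> M /= [].
    case: ba => _ [M aM]; exists `|M|; split => //.
    exists (fun=> 0); split.
    - split; first by move=> k x y; rewrite scaler0 addr0.
      by exists 0 => x; rewrite normr0 mul0r.
    - by exists (fun=> 0) => x; exists (fun=> 0); rewrite big1// => i _; rewrite scaler0.
    - move=> x; rewrite subr0; apply: le_trans (aM x) _.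
      by rewrite ler_wpM2r// lecR ler_norm.
  apply: ge_inf; first by exists 0 => M /= [].
  split; first by rewrite mulr_ge0 ?expR_ge0.
  pose P : HS -> HS := mulop (fun k => (nu_inv k < n)%N%:R).
  exists (a \o P); split.
  - by apply: bounded_op_comp => //; exact: mulop_bounded.
  - exists (fun i => a (delta (nu i))) => x; exists (fun i => (x : V) (nu i)).
    have PE : P x = \sum_(i < n) (x : V) (nu i) *: (delta (nu i) : HS).
      apply: ell2_ext => k; rewrite /P mulop_bE//.
      have -> : l2v (\sum_(i < n) (x : V) (nu i) *: (delta (nu i) : HS)) k =
          \sum_(i < n) (x : V) (nu i) * (k == nu i)%:R.
        rewrite (big_morph (fun v : V => v k) (id1 := 0) (op1 := +%R))//.
      case: ltnP => kn.
        rewrite mul1r (bigD1 (Ordinal kn))//= nu_invK eqxx mulr1 big1 ?addr0// => i ik.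
        have -> : (k == nu i) = false.
          apply: contraNF ik => /eqP ki; apply/eqP/val_inj => /=.
          by rewrite ki nuK.
        by rewrite mulr0.
      rewrite mul0r big1// => i _.
      have -> : (k == nu i) = false.
        by apply: contraTF kn => /eqP ->; rewrite nuK -ltnNge.
      by rewrite mulr0.
    have a0 : a 0 = 0.
      by have := la (-1) 0 0; rewrite scaler0 addr0 scaleN1r addNr.
    have aDD x1 x2 : a (x1 + x2) = a x1 + a x2.
      by have := la 1 x1 x2; rewrite !scale1r.
    transitivity (a (P x)) => //.
    rewrite PE (big_morph a aDD a0); apply: eq_bigr => i _.
    by have := la ((x : V) (nu i)) (delta (nu i)) 0; rewrite !addr0 a0 addr0.
  - move=> x /=; have aB : a x - a (P x) = a (x - P x).
      by have := la (-1) (P x) x; rewrite !scaleN1r ![- _ + _]addrC.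
    rewrite aB !ell2_normE -rmorphM/= lecR.
    have yE k : (x - P x : V) k = (if (nu_inv k < n)%N then 0 else (x : V) k).
      rewrite ell2DE ell2NE /P mulop_bE//.
      by case: ltnP; rewrite ?mul1r ?mul0r ?subrr ?subr0.
    have van : vanish n./2 (x - P x : V).
      move=> k kn; rewrite yE ifT//.
      by case: k kn => k /=; rewrite ?NegzE ?abszN /= => kn; lia.
    apply: le_trans (aD _ _ van) _.
    rewrite ler_wpM2l ?mulr_ge0 ?expR_ge0// ler_sqrt ?l2nsq_ge0//.
    apply: le_pval; last exact: l2vP.
    by move=> k; rewrite sqn_ge0 yE /=; case: ifP => _; rewrite ?sqn0 ?sqn_ge0 ?lexx.
(* Rank n reaches only the bound e^{-c floor(n/2)}, so the geometric ratio is e^{-c/2}; the factor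
   e^{c/2} pays for the rounding. *)
pose r := expR (- c / 2).
have r01 : 0 <= r < 1 by rewrite expR_ge0 -expR0 ltr_expR mulNr oppr_lt0 divr_gt0.
have svr j : singular_value a j `^ 1 <= D * expR (c / 2) * r ^+ j.
  have /andP[s0 s1] := sv j; rewrite powRr1//; apply: le_trans s1 _.
  rewrite -mulrA ler_wpM2l// /r -expRM_natr -expRD ler_expR.
  have : j%:R <= (2 * j./2 + 1)%:R :> R by rewrite ler_nat; lia.
  by rewrite natrD natrM; nra.
have sv0 j : 0 <= singular_value a j `^ 1 by exact: powR_ge0.
have DE0 : 0 <= D * expR (c / 2) by rewrite mulr_ge0 ?expR_ge0.
have := le_summ svr (summZ DE0 (fun n => exprn_ge0 n (andP r01).1) (summ_geo_nat r01)).1.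
by rewrite /summ /tsum -nneseries_esumT// => n; rewrite lee_fin.
Qed.

Lemma decay_l2 (c : R) : 0 < c -> exists2 S : R, 0 <= S & forall (B : R) (x : int -> R[i]),
  0 <= B -> decay c B x -> l2 x /\ l2n x <= S * B.
Proof.
move=> c0; have c2 : 0 < 2 * c by rewrite mulr_gt0.
have sx := @summ_exp R _ c2.
pose f (n : int) : R := expR (- (2 * c) * (`|n|%N)%:R).
have f0 n : 0 <= f n := expR_ge0 _.
exists (Num.sqrt (pval f)); first exact: sqrtr_ge0.
move=> B x B0 xd.
have le n : sqn (x n) <= B ^+ 2 * f n.
  rewrite sqnE; apply: le_trans (_ : (B * expR (- c * (`|n|%N)%:R)) ^+ 2 <= _).
    by rewrite lerXn2r ?nnegrE ?cabs_ge0 ?mulr_ge0 ?expR_ge0//; exact: xd.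
  rewrite exprMn -expRM_natr; apply: ler_wpM2l; first exact: sqr_ge0.
  by rewrite /f ler_expR; lra.
have [s1 s2] := summZ (sqr_ge0 B) f0 sx.
have lx : l2 x := le_summ le s1.
split => //; rewrite -[in leRHS](ger0_norm B0) -sqrtr_sqr -sqrtrM ?pval_ge0//.
rewrite ler_sqrt ?mulr_ge0 ?sqr_ge0 ?pval_ge0// mulrC.
by apply: le_trans s2; apply: le_pval => // n; rewrite sqn_ge0 le.
Qed.

Lemma schatten_diag (f : int -> R[i]) : (forall n, cabs (f n) <= expR (- (`|n|%N)%:R)) ->
  schatten 1 (mulop f : HS -> HS).
Proof.
move=> fd; have bf : bounded_fun f.
  by exists 1 => // n; apply: le_trans (fd n) _; rewrite -expR0 ler_expR oppr_le0.
apply: (@schatten_decay _ 1 1) => //; first exact: (mulop_bounded bf).1.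
move=> m x xm.
have E : (mulop f (x : HS) : V) = (fun n => (if (`|n| < m)%N then 0 else f n) * x n) :> (int -> R[i]).
  apply/funext => n; rewrite mulop_bE//; case: ifP => // nm.
  by rewrite (xm n nm) !mulr0.
rewrite E mul1r mulN1r.
have [|_] // := @bounded_fun_l2 R _ (fun n => if (`|n| < m)%N then 0 else f n) (expR (- m%:R)) x (expR_ge0 _).
move=> n; case: ltnP => nm; first by rewrite cabs0 expR_ge0.
by apply: le_trans (fd n) _; rewrite ler_expR lerN2 ler_nat.
Qed.

Lemma cabs_zw (z : R[i]) n : cabs (zw z n) = expR (- (2 * complex.Re z) * (`|n|%N)%:R).
Proof.
rewrite cabs_cexp; congr expR.
have -> : - (2 * z) * (`|n|%N)%:R = (- 2 * (`|n|%N)%:R : R)%:C%C * z.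
  by rewrite rmorphM/= rmorphN/= !rmorph_nat; ring.
by case: z => a b /=; ring.
Qed.

(** The weight [zw] decays like e^{-2 rho |n|} with rho = Re z. One factor e^{-rho |n|}, at most
    e^{-rho m} outside radius m, supplies the decay that [schatten_decay] asks for; the other
    outweighs the growth rate [k] of the coefficients as soon as rho > k. *)
Lemma trace_op K (L : (int -> R[i]) -> int -> R[i]) : Op K L -> exists2 r : R, 0 <= r &
  forall z, r < complex.Re z ->
  (forall x : V, l2 (L (fun n => zw z n * x n))) /\
  forall a : HS -> HS, (forall (x : V) n, (a x : V) n = L (fun n => zw z n * x n) n) -> schatten 1 a.
Proof.
move=> KL; have [k k0 kP] := Op_decay KL.
exists k => // z kz; set rho := complex.Re z in kz *.
have rho0 : 0 <= rho by lra.
have [D D0 DP] := kP _ rho0.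
have rk : 0 < rho - k by rewrite subr_gt0.
have [S S0 SP] := decay_l2 rk.
have key m (x : V) : vanish m x ->
    decay rho (expR (- rho * m%:R) * l2n x) (fun n => zw z n * x n).
  move=> xm n; rewrite cabsM; case: (ltnP `|n|%N m) => nm.
    by rewrite (xm n nm) cabs0 mulr0 !mulr_ge0 ?expR_ge0 ?l2n_ge0.
  rewrite cabs_zw -/rho.
  apply: le_trans (_ : expR (- (2 * rho) * (`|n|%N)%:R) * l2n x <= _).
    by rewrite ler_wpM2l ?expR_ge0//; exact: (l2n_ge_term n (l2vP x)).
  rewrite mulrAC ler_wpM2r ?l2n_ge0// -expRD ler_expR.
  have : rho * m%:R <= rho * (`|n|%N)%:R by rewrite ler_wpM2l// ler_nat.
  by lra.
have est m (x : V) : vanish m x -> l2 (L (fun n => zw z n * x n)) /\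
    l2n (L (fun n => zw z n * x n)) <= S * (D * (expR (- rho * m%:R) * l2n x)).
  move=> xm; have B0 : 0 <= expR (- rho * m%:R) * l2n x by rewrite mulr_ge0 ?expR_ge0 ?l2n_ge0.
  by apply: SP; [rewrite mulr_ge0|apply: DP => //; exact: key].
split; first by move=> x; apply: (est 0%N x _).1.
move=> a aE.
have rho1 : 0 < rho by lra.
apply: (@schatten_decay a (S * D) rho) => //; last 2 first.
- by rewrite mulr_ge0.
- move=> m x xm; have [_] := est m x xm.
  by rewrite !mulrA; congr (l2n _ <= _); apply/funext => n; rewrite aE.
move=> c x y; apply: ell2_ext => n; rewrite ell2DE ell2ZE !aE -(Op_linear KL).
by congr (L _ n); apply/funext => m; rewrite ell2DE ell2ZE; ring.
Qed.

(** In contrast to [Op_decay], bounded coefficients lose no rate, so the full decay e^{-|n|} of the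
    eigenvalues of (1 + DD^2)^{-1/2} is kept. *)
Lemma Op0_decay (L : (int -> R[i]) -> int -> R[i]) : Op [set 0] L -> exists2 D : R, 0 <= D &
  forall B x, 0 <= B -> decay 1 B x -> decay 1 (D * B) (L x).
Proof.
elim=> [f d /EP_bounded[M M0 fM]|{}L L' _ [D D0 DP] _ [E E0 EP]].
- exists (M * expR (`|d|%N)%:R); first by rewrite mulr_ge0 ?expR_ge0.
  move=> B x B0 xd n; rewrite cabsM.
  apply: le_trans (ler_pM (cabs_ge0 _) (cabs_ge0 _) (fM n) (xd _)) _.
  rewrite -!mulrA; apply: ler_wpM2l => //.
  rewrite [leRHS]mulrCA; apply: ler_wpM2l => //.
  rewrite -!expRD ler_expR.
  have : (`|n|%N)%:R <= (`|(n + d)%R|%N)%:R + (`|d|%N)%:R :> R by rewrite -natrD ler_nat; lia.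
  lra.
- exists (D + E); first exact: addr_ge0.
  move=> B x B0 xd n; rewrite (le_trans (cabsD _ _))// !mulrDl; apply: lerD; [exact: DP|exact: EP].
Qed.

(** The diagonal factor sends the unit ball to sequences bounded by e^{-|n|}, which the band
    operator sends into a cube with sides D e^{-|n|}. *)
Lemma compact_band (L : (int -> R[i]) -> int -> R[i]) (a : HS -> HS) (f : int -> R[i]) :
  Op [set 0] L -> bounded_op a -> (forall (x : V) n, (a x : V) n = L x n) ->
  (forall n, cabs (f n) <= expR (- (`|n|%N)%:R)) ->
  compact_op (a \o (mulop f : HS -> HS)).
Proof.
move=> KL ba aE fd; have bf : bounded_fun f.
  by exists 1 => // n; apply: le_trans (fd n) _; rewrite -expR0 ler_expR oppr_le0.
split; first by apply: bounded_op_comp => //; exact: mulop_bounded.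
have [D D0 DP] := Op0_decay KL.
pose M (n : int) := D * expR (- (`|n|%N)%:R).
have sM : summ (fun n => M n ^+ 2).
  have sx := @summ_exp R 2 (ltr0Sn _ _).
  have -> : (fun n => M n ^+ 2) = fun n : int => D ^+ 2 * expR (- 2 * (`|n|%N)%:R).
    by apply/funext => n; rewrite /M exprMn -expRM_natr; congr (_ * expR _); lra.
  by have [] := summZ (sqr_ge0 D) (fun n : int => expR_ge0 (- 2 * (`|n|%N)%:R)) sx.
have cc := compact_cube sM.
have sub : ((a \o (mulop f : HS -> HS)) @` [set x | `|x| <= 1]) `<=` cube M.
  move=> _ [x /= x1 <-] n; rewrite aE.
  have xd : decay 1 1 (mulop f x : V).
    move=> m; rewrite mulop_bE// cabsM mul1r mulN1r -[leRHS]mulr1.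
    apply: ler_pM; rewrite ?cabs_ge0//.
    apply: le_trans (l2n_ge_term m (l2vP x)) _.
    by move: x1; rewrite ell2_normE -lecR.
  by have := DP 1 _ ler01 xd n; rewrite mulr1 mulN1r.
apply: (subclosed_compact (@closed_closure _ _) cc).
apply: subset_trans (closure_subset sub) _.
have cl : closed (cube M) by apply: compact_closed cc; exact: norm_hausdorff.
by rewrite -(closure_id _).1.
Qed.

End Schatten.

(** * The algebra of band operators *)

Section Model.
Context {R : realType}.
Local Notation V := (@ell2 R int).
Local Notation HS := (@ell2_hilbert R int).
Local Notation sq := (int -> R[i]).
Implicit Types (L M : sq -> sq) (a b : HS -> HS).

(* A band operator on sequences is determined by its matrix entries, hence by its
   restriction to l2. *)
Lemma Op_expand K L : Op K L -> forall n, exists s : seq int, forall t : seq int,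
  uniq t -> {subset s <= t} ->
  forall x, L x n = \sum_(m <- t) x m * L (fun j => (j == m)%:R) n.
Proof.
elim=> [f d Kf|{}L M _ KL _ KM] n.
  exists [:: n + d] => t ut st x.
  have nt : n + d \in t by apply: st; rewrite inE.
  rewrite (bigD1_seq _ nt ut)/= eqxx mulr1 big1 ?addr0; first exact: mulrC.
  by move=> m mn; rewrite eq_sym (negbTE mn) !mulr0.
have [s sP] := KL n; have [s' sP'] := KM n.
exists (s ++ s') => t ut st x.
rewrite (sP t ut) ?(sP' t ut) -?big_split/=.
- by apply: eq_bigr => m _; rewrite mulrDr.
- by move=> m ms; apply: st; rewrite mem_cat ms orbT.
- by move=> m ms; apply: st; rewrite mem_cat ms.
Qed.

Lemma Op_eq_delta K K' L M : Op K L -> Op K' M ->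
  (forall m n, L (fun j => (j == m)%:R) n = M (fun j => (j == m)%:R) n) ->
  forall x n, L x n = M x n.
Proof.
move=> KL KM LM x n; have [s sP] := Op_expand KL n; have [s' sP'] := Op_expand KM n.
pose t := undup (s ++ s').
have st : {subset s <= t} by move=> m ms; rewrite mem_undup mem_cat ms.
have st' : {subset s' <= t} by move=> m ms; rewrite mem_undup mem_cat ms orbT.
rewrite (sP t (undup_uniq _) st) (sP' t (undup_uniq _) st').
by apply: eq_bigr => m _; rewrite LM.
Qed.

(* The operator on l2 induced by L, with junk value 0 where L x is not in l2. *)
Definition seqop L (x : HS) : HS :=
  if pselect (l2 (L (x : V))) is left l then mkl2 l else 0.

Lemma seqopE L (x : V) n : l2 (L x) -> (seqop L x : V) n = L x n.
Proof. by move=> lx; rewrite /seqop; case: pselect. Qed.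

Definition represents L a := Op [set 0] L /\ forall (x : V) n, (a x : V) n = L x n.

Lemma represents_l2 L a (x : V) : represents L a -> l2 (L x).
Proof. by case=> KL _; have [M _ LM] := Op_l2 KL; have [] := LM x (l2vP x). Qed.

Lemma seqop_rep L : Op [set 0] L -> represents L (seqop L).
Proof.
move=> KL; split => // x n; have [M _ LM] := Op_l2 KL.
by rewrite seqopE//; have [] := LM x (l2vP x).
Qed.

Lemma represents_ext L M a : represents L a -> (forall x n, L x n = M x n) -> represents M a.
Proof. by move=> [KL aE] LM; split; [exact: Op_ext KL LM|move=> x n; rewrite aE]. Qed.

Lemma represents_uniq L a b : represents L a -> represents L b -> a = b.
Proof. by move=> [_ aE] [_ bE]; apply/funext => x; apply: ell2_ext => n; rewrite aE bE. Qed.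

(** Matrix entries determine a band operator, so the agreement extends beyond l2. Injectivity of
    [sAlg] uses it at sequences of the form e^{|n|} x. *)
Lemma represents_inj L M a : represents L a -> represents M a -> forall x n, L x n = M x n.
Proof.
move=> [KL aE] [KM aE']; apply: (Op_eq_delta KL KM) => m n.
by rewrite -(aE (delta m)) -(aE' (delta m)).
Qed.

Lemma represents_bounded L a : represents L a -> bounded_op a.
Proof.
move=> [KL aE]; split.
  move=> c x y; apply: ell2_ext => n.
  by rewrite ell2DE ell2ZE !aE -(Op_linear KL).
have [M _ LM] := Op_l2 KL; exists M => x.
rewrite !ell2_normE -rmorphM/= lecR; have [_] := LM x (l2vP x).
by congr (l2n _ <= _); apply/funext => n; rewrite aE.
Qed.

Lemma K0D (k l : int) : [set (0 : int)] k -> [set (0 : int)] l -> [set (0 : int)] (k + l).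
Proof. by move=> /= -> ->. Qed.

Definition Alg : set (HS -> HS) := [set a | exists L, represents L a].

Lemma rep_comp L M a b : represents L a -> represents M b ->
  represents (fun x => L (M x)) (a \o b).
Proof.
move=> [KL aE] [KM bE]; split; first exact: (Op_comp K0D KL KM).
by move=> x n; rewrite /= aE; congr (L _ n); apply/funext => m; rewrite bE.
Qed.

Lemma rep_lin L M a b (c : R[i]) : represents L a -> represents M b ->
  represents (fun x n => c * L x n + M x n) (fun x => c *: a x + b x).
Proof.
move=> [KL aE] [KM bE]; split; first exact: Op_add (Op_scale c KL) KM.
by move=> x n; rewrite ell2DE ell2ZE aE bE.
Qed.

Lemma Op_id : Op [set 0] (fun x : sq => x).
Proof.
apply: Op_ext (Op_mul (EP_const 1 (erefl : [set 0] (0 : int)))) _ => x n.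
by rewrite mul1r.
Qed.

Lemma rep_id : represents (fun x => x) id.
Proof. by split; first exact: Op_id. Qed.

Lemma rep_zero : represents (fun _ _ => 0) (fun=> 0).
Proof. by split; first exact: Op_zero. Qed.

(** The relation between matrix entries is recorded because, unlike the adjoint relation, it is
    easily followed through a twist in [sAlg_adj]. *)
Lemma rep_adj L a : represents L a -> exists M b, [/\ represents M b, is_adjoint a b &
  forall m n, L (fun j => (j == m)%:R) n = conjc (M (fun j => (j == n)%:R) m)].
Proof.
move=> [KL aE]; have [M KM LM] := Op_adj KL.
have rM := seqop_rep KM; exists M, (seqop M).
have adj : is_adjoint a (seqop M).
  move=> x y; rewrite !ip_ell2 -[RHS]/(csum _).
  transitivity (csum (fun n => L (x : V) n * conjc ((y : V) n))).
    by congr csum; apply/funext => n; rewrite aE.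
  rewrite LM; [|exact: l2vP|exact: l2vP].
  by congr csum; apply/funext => n; rewrite rM.2.
split => // m n.
have := adj (delta m : V) (delta n : V); rewrite ip_delta aE => ->.
by rewrite ip_conj ip_delta rM.2.
Qed.

Lemma adjoint_uniq a b b' : is_adjoint a b -> is_adjoint a b' -> b = b'.
Proof.
move=> ab ab'; apply/funext => y; apply: ell2_ext => n.
by rewrite -!ip_delta ip_conj -(ab (delta n : V)) (ab' (delta n : V)) [RHS]ip_conj.
Qed.

Lemma star_Alg : star_algebra Alg.
Proof.
split.
- by move=> a [L La]; exact: represents_bounded La.
- by exists (fun _ _ => 0); exact: rep_zero.
- by move=> c a b [L La] [M Mb]; exists (fun x n => c * L x n + M x n); exact: rep_lin.
- by move=> a b [L La] [M Mb]; exists (fun x => L (M x)); exact: rep_comp.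
- move=> a [L La]; have [M [b [Mb ab _]]] := rep_adj La.
  by exists b => //; exists M.
Qed.

Definition wC (k n : int) : R[i] := (ew k n)%:C%C.

Lemma wCD k l n : wC (k + l) n = wC k n * wC l n.
Proof. by rewrite /wC ewD rmorphM. Qed.
Lemma wC0 n : wC 0 n = 1. Proof. by rewrite /wC ew0. Qed.
Lemma wCN k n : wC (- k) n * wC k n = 1. Proof. by rewrite -wCD addNr wC0. Qed.
Lemma wCNr k n : wC k n * wC (- k) n = 1. Proof. by rewrite mulrC wCN. Qed.
Lemma wC_neq0 k n : wC k n != 0.
Proof. by apply/eqP => w0; have := wCN k n; rewrite w0 mulr0 => /eqP; rewrite eq_sym oner_eq0. Qed.

Definition twist (k : int) L : sq -> sq := fun x n => wC k n * L (fun m => wC (- k) m * x m) n.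

Lemma Op_tw k L : Op [set 0] L -> Op [set 0] (twist k L).
Proof. exact: Op_twist. Qed.

Lemma twistK k L x n : twist k (twist (- k) L) x n = L x n.
Proof.
rewrite /twist mulrA wCNr mul1r; congr (L _ n); apply/funext => m.
by rewrite mulrA wCN mul1r.
Qed.

Lemma bounded_wN : bounded_fun (wC (-1) : sq).
Proof.
exists 1 => // n; rewrite cabs_real ger0_norm ?ew_ge0// /ew -[leRHS]expR0 ler_expR.
by rewrite mulN1r oppr_le0.
Qed.

(** For [a] in [Alg] the unbounded outer factor never meets the junk value of [mulop]: by [sAlg_rep]
    the result is the bounded operator of the twisted band map. *)
Definition sAlg a : HS -> HS := mulop (wC 1) \o a \o mulop (wC (-1)).

Lemma sAlg_rep L a : represents L a -> represents (twist 1 L) (sAlg a).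
Proof.
move=> La; have KT := Op_tw 1 La.1; split => // x n.
have E m : (a (mulop (wC (-1)) (x : HS)) : V) m = L (fun j => wC (-1) j * x j) m.
  by rewrite La.2; congr (L _ m); apply/funext => j; rewrite mulop_bE//; exact: bounded_wN.
rewrite /sAlg /= mulopE; first by rewrite E.
have := represents_l2 x (seqop_rep KT); congr l2.
by apply/funext => m; rewrite E.
Qed.

Lemma sAlg_bij : set_bij Alg Alg sAlg.
Proof.
split.
- by move=> a [L La]; exists (twist 1 L); exact: sAlg_rep.
- move=> a b /set_mem[L La] /set_mem[M Mb] ab.
  have rb : represents (twist 1 M) (sAlg a) by rewrite ab; exact: sAlg_rep.
  have E := represents_inj (sAlg_rep La) rb.
  apply: (represents_uniq La); apply: (represents_ext Mb) => x n.
  have := E (fun m => wC 1 m * x m) n; rewrite /twist => /(mulfI (wC_neq0 1 n)).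
  have -> : (fun m => wC (-1) m * (wC 1 m * x m)) = x.
    by apply/funext => m; rewrite mulrA wCN mul1r.
  by [].
- move=> b [M Mb]; exists (seqop (twist (-1) M)).
    by exists (twist (-1) M); apply: seqop_rep; apply: Op_tw; exact: Mb.1.
  apply: (represents_uniq _ Mb).
  have := sAlg_rep (seqop_rep (Op_tw (-1) Mb.1)).
  by move=> /represents_ext; apply => x n; exact: (twistK 1).
Qed.

Lemma s_inv_rep M b : represents M b -> represents (twist (-1) M) (s_inv Alg sAlg b).
Proof.
move=> Mb; pose a := seqop (twist (-1) M).
have Ra : represents (twist (-1) M) a := seqop_rep (Op_tw (-1) Mb.1).
have sab : sAlg a = b.
  apply: (represents_uniq _ Mb); apply: (represents_ext (sAlg_rep Ra)) => x n.
  exact: (twistK 1).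
have Aa : Alg a by exists (twist (-1) M).
rewrite /s_inv -sab (_ : 'pinv_(fun=> id) Alg sAlg (sAlg a) = a)//.
apply: pinvKV; [by case: sAlg_bij|exact/mem_set].
Qed.

Lemma sAlg_aut : algebra_automorphism Alg sAlg.
Proof.
split; first split; first exact: sAlg_bij.
- move=> c a b [L La] [M Mb].
  apply: (represents_uniq (sAlg_rep (rep_lin c La Mb))).
  apply: represents_ext (rep_lin c (sAlg_rep La) (sAlg_rep Mb)) _ => x n.
  by rewrite /twist; ring.
- move=> a b [L La] [M Mb].
  apply: (represents_uniq (sAlg_rep (rep_comp La Mb))).
  apply: represents_ext (rep_comp (sAlg_rep La) (sAlg_rep Mb)) _ => x n.
  rewrite /twist; congr (_ * L _ n); apply/funext => m.
  by rewrite mulrA wCN mul1r.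
Qed.

(** Twisting multiplies the matrix entry at (n, m) by the real number e^{|n| - |m|}. Exchanging n
    and m inverts this factor, so conjugate transposition turns the twist into its inverse. *)
Lemma sAlg_adj a b : Alg a -> is_adjoint a b -> is_adjoint (sAlg a) (s_inv Alg sAlg b).
Proof.
move=> [L La] ab; have [M [b' [Mb ab' LM]]] := rep_adj La.
have {b' ab' Mb}Mb : represents M b by rewrite (adjoint_uniq ab ab').
have [N [c [Nc sac NM]]] := rep_adj (sAlg_rep La).
suff -> : s_inv Alg sAlg b = c by [].
apply: (represents_uniq (s_inv_rep Mb)); apply: (represents_ext Nc).
apply: (Op_eq_delta Nc.1 (Op_tw (-1) Mb.1)) => m n.
apply: (can_inj (@conjcK R)); rewrite -NM /twist.
rewrite (Op_delta La.1) (Op_delta Mb.1) LM !conjCM !conjCR opprK; ring.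
Qed.

End Model.

(** * The twisted spectral triple *)

Section Triple.
Context {R : realType}.
Local Notation V := (@ell2 R int).
Local Notation HS := (@ell2_hilbert R int).
Local Notation sq := (int -> R[i]).
Local Notation AA := (@Alg R).
Local Notation ss := (@sAlg R).

Definition sgR (n : int) : R := if 0 <= n then 1 else -1.
Definition dT (n : int) : R := sgR n * ew 1 n.

Lemma sgnCE n : sgnC n = (sgR n)%:C%C :> R[i].
Proof. by rewrite /sgnC /sgR; case: ifP => _ //; rewrite rmorphN1. Qed.

Lemma cabs_sgnC n : cabs (sgnC n : R[i]) = 1.
Proof. by rewrite /sgnC; case: ifP; rewrite ?cabsN cabs1. Qed.

Lemma dTE n : (dT n)%:C%C = sgnC n * wC 1 n :> R[i].
Proof. by rewrite sgnCE -rmorphM. Qed.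

Lemma abs_dT n : `|dT n| = ew 1 n.
Proof.
rewrite normrM (ger0_norm (ew_ge0 _ _)) /sgR.
by case: ifP; rewrite ?normrN normr1 mul1r.
Qed.

Lemma bounded_sgnC : bounded_fun (sgnC : sq).
Proof. by exists 1 => // n; rewrite cabs_sgnC. Qed.

Definition Fop : HS -> HS := mulop sgnC.
Definition Dop : operator HS := Diag (fun n => (n%:~R : R)%:C%C).
Definition absDop : operator HS := Diag (fun n => (`|n%:~R : R|)%:C%C).
Definition absT : operator HS := Diag (wC 1).
Definition DDop : operator HS := op_comp (graph Fop) absT.

Lemma FopE (x : V) n : (Fop x : V) n = sgnC n * x n.
Proof. by rewrite mulop_bE//; exact: bounded_sgnC. Qed.

Lemma DDE : DDop = Diag (fun n => (dT n)%:C%C).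
Proof.
apply/seteqP; split => -[x z]; rewrite /DDop /op_comp /graph /absT /Diag /=.
  by move=> [y Hy ->] n; rewrite FopE Hy dTE mulrA.
move=> Hz; exists (Fop z).
  by move=> n; rewrite FopE Hz dTE !mulrA sgnCM mul1r.
by apply: ell2_ext => n; rewrite !FopE mulrA sgnCM mul1r.
Qed.

Lemma measurable_RtoC (f : R -> R) : measurable_fun setT f -> is_measurable (fun t => (f t)%:C%C).
Proof. by split => //=; exact: measurable_cst. Qed.

Lemma abs_D : is_abs Dop absDop.
Proof.
apply: (@fcalc_diag R _ _ nu_bij (fun n => n%:~R) (fun t => (`|t|)%:C%C)).
by apply: measurable_RtoC; exact: normr_measurable.
Qed.

Lemma exp_absD : is_exp absDop absT.
Proof.
have := @fcalc_diag R _ _ nu_bij (fun n : int => `|n%:~R : R|) (fun t => (expR t)%:C%C)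
  (measurable_RtoC (@measurable_expR R)).
suff -> : (fun n : int => (expR `|n%:~R : R|)%:C%C) = wC 1 by [].
apply/funext => n; rewrite /wC /ew mulr1z mul1r; congr (expR _)%:C%C.
by rewrite natr_absz intr_norm.
Qed.

Lemma abs_DD : is_abs DDop absT.
Proof.
rewrite DDE; have := @fcalc_diag R _ _ nu_bij dT (fun t => (`|t|)%:C%C).
have -> : (fun n => (`|dT n|)%:C%C) = wC 1 by apply/funext => n; rewrite abs_dT.
by apply; apply: measurable_RtoC; exact: normr_measurable.
Qed.

Lemma phase_D : is_phase Dop absDop Fop.
Proof.
split.
- exact/mulop_bounded/bounded_sgnC.
- have := is_adjoint_mulop bounded_sgnC; congr is_adjoint; congr mulop.
  by apply/funext => n; rewrite sgnCE conjCR.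
- by apply/funext => x; apply: ell2_ext => n; rewrite /= !FopE mulrA sgnCM mul1r.
- have E n : (n%:~R : R)%:C%C = sgnC n * (`|n%:~R : R|)%:C%C :> R[i].
    rewrite sgnCE -rmorphM/=; congr (_%:C)%C; rewrite /sgR; case: ifP => n0.
      by rewrite mul1r ger0_norm// ler0z.
    by rewrite mulN1r ltr0_norm ?opprK// ltrz0 ltNge n0.
  apply/seteqP; split => -[x z]; rewrite /Dop /op_comp /graph /absDop /Diag /=.
    move=> Hz; exists (Fop z).
      by move=> n; rewrite FopE Hz E !mulrA sgnCM mul1r.
    by apply: ell2_ext => n; rewrite !FopE mulrA sgnCM mul1r.
  by move=> [y Hy ->] n; rewrite FopE Hy E mulrA.
Qed.

(** The inverse of e^{|D|} is everywhere defined and [a] sends its range into the domain of e^{|D|},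
    so the composition on the right has full domain. *)
Lemma sAlg_graph a : AA a -> graph (ss a) = op_comp absT (op_comp (graph a) (op_inv absT)).
Proof.
move=> [L La]; have Ra := sAlg_rep La.
apply/seteqP; split => -[x z]; rewrite /op_comp /graph /op_inv /absT /Diag /=.
  move=> ->; exists (a (mulop (wC (-1)) x)).
    exists (mulop (wC (-1)) x) => // n.
    by rewrite mulop_bE ?mulrA ?wCNr ?mul1r//; exact: bounded_wN.
  move=> n; rewrite Ra.2 La.2 /twist; congr (_ * L _ n); apply/funext => m.
  by rewrite mulop_bE//; exact: bounded_wN.
move=> [y [u Hu ->] Hz]; apply: ell2_ext => n; rewrite Hz Ra.2 La.2 /twist.
congr (_ * L _ n); apply/funext => m.
by rewrite Hu mulrA wCN mul1r.
Qed.

Lemma l2_sgnC (x : sq) : l2 (fun n => sgnC n * x n) <-> l2 x.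
Proof.
rewrite /l2; suff -> : (fun n => sqn (sgnC n * x n)) = fun n => sqn (x n) by [].
by apply/funext => n; rewrite sqnM sqnE cabs_sgnC expr1n mul1r.
Qed.

Lemma dom_absT (x : V) : dom absT x <-> l2 (fun n => wC 1 n * x n).
Proof. exact: dom_Diag. Qed.

Lemma dom_DD (x : V) : dom DDop x <-> l2 (fun n => wC 1 n * x n).
Proof.
rewrite DDE dom_Diag -(l2_sgnC (fun n => wC 1 n * x n)).
have -> : (fun i => (dT i)%:C%C * x i) = fun n => sgnC n * (wC 1 n * x n) :> R[i].
  by apply/funext => n; rewrite dTE mulrA.
by [].
Qed.

Lemma twist_wC (L : sq -> sq) (x : sq) n : wC 1 n * L x n = twist 1 L (fun m => wC 1 m * x m) n.
Proof.
rewrite /twist; congr (_ * L _ n); apply/funext => m.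
by rewrite mulrA wCN mul1r.
Qed.

(** The weight e^{|n|} passes through [a] at the price of a twist ([twist_wC]), and the twisted
    operator is still bounded. *)
Lemma dom_Alg a (x : V) : AA a -> l2 (fun n => wC 1 n * x n) ->
  l2 (fun n => wC 1 n * (a x : V) n).
Proof.
move=> [L La] lx; have := represents_l2 (mkl2 lx) (sAlg_rep La); congr l2.
by apply/funext => n; rewrite La.2 twist_wC.
Qed.

(* The twisted commutator DD a - s(a) DD, in the form e^{|D|} (F a - a F). *)
Definition commL (L : sq -> sq) : sq -> sq := fun x n =>
  wC 1 n * (sgnC n * L x n - L (fun m => sgnC m * x m) n).

(** The commutator with the sign is a finite matrix, and the ideal of such matrices absorbs the
    unbounded weight e^{|n|}. *)
Lemma Op_commL L : Op [set 0] L -> Op set0 (commL L).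
Proof.
move=> KL; apply: (@Op_ideall _ setT (fun x n => wC 1 n * x n)).
  by apply: Op_mul; exact: EP_ew.
exact: Op_sgnC_comm KL.
Qed.

(** The factor e^{-|D|} inside s(a) commutes with F and cancels the e^{|D|} of DD, so s(a) DD
    becomes e^{|D|} a F. The domain is that of DD because [a] preserves it. *)
Lemma twisted_commE a L (x z : V) : represents L a ->
  twisted_comm DDop ss a (x, z) <->
  l2 (fun n => wC 1 n * x n) /\ forall n, z n = commL L x n.
Proof.
move=> La; have Ra := sAlg_rep La.
have key (y u v : V) n : y n = (dT n)%:C%C * (a x : V) n -> (forall m, u m = (dT m)%:C%C * x m) ->
    v = ss a u -> y n - v n = commL L x n.
  move=> yE uE ->; rewrite yE Ra.2 La.2 /commL /twist dTE mulrBr mulrA [wC 1 n * sgnC n]mulrC.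
  congr (_ - _ * L _ n); apply/funext => m.
  by rewrite uE dTE mulrA [sgnC m * _]mulrC mulrA wCN mul1r.
rewrite /twisted_comm DDE /op_sub /op_comp /graph /=; split.
  move=> [y [v [[u ->] yE [w wE ->] ->]]]; split.
    apply/dom_DD; rewrite DDE; by exists w.
  by move=> n; rewrite ell2DE ell2NE (key y w _ n (yE n) wE).
move=> [lx zE].
have Aa : AA a by exists L.
have [y yE] : dom DDop (a x) by apply/dom_DD; exact: dom_Alg.
have [u uE] : dom DDop x by apply/dom_DD.
rewrite DDE in yE uE.
exists y, (ss a u); split.
- by exists (a x).
- by exists u.
- by apply: ell2_ext => n; rewrite ell2DE ell2NE zE (key y u _ n (yE n) uE).
Qed.

Lemma Op0_sub K (L : sq -> sq) : Op set0 L -> Op K L.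
Proof. by apply: Op_sub. Qed.

Lemma comm_rep a L : represents L a -> represents (commL L) (seqop (commL L)).
Proof. by move=> La; apply: seqop_rep; apply: Op0_sub; apply: Op_commL; case: La. Qed.

Lemma comm_bounded a L : represents L a ->
  twisted_comm DDop ss a `<=` graph (seqop (commL L)).
Proof.
move=> La [x z] /(twisted_commE _ _ La)[_ zE]; rewrite /graph /=.
by apply: ell2_ext => n; rewrite zE (comm_rep La).2.
Qed.

(** Bounded maps are continuous and finitely supported vectors are dense. This identifies an
    arbitrary bounded extension of a twisted commutator with the explicit one. *)
Lemma bounded_eq (a b : HS -> HS) : bounded_op a -> bounded_op b ->
  (forall (s : seq int) (x : V), (forall i, i \notin s -> x i = 0) -> a x = b x) -> a = b.
Proof.
move=> [la [M aM]] [lb [N bN]] ab; apply/funext => x.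
have aB (f : HS -> HS) : linear f -> forall u v, f (u - v) = f u - f v.
  by move=> lf u v; have := lf (-1) v u; rewrite !scaleN1r ![- _ + _]addrC.
apply/eqP; rewrite -subr_eq0 -normr_eq0 eq_le normr_ge0 andbT.
rewrite ell2_normE lecR; apply/ler_addgt0Pr => e e0; rewrite add0r.
pose C := `|M| + `|N| + 1.
have C0 : 0 < C by rewrite ltr_wpDl// addr_ge0.
have e2 : 0 < (e / C) ^+ 2 by rewrite exprn_gt0// divr_gt0.
have [s us sP] := tsum_tail (fun i => sqn_ge0 ((x : V) i)) (l2vP (x : V)) e2.
have ly : l2 (fun i => if i \in s then (x : V) i else 0).
  by apply: (@l2_fin _ _ s) => i /negbTE ->.
pose y : V := mkl2 ly.
have xy : l2n (x - y : V) <= e / C.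
  rewrite -ler_sqr ?nnegrE ?l2n_ge0 ?divr_ge0 ?(ltW e0) ?(ltW C0)// -l2nsqE.
  apply: sP => [i|i si]; rewrite ell2DE ell2NE /=.
    rewrite sqn_ge0 /=; case: ifP => _; first by rewrite subrr sqn0 sqn_ge0.
    by rewrite subr0.
  by rewrite si subrr sqn0.
have -> : a x - b x = a (x - y) - b (x - y).
  have aby : a y = b y by apply: (ab s) => i /= /negbTE ->.
  by rewrite (aB a la) (aB b lb) aby opprB addrA subrK.
rewrite -lecR -[(l2n _)%:C%C]/(`|a (x - y) - b (x - y)|).
apply: le_trans (ler_normB _ _) _.
have ha := aM (x - y); have hb := bN (x - y).
apply: le_trans (lerD ha hb) _.
rewrite -mulrDl -rmorphD/= -[ `|x - y|]/((l2n (x - y : V))%:C%C) -rmorphM/= lecR.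
apply: le_trans (_ : C * (e / C) <= _); last by rewrite mulrCA mulfV ?mulr1// gt_eqF.
apply: le_trans (_ : (`|M| + `|N|) * l2n (x - y : V) <= _).
  by rewrite ler_wpM2r ?l2n_ge0// lerD// ler_norm.
apply: ler_pM; rewrite ?addr_ge0 ?l2n_ge0//.
by rewrite /C lerDl.
Qed.

Lemma twisted_comms_rep c : twisted_comms AA DDop ss c ->
  exists2 L, Op [set 0] L & represents (commL L) c.
Proof.
move=> [bc [a [L La] ac]]; exists L; first exact: La.1.
suff -> : c = seqop (commL L) by exact: comm_rep La.
apply: bounded_eq => //; first exact: represents_bounded (comm_rep La).
move=> s x xs; have lx : l2 (fun n => wC 1 n * x n).
  by apply: (@l2_fin _ _ s) => n /xs ->; rewrite mulr0.
have : twisted_comm DDop ss a (x, seqop (commL L) x).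
  by apply/(twisted_commE _ _ La); split => // n; rewrite (comm_rep La).2.
by move=> /ac.
Qed.

Lemma sqrt1_gt0 (t : R) : 0 < Num.sqrt (1 + t ^+ 2).
Proof. by rewrite sqrtr_gt0 ltr_wpDr ?sqr_ge0. Qed.

Lemma measurable_resolvent : measurable_fun setT (fun t : R => (Num.sqrt (1 + t ^+ 2))^-1).
Proof.
apply: continuous_measurable_fun => t.
apply: cvgV; first by rewrite gt_eqF ?sqrt1_gt0.
apply: (@continuous_comp _ _ _ (fun t : R => 1 + t ^+ 2) Num.sqrt).
  apply: continuousD; first exact: cst_continuous.
  exact: exprn_continuous.
exact: sqrt_continuous.
Qed.

(* The eigenvalues of (1 + DD^2)^{-1/2}. *)
Definition kappa (n : int) : R[i] := ((Num.sqrt (1 + dT n ^+ 2))^-1)%:C%C.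

Lemma ewN1 n : ew (-1) n = expR (- (`|n|%N)%:R) :> R.
Proof. by rewrite /ew mulN1r. Qed.

Lemma kappa_le n : cabs (kappa n) <= expR (- (`|n|%N)%:R).
Proof.
rewrite cabs_real ger0_norm ?invr_ge0 ?sqrtr_ge0// -ewN1.
rewrite ewV lef_pV2 ?posrE ?sqrt1_gt0 ?ew_gt0// -abs_dT -sqrtr_sqr.
by rewrite ler_sqrt ?addr_ge0 ?sqr_ge0// lerDr.
Qed.

Lemma triple : twisted_spectral_triple AA DDop ss.
Proof.
split.
- exact: star_Alg.
- exact: sAlg_aut.
- by move=> a b; exact: sAlg_adj.
- rewrite DDE; exact: self_adjoint_Diag.
- move=> a [L La]; split.
  + by move=> x /dom_DD lx; apply/dom_DD; apply: dom_Alg => //; exists L.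
  + exists (seqop (commL L)); last exact: comm_bounded.
    exact: represents_bounded (comm_rep La).
  + exists (mulop kappa); last exact: compact_band La.1 (represents_bounded La) La.2 kappa_le.
    rewrite graph_mulop.
      rewrite DDE; apply: (@fcalc_diag R _ _ nu_bij dT
        (fun t => ((Num.sqrt (1 + t ^+ 2))^-1)%:C%C)).
      exact: measurable_RtoC measurable_resolvent.
    exists 1 => // n; apply: le_trans (kappa_le n) _.
    by rewrite -[leRHS]expR0 ler_expR oppr_le0.
Qed.

Lemma unital_Alg : unital AA.
Proof. by exists (fun x => x); exact: rep_id. Qed.

Lemma regular_Alg : regular AA DDop ss.
Proof.
exists absT; split; first exact: abs_DD.
exists AA, ss; split=> //.
- exact: star_Alg.
- split => // c /twisted_comms_rep[L _ Lc]; by exists (commL L).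
- exact: (@sAlg_aut R).1.
- move=> b Ab; split; first by move=> x /dom_absT lx; apply/dom_absT; exact: dom_Alg.
  exists (fun=> 0); first by exists (fun _ _ => 0); exact: rep_zero.
  case: Ab => L Lb; have Rb := sAlg_rep Lb.
  move=> [x z]; rewrite /twisted_comm /op_sub /op_comp /graph /=.
  move=> [y [v [[u -> yE] [w wE ->] ->]]].
  apply: ell2_ext => n; rewrite ell2DE ell2NE yE Rb.2 Lb.2 twist_wC ell20E.
  rewrite (_ : (w : V) = (fun m => wC 1 m * (x : V) m) :> sq) ?subrr//.
  by apply/funext => m; exact: wE.
Qed.

(* The eigenvalues of (i + DD)^{-1}. *)
Definition beta (n : int) : R[i] := ('i%C + (dT n)%:C%C)^-1.

Lemma idT_neq0 n : 'i%C + (dT n)%:C%C != 0 :> R[i].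
Proof. by rewrite eq_complex /= addr0 oner_eq0 andbF. Qed.

Lemma beta_le n : cabs (beta n) <= expR (- (`|n|%N)%:R).
Proof.
rewrite cabsV -ewN1.
have le : ew 1 n <= cabs ('i%C + (dT n)%:C%C).
  apply: le_trans (absRe_le _); by rewrite /= add0r abs_dT.
by rewrite ewV lef_pV2 ?posrE ?ew_gt0// (lt_le_trans (ew_gt0 1 n)).
Qed.

Lemma summable_Alg : finitely_summable DDop.
Proof.
exists 1; split => //; exists (mulop beta); last exact: schatten_diag beta_le.
have bb : bounded_fun beta.
  exists 1 => // n; apply: le_trans (beta_le n) _.
  by rewrite -[leRHS]expR0 ler_expR oppr_le0.
rewrite graph_mulop// DDE.
apply/seteqP; split => -[x y]; rewrite /op_inv /op_add /graph /Diag /=.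
  move=> yE.
  (* Here y lies in the domain of DD because dT y = x - i y is square-summable. *)
  have lz : l2 (fun n => (dT n)%:C%C * (y : V) n).
    have := l2vP (x - 'i%C *: y : V); congr l2; apply/funext => n.
    rewrite ell2DE ell2NE ell2ZE yE /beta.
    have xE : (x : V) n = ('i%C + (dT n)%:C%C) * (('i%C + (dT n)%:C%C)^-1 * (x : V) n).
      by rewrite mulrA mulfV ?mul1r ?idT_neq0.
    by rewrite [X in X - _]xE mulrDl addrAC subrr add0r.
  exists ('i%C *: y), (mkl2 lz : V); split => //.
  apply: ell2_ext => n; rewrite ell2DE ell2ZE /= yE /beta -mulrDl mulrA mulfV ?mul1r//.
  exact: idT_neq0.
move=> [_ [z [-> zE ->]]] n; rewrite ell2DE ell2ZE zE -mulrDl mulrA mulVf ?mul1r//.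
exact: idT_neq0.
Qed.

End Triple.

(** * Operators on the smooth domain *)

Section Smooth.
Context {R : realType}.
Local Notation V := (@ell2 R int).
Local Notation HS := (@ell2_hilbert R int).
Local Notation sq := (int -> R[i]).
Local Notation AA := (@Alg R).
Local Notation ss := (@sAlg R).
Local Notation absT := (@absT R).
Local Notation DDop := (@DDop R).
Implicit Types (X Y : operator HS) (L M : sq -> sq).

(** By [smoothP] this describes the common domain of all powers of e^{|D|}; the decay is faster than
    every exponential, not merely faster than powers of n. *)
Definition rapid (x : sq) := forall c : R, 0 <= c -> exists2 B : R, 0 <= B & decay c B x.

(** A band operator lowers the rate by a fixed k, so the rate c + k at the source gives the rate c
    at the target. *)
Lemma rapid_Op K L x : Op K L -> rapid x -> rapid (L x).
Proof.
move=> KL rx c c0; have [k k0 kP] := Op_decay KL.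
have ck : 0 <= c + k by rewrite addr_ge0.
have [D D0 DP] := kP _ ck; have [B B0 xB] := rx _ ck.
exists (D * B); first exact: mulr_ge0.
by have := DP B x B0 xB; rewrite addrK.
Qed.

Lemma rapid_l2 x : rapid x -> l2 x.
Proof.
move=> rx; have [S _ SP] := @decay_l2 R 1 ltr01; have [B B0 xB] := rx 1 ler01.
by have [] := SP B x B0 xB.
Qed.

Lemma rapid_fin (s : seq int) (x : sq) : (forall i, i \notin s -> x i = 0) -> rapid x.
Proof.
move=> xs c c0.
pose B := \sum_(i <- s) cabs (x i) * expR (c * (`|i|%N)%:R).
have pos i : 0 <= cabs (x i) * expR (c * (`|i|%N)%:R) by rewrite mulr_ge0 ?cabs_ge0 ?expR_ge0.
have B0 : 0 <= B by apply: sumr_ge0.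
exists B => // n; have [ns|ns] := boolP (n \in s); last first.
  by rewrite xs// cabs0 mulr_ge0 ?expR_ge0.
rewrite mulNr expRN ler_pdivlMr ?expR_gt0// /B (big_rem n ns) /= lerDl.
exact: sumr_ge0.
Qed.

Lemma op_powE n (x y : V) : op_pow absT n (x, y) ->
  forall m, y m = wC n m * x m.
Proof.
elim: n y => [|n ih] y /=; first by rewrite /graph /= => -> m; rewrite wC0 mul1r.
move=> [z /= /ih zE yE] m.
by rewrite yE zE mulrA -wCD; congr (wC _ m * _); lia.
Qed.

Lemma rapid_wC k (x : sq) : rapid x -> rapid (fun n => wC k n * x n).
Proof.
by apply: (@rapid_Op setT (fun x n => wC k n * x n)); apply: Op_mul; exact: EP_ew.
Qed.

Lemma smoothP (x : V) : smooth_domain absT x <-> rapid x.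
Proof.
split=> [sx c c0|rx n].
  have [n cn] : exists n : nat, c <= n%:R.
    by exists (Num.bound c); apply/ltW/archi_boundP.
  have [y xy] := sx n; have yE := op_powE xy.
  exists (l2n y); first exact: l2n_ge0.
  move=> m; have := l2n_ge_term m (l2vP y); rewrite yE cabsM cabs_real ger0_norm ?ew_ge0//.
  move=> le; rewrite mulNr expRN ler_pdivlMr ?expR_gt0// mulrC.
  apply: le_trans le; rewrite ler_wpM2r ?cabs_ge0// /ew ler_expR ler_wpM2r//.
elim: n => [|n [y xy]]; first by exists x.
have yE := op_powE xy.
have lz : l2 (fun m => wC 1 m * y m).
  apply: rapid_l2; apply: rapid_wC.
  by rewrite (_ : l2v y = fun m => wC n m * x m); [exact: rapid_wC|apply/funext => m; exact: yE].
by exists (mkl2 lz : V); exists y.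
Qed.

Definition sm L : operator HS :=
  [set p : HS * HS | rapid (p.1 : V) /\ forall n, (p.2 : V) n = L (p.1 : V) n].

(** For [K = setT] this class contains [Psi]; for [K = set0] it consists of the finite matrices, in
    the role of smoothing operators. *)
Definition Sop K X := exists2 L, Op K L & X = sm L.

Lemma sm_ex K L (x : V) : Op K L -> rapid x ->
  exists y : V, rapid y /\ forall n, y n = L x n.
Proof. by move=> KL rx; exists (mkl2 (rapid_l2 (rapid_Op KL rx))); split => //; exact: rapid_Op KL rx. Qed.

Lemma sm_ext L M : (forall x n, L x n = M x n) -> sm L = sm M.
Proof. by move=> LM; congr sm; apply/funext => x; apply/funext => n. Qed.

Lemma Sop_add K X Y : Sop K X -> Sop K Y -> Sop K (op_add X Y).
Proof.
move=> [L KL ->] [M KM ->]; exists (fun x n => L x n + M x n); first exact: Op_add.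
apply/seteqP; split => -[x z]; rewrite /op_add /sm /=.
  move=> [y [u [[rx yE] [_ uE] ->]]]; split => // n.
  by rewrite ell2DE yE uE.
move=> [rx zE]; have [y [_ yE]] := sm_ex KL rx; have [u [_ uE]] := sm_ex KM rx.
exists y, u; split => //.
by apply: ell2_ext => n; rewrite ell2DE zE yE uE.
Qed.

Lemma Sop_scale K c X : Sop K X -> Sop K (op_scale c X).
Proof.
move=> [L KL ->]; exists (fun x n => c * L x n); first exact: Op_scale.
apply/seteqP; split => -[x z]; rewrite /op_scale /sm /=.
  by move=> [y [rx yE] ->]; split => // n; rewrite ell2ZE yE.
move=> [rx zE]; have [y [_ yE]] := sm_ex KL rx.
exists y => //; apply: ell2_ext => n; by rewrite ell2ZE zE yE.
Qed.

Lemma Sop_sub K X Y : Sop K X -> Sop K Y -> Sop K (op_sub X Y).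
Proof.
move=> KX [M KM ->]; have := Sop_add KX (Sop_scale (-1) (ex_intro2 _ _ M KM erefl)).
congr Sop; apply/seteqP; split => -[x z]; rewrite /op_sub /op_add /op_scale /=.
  by move=> [y [_ [Xy [u Mu ->] ->]]]; exists y, u; split => //; rewrite scaleN1r.
move=> [y [u [Xy Mu ->]]]; exists y, (- u); split => //.
by exists u => //; rewrite scaleN1r.
Qed.

Lemma sm_comp K K' L M : Op K L -> Op K' M -> op_comp (sm L) (sm M) = sm (fun x => L (M x)).
Proof.
move=> KL KM; apply/seteqP; split => -[x z]; rewrite /op_comp /=.
  move=> [y [/= rx yE] [/= ry zE]]; split => //= n.
  by rewrite zE (_ : l2v y = M x)//; exact/funext.
move=> [/= rx zE]; have [y [ry yE]] := sm_ex KM rx.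
by exists y; split => //= n; rewrite zE (_ : l2v y = M x)//; exact/funext.
Qed.

Lemma OpT_comp L M : Op setT L -> Op setT M -> Op setT (fun x => L (M x)).
Proof. by apply: Op_comp. Qed.

Lemma Sop_comp X Y : Sop setT X -> Sop setT Y -> Sop setT (op_comp X Y).
Proof.
move=> [L KL ->] [M KM ->]; exists (fun x => L (M x)); first exact: OpT_comp.
exact: sm_comp KL KM.
Qed.

Lemma Sop_ideall X Y : Sop setT X -> Sop set0 Y -> Sop set0 (op_comp X Y).
Proof.
move=> [L KL ->] [M KM ->]; exists (fun x => L (M x)); first exact: Op_ideall KL KM.
exact: sm_comp KL KM.
Qed.

Lemma Sop_idealr X Y : Sop set0 X -> Sop setT Y -> Sop set0 (op_comp X Y).
Proof.
move=> [L KL ->] [M KM ->]; exists (fun x => L (M x)); first exact: Op_idealr KL KM.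
exact: sm_comp KL KM.
Qed.

Lemma Sop0 X : Sop set0 X -> Sop setT X.
Proof. by move=> [L KL ->]; exists L => //; exact: Op0_sub. Qed.

Lemma Diag_sm g K L : EP setT g -> Op K L ->
  op_comp (Diag g) (sm L) = sm (fun x n => g n * L x n).
Proof.
move=> Kg KL; have KgO := Op_mul Kg.
apply/seteqP; split => -[x z]; rewrite /op_comp /=.
  by move=> [y [/= rx yE] zE]; split => //= n; rewrite zE yE.
move=> [/= rx zE]; have [y [ry yE]] := sm_ex KL rx.
by exists y; [split|move=> n /=; rewrite zE yE].
Qed.

(** The inverse multiplier [h] recovers x from g x within the rapid sequences, so the composition
    has exactly the smooth domain. *)
Lemma sm_Diag g h K L : EP setT g -> EP setT h -> (forall n, h n * g n = 1) -> Op K L ->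
  op_comp (sm L) (Diag g) = sm (fun x => L (fun n => g n * x n)).
Proof.
move=> Kg Kh hg KL.
apply/seteqP; split => -[x z]; rewrite /op_comp /=.
  move=> [y yE [/= ry zE]]; split => /= [|n].
    have -> : l2v x = fun n => h n * y n.
      by apply/funext => n; rewrite yE mulrA hg mul1r.
    exact: (rapid_Op (Op_mul Kh) ry).
  by rewrite zE (_ : l2v y = fun n => g n * x n)//; exact/funext.
move=> [/= rx zE]; have [y [ry yE]] := sm_ex (Op_mul Kg) rx.
by exists y => //; split => //= n; rewrite zE (_ : l2v y = fun n => g n * x n)//; exact/funext.
Qed.

Lemma EP_wC k : EP setT (wC k : sq). Proof. exact: EP_ew. Qed.

Lemma op_inv_absT : op_inv absT = Diag (wC (-1)).
Proof.
apply/seteqP; split => -[x y]; rewrite /op_inv /absT /Diag /= => H n.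
  by rewrite H mulrA wCN mul1r.
by rewrite H mulrA wCNr mul1r.
Qed.

Lemma EPT_mul (f g : sq) : EP setT f -> EP setT g -> EP setT (fun n => f n * g n) :> Prop.
Proof. exact: EP_mul. Qed.

Lemma on_smoothE Z L : (forall x y, rapid (x : V) -> Z (x, y) <-> forall n, (y : V) n = L (x : V) n) ->
  op_restr (smooth_domain absT) Z = sm L.
Proof.
move=> H; apply/seteqP; split => -[x y]; rewrite /op_restr /sm /=.
  by move=> [/smoothP rx Zxy]; split => //; apply/H.
by move=> [rx yE]; split; [exact/smoothP|apply/H].
Qed.

Lemma Sop_phase : Sop setT (PsiF DDop absT).
Proof.
exists (fun x n => sgnC n * x n); first by apply: Op_mul; exact: EP_sgnC.
apply: on_smoothE => x y rx; rewrite DDE op_inv_absT /op_comp /Diag /=; split.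
  by move=> [u uE yE] n; rewrite yE uE dTE -mulrA [wC 1 n * _]mulrA wCNr mul1r.
move=> yE; exists (mkl2 (rapid_l2 (rapid_wC (-1) rx)) : V) => // n.
by rewrite yE /= dTE -mulrA [wC 1 n * _]mulrA wCNr mul1r.
Qed.

Lemma Sop_rep L a : represents L a -> op_restr (smooth_domain absT) (graph a) = sm L.
Proof.
move=> [KL aE]; apply: on_smoothE => x y rx; rewrite /graph /=.
by split=> [-> n|yE]; [exact: aE|apply: ell2_ext => n; rewrite yE aE].
Qed.

Lemma OpK_setT K L : Op K L -> Op setT L.
Proof. exact: Op_sub. Qed.

Lemma sm_id_restr X : op_comp X (graph id) = X.
Proof.
apply/seteqP; split => -[x y]; rewrite /op_comp /graph /=; first by move=> [z ->].
by move=> Xxy; exists x.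
Qed.

Lemma op_compA X Y Z : op_comp X (op_comp Y Z) = op_comp (op_comp X Y) Z.
Proof.
apply/seteqP; split => -[x y]; rewrite /op_comp /=.
  by move=> [u [v Zv Yv] Xu]; exists v => //; exists u.
by move=> [v Zv [u Yu Xu]]; exists u => //; exists v.
Qed.

Lemma restr_comp (W : set HS) X Y : op_restr W (op_comp X Y) = op_comp X (op_restr W Y).
Proof.
apply/seteqP; split => -[x y]; rewrite /op_comp /op_restr /=.
  by move=> [Wx [z Yz Xz]]; exists z.
by move=> [z [Wx Yz] Xz]; split => //; exists z.
Qed.

Lemma sm_id : op_restr (smooth_domain absT) (graph id) = sm (fun x => x).
Proof. exact: Sop_rep rep_id. Qed.

Lemma on_smooth_pow (e : int) n : op_restr (smooth_domain absT) (op_pow (Diag (wC e)) n) =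
  sm (fun x m => wC (e * n%:Z) m * x m).
Proof.
elim: n => [|n ih].
  by rewrite sm_id; apply: sm_ext => x m; rewrite mulr0 wC0 mul1r.
rewrite [op_pow _ _]/(op_comp (Diag (wC e)) (op_pow (Diag (wC e)) n)) restr_comp ih.
rewrite (Diag_sm (EP_wC e) (Op_mul (EP_wC (e * n%:Z)))).
by apply: sm_ext => x m; rewrite mulrA -wCD; congr (wC _ m * _); lia.
Qed.

Lemma on_smooth_zpow k : op_restr (smooth_domain absT) (op_zpow absT k) =
  sm (fun x m => wC k m * x m).
Proof.
case: k => n; first by rewrite (on_smooth_pow 1); apply: sm_ext => x m; rewrite mul1r.
have -> : op_zpow absT (Negz n) = op_pow (Diag (wC (-1))) n.+1 by rewrite -op_inv_absT.
rewrite on_smooth_pow.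
by apply: sm_ext => x m; rewrite NegzE mulN1r.
Qed.

Lemma Sop_zpow k : Sop setT (op_restr (smooth_domain absT) (op_zpow absT k)).
Proof.
rewrite on_smooth_zpow; exists (fun x m => wC k m * x m) => //.
exact: Op_mul (EP_wC k).
Qed.

Lemma Psi_Sop X : Psi AA DDop ss absT X -> Sop setT X.
Proof.
elim=> [|a [L La]|c /twisted_comms_rep[L KL Lc]|k|{}X Y _ SX _ SY|c {}X _ SX|{}X Y _ SX _ SY].
- exact: Sop_phase.
- by exists L; [exact: OpK_setT La.1|exact: Sop_rep].
- by exists (commL L); [exact: OpK_setT Lc.1|exact: Sop_rep].
- exact: Sop_zpow.
- exact: Sop_add.
- exact: Sop_scale.
- exact: Sop_comp.
Qed.

Lemma Sop_comm L a : represents L a ->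
  Sop set0 (op_restr (smooth_domain absT) (twisted_comm DDop ss a)).
Proof.
move=> La; exists (commL L); first exact: Op_commL La.1.
apply: on_smoothE => x y rx; split; first by move=> /(twisted_commE _ _ La)[].
move=> yE; apply/(twisted_commE _ _ La); split => //.
exact: rapid_l2 (rapid_wC 1 rx).
Qed.

Lemma Psi_sigma_Sop X : Sop set0 X -> Sop set0 (Psi_sigma absT X).
Proof.
move=> [L KL ->]; rewrite /Psi_sigma op_inv_absT.
rewrite (sm_Diag (EP_wC (-1)) (EP_wC 1) (wCNr 1) KL).
have KL' : Op set0 (fun x => L (fun n => wC (-1) n * x n)).
  exact: Op_idealr KL (Op_mul (EP_wC (-1))).
exists (fun x n => wC 1 n * L (fun n => wC (-1) n * x n) n).
  exact: Op_ideall (Op_mul (EP_wC 1)) KL'.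
by rewrite (Diag_sm (EP_wC 1) KL').
Qed.

Definition dC (n : int) : R[i] := (dT n)%:C%C.

Lemma EP_dC : EP setT dC.
Proof.
apply: EP_ext (EPT_mul (EP_sgnC (I : setT (0 : int))) (EP_wC 1)) _ => n.
by rewrite /dC dTE.
Qed.

Lemma EP_dCV : EP setT (fun n => sgnC n * wC (-1) n : R[i]).
Proof. exact: EPT_mul (EP_sgnC (I : setT (0 : int))) (EP_wC (-1)). Qed.

Lemma dCV n : sgnC n * wC (-1) n * dC n = 1.
Proof. by rewrite /dC dTE mulrACA sgnCM mul1r wCN. Qed.

(** The square of DD is unbounded, but it multiplies a finite matrix from one side or the other, so
    all iterated differences remain finite matrices. *)
Lemma Psi_diff_Sop X : Sop set0 X -> Sop set0 (Psi_diff DDop absT X).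
Proof.
move=> SX; rewrite /Psi_diff.
have -> : op_pow DDop 2 = op_comp DDop DDop.
  by rewrite /op_pow /= sm_id_restr.
apply: Sop_sub.
  rewrite -op_compA; case: SX => L KL ->; rewrite DDE.
  have K1 := Op_ideall (Op_mul EP_dC) KL.
  rewrite (Diag_sm EP_dC KL) (Diag_sm EP_dC K1).
  by exists (fun x n => dC n * (dC n * L x n)) => //; exact: Op_ideall (Op_mul EP_dC) K1.
have [L KL ->] := Psi_sigma_Sop (Psi_sigma_Sop SX).
rewrite op_compA DDE (sm_Diag EP_dC EP_dCV dCV KL).
have K1 := Op_idealr KL (Op_mul EP_dC).
rewrite (sm_Diag EP_dC EP_dCV dCV K1).
by exists (fun x => L (fun n => dC n * (dC n * x n))) => //; exact: Op_idealr K1 (Op_mul EP_dC).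
Qed.

(** The empty product is the identity, which is not a finite matrix, hence the count n.+1. *)
Lemma Sop_big n (f : 'I_n.+1 -> operator HS) : (forall i, Sop set0 (f i)) ->
  Sop set0 (\big[@op_comp R HS/graph id]_(i < n.+1) f i).
Proof.
elim: n f => [|n ih] f Sf; rewrite big_ord_recl.
  by rewrite big_ord0 sm_id_restr.
by apply: Sop_ideall; [exact: Sop0|exact: ih].
Qed.

Lemma s_inv_Alg b : AA b -> AA (s_inv AA ss b).
Proof. by move=> [M Mb]; exists (twist (-1) M); exact: s_inv_rep. Qed.

(** Since m > 0, at least one factor is an iterated difference of a twisted commutator, hence a
    finite matrix; the ideal absorbs the phase, a_0 and the power of |DD|. *)
Lemma ansatz_Sop m (a : 'I_m.+1 -> HS -> HS) (k : {ffun 'I_m -> nat}) : (0 < m)%N ->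
  (forall i, AA (a i)) -> Sop set0 (ansatz_operator AA DDop ss absT a k).
Proof.
move=> m0 Aa; rewrite /ansatz_operator.
apply: Sop_ideall; first exact: Sop_phase.
have [L La] := Aa ord0.
apply: Sop_ideall.
  by exists L; [exact: OpK_setT La.1|exact: Sop_rep].
apply: Sop_idealr; last exact: Sop_zpow.
have H (i : 'I_m) : Sop set0 (iter (k i) (Psi_diff DDop absT) (op_restr (smooth_domain absT)
    (twisted_comm DDop ss (iter (psum k i).*2.+1 (s_inv AA ss) (a (lift ord0 i)))))).
  elim: (k i) => [|n ih] /=; last exact: Psi_diff_Sop.
  have : AA (iter (psum k i).*2.+1 (s_inv AA ss) (a (lift ord0 i))).
    by elim: _.*2.+1 => [|j ihj] //=; exact: s_inv_Alg.
  by move=> [M /Sop_comm].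
case: m m0 a k Aa La H => // m _ a k _ _ H.
exact: (Sop_big H).
Qed.

End Smooth.

(** * Dimension spectrum, ansatz and index pairing *)

Section DimensionSpectrum.
Context {R : realType}.
Local Notation V := (@ell2 R int).
Local Notation HS := (@ell2_hilbert R int).
Local Notation sq := (int -> R[i]).
Local Notation AA := (@Alg R).
Local Notation ss := (@sAlg R).
Local Notation absT := (@absT R).
Local Notation DDop := (@DDop R).
Implicit Types (X Y : operator HS) (L M : sq -> sq).

Lemma measurable_cos : measurable_fun setT (@cos R).
Proof. by apply: continuous_measurable_fun; exact: continuous_cos. Qed.

Lemma measurable_sin : measurable_fun setT (@sin R).
Proof. by apply: continuous_measurable_fun; exact: continuous_sin. Qed.

Lemma measurable_cpow (u : R[i]) : is_measurable (fun t : R => cpow t u).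
Proof.
have mb : measurable_fun setT (fun t : R => 0 < t).
  by apply: measurable_fun_ltr; [exact: measurable_cst|exact: measurable_id].
have mln := @measurable_ln R.
have mR : measurable_fun setT (fun t : R => expR (complex.Re u * ln t)).
  apply: measurableT_comp; first exact: measurable_expR.
  by apply: measurable_funM => //; exact: measurable_cst.
have mI : measurable_fun setT (fun t : R => complex.Im u * ln t).
  by apply: measurable_funM => //; exact: measurable_cst.
have uE t : u * (ln t)%:C%C = ((complex.Re u * ln t) +i* (complex.Im u * ln t))%C.
  by case: (u) => a b; apply: ReIm_eq => /=; ring.
split.
  have -> : (fun t => complex.Re (cpow t u)) =
      fun t => if 0 < t then expR (complex.Re u * ln t) * cos (complex.Im u * ln t) else 0.
    by apply/funext => t; rewrite /cpow; case: ifP => // _; rewrite uE.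
  apply: measurable_fun_ifT => //.
  by apply: measurable_funM => //; apply: measurableT_comp mI; exact: measurable_cos.
have -> : (fun t => complex.Im (cpow t u)) =
    fun t => if 0 < t then expR (complex.Re u * ln t) * sin (complex.Im u * ln t) else 0.
  by apply/funext => t; rewrite /cpow; case: ifP => // _; rewrite uE.
apply: measurable_fun_ifT => //.
by apply: measurable_funM => //; apply: measurableT_comp mI; exact: measurable_sin.
Qed.

Lemma fcalc_zw (z : R[i]) : is_fcalc absT (fun t => cpow t (- (2 * z))) (Diag (zw z)).
Proof.
have := @fcalc_diag R _ _ nu_bij (ew 1) (fun t => cpow t (- (2 * z))) (measurable_cpow _).
suff -> : (fun n => cpow (ew 1 n) (- (2 * z))) = zw z by [].
apply/funext => n; rewrite /cpow ew_gt0 /ew expRK mul1r /zw; congr cexp.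
by rewrite rmorph_nat.
Qed.

(** In the basis e_n the n-th diagonal entry of L |DD|^{-2z} is that of L times [zw z n], so
    [EP_zeta] applies. All exponents give the dimension spectrum, no exponents the vanishing of the
    residues. *)
Lemma Sop_zeta K X : Sop K X -> exists2 Z : R[i]^o -> R[i]^o, is_zeta absT X Z &
  forall z, ~ SdK K z -> holomorphic_at Z z.
Proof.
move=> [L KL ->]; have [Z [mZ hZ [r rP]]] := EP_zeta (Op_diag KL).
exists Z => //; split => //; have [r' r'0 r'P] := trace_op KL.
exists (Num.max r r') => z; rewrite gt_max => /andP[rz rz'].
have [sL eL] := rP z rz; have [l2L sch] := r'P z rz'.
exists (Diag (zw z)); first exact: fcalc_zw.
(* [a] is the everywhere defined bounded extension; the composition itself is defined only on
   vectors that |DD|^{-2z} sends into the smooth domain. *)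
pose a : HS -> HS := seqop (fun x => L (fun n => zw z n * x n)).
have aE (x : V) n : (a x : V) n = L (fun n => zw z n * x n) n by apply: seqopE; exact: l2L.
exists a; split.
- apply: ell2_dense => s x xs.
  have rx : rapid (fun n => zw z n * x n).
    by apply: (@rapid_fin _ s) => n /xs ->; rewrite mulr0.
  have ry := rapid_Op KL rx.
  exists (mkl2 (rapid_l2 ry) : V), (mkl2 (rapid_l2 rx) : V) => //=.
- move=> [x y]; rewrite /op_comp /graph /= => -[u uE [_ yE]].
  apply: ell2_ext => n; rewrite yE aE; congr (L _ n).
  by apply/funext => m; exact: uE.
- split; first exact: sch aE.
  exists int, (fun n => delta n); split; first exact: delta_onb.
  have -> : (fun i => ip (a (delta i)) (delta i) : R[i]^o) =
      fun n => L (fun j => (j == n)%:R) n * zw z n.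
    apply/funext => n; rewrite ip_delta aE.
    exact: etrans (Op_delta KL _ _ _) (mulrC _ _).
  by rewrite -eL; exact: csumm_sums_to.
Qed.

Lemma dimension_spectrum : discrete_dimension_spectrum AA DDop ss.
Proof.
exists absT; split; first exact: abs_DD.
exists Sd; split; first exact: Sd_discrete.
move=> X /Psi_Sop SX; have [Z zZ hZ] := Sop_zeta SX.
by exists Z => // z nz; apply: hZ => -[k _ kz]; apply: nz; exists k.
Qed.

(** The continuation is entire as [SdK set0] is empty, so z^j times it serves as the regular part
    and the principal part is zero. *)
Lemma tau_smoothing j X : Sop set0 X -> is_tau absT j X 0.
Proof.
move=> SX; have [Z zZ hZ] := Sop_zeta SX.
exists Z => //.
have hZ0 : holomorphic_at Z 0 by apply: hZ => -[].
exists 0%N, (fun=> 0), (fun z => z ^+ j * Z z); split; last by [].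
- have hj : holomorphic_at (fun z : R[i]^o => z ^+ j) 0.
    exact: (@holomorphicX R (fun z => z) j 0 (@holomorphic_id R 0)).
  exact: (@holomorphicM R (fun z => z ^+ j) Z 0 hj hZ0).
- by apply: near_punctured => z; rewrite big1 ?add0r// => k _; rewrite mul0r.
Qed.

Lemma ansatz_zero m (a : 'I_m.+1 -> HS -> HS) : odd m -> (forall i, AA (a i)) ->
  ansatz_value AA DDop ss a 0.
Proof.
move=> om Aa; have m0 : (0 < m)%N by case: m om a Aa.
exists absT; split; first exact: abs_DD.
exists (fun _ _ => 0); split.
  by move=> k j; apply: tau_smoothing; exact: ansatz_Sop.
have [s0 e0] := @csum_fin R {ffun 'I_m -> nat} (fun=> 0) [::] isT (fun _ _ => erefl).
have := csumm_sums_to s0; rewrite e0 big_nil.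
congr (sums_to _ _); apply/funext => k.
by rewrite /ansatz_term big1 ?mulr0// => j _; rewrite mulr0.
Qed.

End DimensionSpectrum.

(** * The index of the unilateral shift *)

Section Pairing.
Context {R : realType}.
Local Notation V := (@ell2 R int).
Local Notation HS := (@ell2_hilbert R int).
Local Notation FF := (@Fop R).

Definition shiftop (d : int) : HS -> HS := seqop (fun x n => 1 * x (n + d)).

Lemma shift_rep d : represents (fun x n => 1 * x (n + d)) (shiftop d).
Proof. by apply: seqop_rep; apply: Op_gen; exact: EP_const. Qed.

Lemma shiftopE d (x : V) n : (shiftop d x : V) n = x (n + d).
Proof. by rewrite (shift_rep d).2 mul1r. Qed.

Lemma shift_adj d : is_adjoint (shiftop d) (shiftop (- d)).
Proof.
move=> x y; rewrite !ip_ell2 -[RHS](csum_reindex _ (bij_shift d)); congr csum.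
by apply/funext => n; rewrite /= !shiftopE addrK.
Qed.

Lemma pos_projE (x : V) n : (pos_proj FF x : V) n = if 0 <= n then x n else 0.
Proof.
rewrite /pos_proj ell2ZE ell2DE FopE /sgnC; case: ifP => _.
  by field.
by rewrite mulN1r addNr mulr0.
Qed.

Lemma hardyE (v : {ffun 'I_1 -> HS}) : hardy FF v <->
  forall n : int, n < 0 -> (v ord0 : V) n = 0.
Proof.
split=> [Hv n n0|Hv i]; first by rewrite -(Hv ord0) pos_projE leNgt n0.
by apply: ell2_ext => n; rewrite pos_projE (ord1 i); case: ltP => // /Hv ->.
Qed.

(** It maps e_n to e_{n+1}, so its compression to n >= 0 is injective with range of codimension
    one. *)
Definition bilateral_shift : 'I_1 -> 'I_1 -> HS -> HS := fun _ _ => shiftop (-1).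

Lemma toeplitzE (v : {ffun 'I_1 -> HS}) (n : int) :
  (toeplitz FF bilateral_shift v ord0 : V) n = if 1 <= n then (v ord0 : V) (n - 1) else 0.
Proof.
rewrite /toeplitz ffunE big_ord1 pos_projE shiftopE pos_projE.
have [n1|n1] := lerP 1 n; first by rewrite !ifT//; lia.
by case: ifP => // n0; rewrite ifF//; lia.
Qed.

Lemma pairing : pairs_nontrivially (@Alg R) FF.
Proof.
exists 1%N, bilateral_shift, (- 1%:Z); split => //.
- by move=> i j; exists (fun x n => 1 * x (n + -1)); exact: shift_rep.
- exists (fun _ _ => shiftop 1); split.
  + by move=> i j; exact: (shift_adj (-1)).
  + move=> i j x; rewrite big_ord1 !ord1 eqxx; apply: ell2_ext => n.
    by rewrite !shiftopE addrNK.
  + move=> i j x; rewrite big_ord1 !ord1 eqxx; apply: ell2_ext => n.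
    by rewrite !shiftopE addrK.
exists 0%N, 1%N; split => //.
- exists (fun _ => 0); split; first by case.
  move=> v [/hardyE Hv Tv]; exists [ffun=> 0]; split; last first.
    by move=> c _; apply/ffunP => -[].
  rewrite big_ord0 subr0 /=; apply/ffunP => i; rewrite (ord1 i) ffunE.
  apply: ell2_ext => n; have [n0|/Hv ->//] := lerP 0 n.
  (* For n >= 0 the value of the compression at n + 1 is v at n, so a vector in the kernel
     vanishes. *)
  have := toeplitzE v (n + 1); rewrite Tv ffunE ifT ?addrK//; lia.
- exists (fun _ => [ffun=> delta 0 : HS]); split.
    move=> _; apply/hardyE => n n0; rewrite ffunE deltaE.
    by case: eqP n0 => // ->; rewrite ltxx.
  move=> v /hardyE Hv.
  have vE (c : {ffun 'I_1 -> R[i]}) (n : int) :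
      ((v - \sum_i c i *: [ffun=> delta 0 : HS]) ord0 : V) n =
      (v ord0 : V) n - c ord0 * (n == 0)%:R.
    by rewrite big_ord1 !ffunE.
  (* Subtracting v(0) e_0 leaves the image of the backward shift of v. The coefficient is unique
     because every vector in the range vanishes at 0. *)
  exists [ffun=> (v ord0 : V) 0]; split.
    exists [ffun=> pos_proj FF (shiftop 1 (v ord0))].
      by apply/hardyE => n n0; rewrite ffunE pos_projE leNgt n0.
    apply/ffunP => i; rewrite (ord1 i); apply: ell2_ext => n.
    rewrite toeplitzE vE !ffunE pos_projE shiftopE subrK.
    have [->|nn] := eqVneq n 0; first by rewrite /= mulr1 subrr.
    rewrite mulr0 subr0; case: ifP => n1; first by rewrite ifT//; lia.
    by rewrite Hv//; lia.
  move=> c [t _ tE]; apply/ffunP => i; rewrite (ord1 i) ffunE.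
  have := vE c 0; rewrite -tE toeplitzE /= mulr1 => /eqP.
  by rewrite eq_sym subr_eq0 => /eqP.
Qed.

End Pairing.

Theorem theorem2 (R : realType) :
  exists (H : hilbert R) (D absD expD : operator H) (F : H -> H)
    (A : set (H -> H)) (s : (H -> H) -> (H -> H)),
    let DD := op_comp (graph F) expD in
    [/\ self_adjoint D, is_abs D absD, is_phase D absD F & is_exp absD expD] /\
    (forall a, A a ->
      graph (s a) = op_comp expD (op_comp (graph a) (op_inv expD))) /\
    [/\ twisted_spectral_triple A DD s, unital A, regular A DD s,
        finitely_summable DD & discrete_dimension_spectrum A DD s] /\
    pairs_nontrivially A F /\
    (forall m, odd m -> forall a : 'I_m.+1 -> H -> H, (forall i, A (a i)) ->
      ansatz_value A DD s a 0).
Proof.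
exists (@ell2_hilbert R int), (@Dop R), (@absDop R), (@absT R), (@Fop R), (@Alg R), (@sAlg R).
split; [|split; [|split; [|split]]].
- split; [exact: self_adjoint_Diag|exact: abs_D|exact: phase_D|exact: exp_absD].
- exact: sAlg_graph.
- split; [exact: triple|exact: unital_Alg|exact: regular_Alg|exact: summable_Alg|].
  exact: dimension_spectrum.
- exact: pairing.
- by move=> m om a Aa; exact: ansatz_zero.
Qed.
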